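(* For every $x>0$, the radius of convergence $z_*(x)$ of the power series $z\mapsto M(z,x)$ satisfies $$\frac92\sqrt{x}\ \le\ \frac1{z_*(x)}\ \le\ 48\max(1,x).$$
   Context: A planar map is a connected multigraph (loops and multiple edges allowed) drawn without crossings on the oriented 2-sphere, up to orientation-preserving homeomorphism; it is rooted if it has a distinguished oriented edge. A planar triangulation is a planar map with all faces of degree 3. An outerplanar triangulation of the $m$-gon is a rooted planar map with $m$ vertices whose face to the right of the root (the outer face) has degree $m$ and is incident to $m$ distinct vertices, and whose other faces have degree 3. $\mathcal O_n$ is the set of outerplanar triangulations with $2n$ vertices. $\mathcal P_n$ is the set of non-crossing pairings of $\{1,\dots,2n\}$ (no $a<b<a'<b'$ with $a$ paired to $a'$ and $b$ to $b'$). For $t\in\mathcal O_n$ and $\pi\in\mathcal P_n$, label the $2n$ edges of the outer face $1,\dots,2n$ clockwise from the root edge and orient them clockwise; $\mathsf{Glue}(t,\pi)$ is obtained by removing the outer face and gluing the paired edges with opposite orientations. This is a rooted planar triangulation with $n+1$ vertices with a distinguished spanning tree (the images of the outer edges) containing the root edge. Let $\mathcal S_n$ be the set of rooted planar triangulations with $n+1$ vertices decorated by a spanning tree containing the root edge. A planar triangulation is hierarchical if it can be obtained from the loopless triangulation with two triangles by repeatedly opening an edge into a 2-gon and inserting a pair of triangles glued along two of their sides (equivalently, every triangle has a companion with which it shares three distinct vertices); it is Apollonian if it can be obtained from the loopless triangulation with two triangles by repeatedly subdividing a triangle into three by inserting a vertex. $\mathcal H_n\subset\mathcal S_n$: hierarchical,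 with spanning tree containing no edge that belongs to a cycle of length 2. $\mathcal A_n\subset\mathcal S_n$: Apollonian. Define $$\mathcal M_n=\{(t,\pi_{\mathrm H},\pi_{\mathrm A})\in\mathcal O_n\times\mathcal P_n\times\mathcal P_n:\ \mathsf{Glue}(t,\pi_{\mathrm H})\in\mathcal H_n,\ \mathsf{Glue}(t,\pi_{\mathrm A})\in\mathcal A_n\},$$ $$M(z,x)=\sum_{n=1}^\infty z^nM_n(x),\qquad M_n(x)=\sum_{(t,\pi_{\mathrm H},\pi_{\mathrm A})\in\mathcal M_n}x^{N(\pi_{\mathrm H},\pi_{\mathrm A})},$$ where $N(\pi_{\mathrm H},\pi_{\mathrm A})$ is the number of loops of the meander system, i.e. the number of connected components of the graph on $\{1,\dots,2n\}$ whose edges are the pairs of $\pi_{\mathrm H}$ and the pairs of $\pi_{\mathrm A}$. *)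

(* Defs.v *)
From HB Require Import structures.
From mathcomp Require Import all_boot all_order all_fingroup all_algebra.
From mathcomp Require Import all_classical all_reals all_analysis.
Import Order.TTheory GRing.Theory Num.Theory.
Import numFieldNormedType.Exports.

Set Implicit Arguments.
Unset Strict Implicit.
Unset Printing Implicit Defensive.

(* Maps on oriented surfaces, up to orientation-preserving homeomorphism, are  *)
(* encoded by their darts (oriented edges): [opp] reverses a dart and [lnext d] *)
(* is the dart following [d] along the face lying to the left of [d], so that   *)
(* [lnext d] starts where [d] ends.                                             *)
Record cmap (D : finType) := CMap { opp : D -> D; lnext : D -> D }.

Section CombinatorialMaps.
Variables (D : finType) (M : cmap D).

(* [lnext M (opp M d)] is the next dart with the same origin as [d], so the   *)
(* vertex [vertex d] is the origin of [d], given as the set of its outgoing     *)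
(* darts; [face d] is the face to the left of [d].                              *)
Definition vrot (d : D) : D := lnext M (opp M d).
Definition vertex (d : D) : {set D} := finset (fconnect vrot d).
Definition face (d : D) : {set D} := finset (fconnect (lnext M) d).
Definition edge (d : D) : {set D} := finset (fconnect (opp M) d).

Definition vertices : {set {set D}} := vertex @: [set: D].
Definition faces : {set {set D}} := face @: [set: D].
Definition edges : {set {set D}} := edge @: [set: D].

(* A connected map is drawn on the sphere iff its Euler characteristic is 2.  *)
Definition planar_map : Prop :=
  [/\ involutive (opp M), forall d, opp M d != d, injective (lnext M),
      forall d e, connect [rel u v | (v == opp M u) || (v == lnext M u)] d e
    & #|vertices| + #|faces| = #|edges| + 2].

Definition planar_triangulation : Prop :=
  planar_map /\ forall d, #|face d| = 3.

(* Simple closed paths; the last condition only excludes going back and forth *)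
(* along one edge, and loops count as cycles of length 1.                       *)
Definition is_cycle (c : seq D) : bool :=
  [&& c != [::], path.cycle [rel d e | vertex (opp M d) == vertex e] c,
      uniq (map vertex c) & all (fun d => opp M d \notin c) c].

(* Sets of edges are encoded by [opp]-invariant sets of darts. *)
Definition spanning_tree (T : {set D}) : Prop :=
  [/\ forall d, (opp M d \in T) = (d \in T),
      forall d e, connect [rel u v | (vertex v == vertex u)
                                  || (u \in T) && (v == opp M u)] d e
    & forall c, is_cycle c -> ~~ all (mem T) c].

End CombinatorialMaps.

Definition isomorphic (D D' : finType) (M : cmap D) (M' : cmap D') : Prop :=
  exists f : D -> D', [/\ bijective f,
    {morph f : d / opp M d >-> opp M' d}
  & {morph f : d / lnext M d >-> lnext M' d}].

(* The loopless triangulation with two triangles: [(false, i)] goes from      *)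
(* vertex [i] to vertex [i + 1] and [(true, i)] is its reverse.                 *)
Definition two_triangles : cmap (bool * 'Z_3)%type :=
  CMap (fun d => (~~ d.1, d.2))
       (fun d => if d.1 then (true, d.2 - 1)%R else (false, d.2 + 1)%R).

Section TriangulationMoves.
Variables (D : finType) (M : cmap D).

(* The edge of [d] is opened into a 2-gon, filled by the two triangles        *)
(* [inr (false, _)] and [inr (true, _)]; their sides of index 0 face [d] and    *)
(* [opp M d], and their other sides are glued together at a new vertex, shared  *)
(* by the sides of index 1 and 2.                                               *)
Definition insert_pair (d : D) : cmap (D + bool * 'Z_3)%type :=
  CMap (fun u : D + bool * 'Z_3 => match u with
        | inl e => if e == d then inr (false, 0%R)
                   else if e == opp M d then inr (true, 0%R)
                   else inl (opp M e)
        | inr (b, i) => if i == 0%R then inl (if b then opp M d else d)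
                        else inr (~~ b, (- i)%R)
        end)
       (fun u : D + bool * 'Z_3 => match u with
        | inl e => inl (lnext M e)
        | inr (b, i) => inr (b, (i + 1)%R)
        end).

(* A vertex is inserted in the triangle to the left of [d], whose sides are   *)
(* [d_i = iter i (lnext M) d]; [inr (false, i)] goes from the new vertex to the *)
(* origin of [d_i] and [inr (true, i)] is its reverse.                          *)
Definition subdivide (d : D) : cmap (D + bool * 'Z_3)%type :=
  CMap (fun u : D + bool * 'Z_3 => match u with
        | inl e => inl (opp M e)
        | inr (b, i) => inr (~~ b, i)
        end)
       (fun u : D + bool * 'Z_3 => match u with
        | inl e => if e == d then inr (true, 1%R)
                   else if e == lnext M d then inr (true, 2%R)
                   else if e == lnext M (lnext M d) then inr (true, 0%R)
                   else inl (lnext M e)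
        | inr (true, i) => inr (false, (i - 1)%R)
        | inr (false, i) => inl (iter i (lnext M) d)
        end).

End TriangulationMoves.

Inductive hierarchical : forall D : finType, cmap D -> Prop :=
| hierarchical_base : hierarchical two_triangles
| hierarchical_insert (D : finType) (M : cmap D) (d : D) :
    hierarchical M -> hierarchical (insert_pair M d)
| hierarchical_iso (D D' : finType) (M : cmap D) (M' : cmap D') :
    isomorphic M M' -> hierarchical M -> hierarchical M'.

Inductive apollonian : forall D : finType, cmap D -> Prop :=
| apollonian_base : apollonian two_triangles
| apollonian_subdivide (D : finType) (M : cmap D) (d : D) :
    apollonian M -> apollonian (subdivide M d)
| apollonian_iso (D D' : finType) (M : cmap D) (M' : cmap D') :
    isomorphic M M' -> apollonian M -> apollonian M'.

Record rmap (D : finType) := RMap { rmap_map :> cmap D; root : D }.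

Definition risomorphic (D D' : finType) (t : rmap D) (t' : rmap D') : Prop :=
  exists f : D -> D', [/\ bijective f,
    {morph f : d / opp t d >-> opp t' d},
    {morph f : d / lnext t d >-> lnext t' d}
  & f (root t) = root t'].

Section DecoratedTriangulations.
Variables (n : nat) (D : finType) (s : rmap D) (T : {set D}).

(* [(s, T)] represents an element of S_n, H_n or A_n respectively. *)
Definition in_S : Prop :=
  [/\ planar_triangulation s, #|vertices s| = n.+1, spanning_tree s T
    & root s \in T].

Definition in_H : Prop :=
  [/\ in_S, hierarchical s
    & forall c d, is_cycle s c -> size c = 2 -> d \in c -> d \notin T].

Definition in_A : Prop := in_S /\ apollonian s.

End DecoratedTriangulations.

Section OuterplanarGluing.
Variables (D : finType) (t : rmap D).

(* The face to the right of the root. *)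
Definition outer : {set D} := face t (opp t (root t)).

Definition outerplanar (m : nat) : Prop :=
  [/\ planar_map t, #|vertices t| = m, #|outer| = m,
      #|vertex t @: outer| = m
    & forall d, d \notin outer -> #|face t d| = 3].

(* The edges of the outer face in clockwise order (with the outer face on      *)
(* their right), numbered from 0 starting at the root.                          *)
Definition side (i : nat) : D :=
  opp t (iter i (finv (lnext t)) (opp t (root t))).

Variables (n : nat) (pi : {perm 'I_n.*2}).

(* Gluing: the darts of the outer face are removed and the remaining dart     *)
(* [side i] of the [i]-th outer edge becomes the reverse of [side (pi i)]. The  *)
(* default values of [insubd] are never reached when [t] is an outerplanar      *)
(* triangulation with [2n >= 4] vertices.                                       *)
Definition glue_dart := {d : D | d \notin outer}.

Definition glue_map : cmap glue_dart :=
  CMap (fun u => insubd u (if [pick i : 'I_n.*2 | val u == side i] is Some i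
                           then side (pi i) else opp t (val u)))
       (fun u => insubd u (lnext t (val u))).

Definition glue_tree : {set glue_dart} :=
  finset (fun u => [exists i : 'I_n.*2, val u == side i]).

(* The root is preserved. It lies in the outer face only if [t] is the map    *)
(* with a single edge ([n = 1]), whose gluing is not a triangulation.           *)
Definition glue_in (P : forall E : finType, rmap E -> {set E} -> Prop) : Prop :=
  exists2 r : glue_dart, val r = root t & P _ (RMap glue_map r) glue_tree.

End OuterplanarGluing.

Definition noncrossing_pairing (n : nat) (pi : {perm 'I_n.*2}) : Prop :=
  [/\ involutive pi, forall i, pi i != i
    & forall a b : 'I_n.*2, ~ [/\ a < b, b < pi a & pi a < pi b]].

Definition loops (n : nat) (piH piA : {perm 'I_n.*2}) : nat :=
  n_comp [rel i j | (j == piH i) || (j == piA i)] predT.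

(* Rooted maps up to isomorphism, as classes of maps whose darts are numbered. *)
Definition numbered_rmap := {k : nat & rmap 'I_k}.

Definition rclass (u : numbered_rmap) : set numbered_rmap :=
  fun v => risomorphic (projT2 u) (projT2 v).

(* Euler's relation forces an outerplanar triangulation with [2n] vertices to *)
(* have [8n - 6] darts, so this set is finite.                                  *)
Definition meander_set (n : nat) :
    set (set numbered_rmap * {perm 'I_n.*2} * {perm 'I_n.*2}) :=
  fun p => exists u : numbered_rmap, let t := projT2 u in
    [/\ p = (rclass u, p.1.2, p.2), outerplanar t n.*2,
        noncrossing_pairing p.1.2 /\ noncrossing_pairing p.2,
        glue_in t p.1.2 (@in_H n) & glue_in t p.2 (@in_A n)].

Arguments meander_set : clear implicits.

Local Open Scope ring_scope.

Definition meander_poly (R : realType) (n : nat) (x : R) : R :=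
  \sum_(p \in meander_set n) x ^+ loops p.1.2 p.2.

(* The coefficients of [M(z, x)] as a power series in [z]. *)
Definition meander_coef (R : realType) (x : R) (n : nat) : R :=
  if n is 0 then 0 else meander_poly n x.

Definition radius_of_convergence (R : realType) (a : R^nat) : \bar R :=
  ereal_sup (fun r : \bar R =>
    exists2 z : R, r = `|z|%:E & cvgn (series (fun n => a n * z ^+ n))).

(* Main.v *)
(* Upper bound: a hierarchical triangulation is a tree of bundles of parallel  *)
(* edges, in which the spanning trees avoiding cycles of length 2 are recorded  *)
(* by finitely many local choices, so that there are at most [C n 12^n]         *)
(* decorated triangulations. Gluing is injective on pairs [(t, pi)], there are  *)
(* at most [4^n] noncrossing pairings, and a meander system has at most [n]     *)
(* loops.                                                                       *)
(*                                                                              *)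
(* Lower bound: a strip of triangles is a word in the letters top and bottom.   *)
(* Gluing the sides of a strip with equal labels, the insertion of [x x] with a *)
(* fresh label between two letters of the word inserts a pair of triangles, and *)
(* the replacement of a letter [y] by [x y x], where [x] is opposite to [y] and *)
(* has a fresh label, subdivides a triangle. There are three ways to combine    *)
(* two moves of each kind so as to replace one letter by five letters and to    *)
(* create exactly one loop, and in each case three of the five letters can be   *)
(* replaced again. The generating function of these meander systems satisfies   *)
(* [C = 1 + 3 (z^2 x) C^3], which has no solution when [z^2 x > 4/81].          *)
From HB Require Import structures.
From Pilot Require Import Defs.
From mathcomp Require Import all_boot all_order all_fingroup all_algebra.
From mathcomp Require Import all_classical all_reals all_analysis.
From mathcomp Require Import finmap.
From mathcomp Require Import fintype fingraph finset zify.
From mathcomp Require Import ring lra.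
Import Order.TTheory GRing.Theory Num.Theory.
Import numFieldNormedType.Exports.
Import Pilot.Defs.
Set Implicit Arguments.
Unset Strict Implicit.
Unset Printing Implicit Defensive.

(** Upper bound. Opening edges and inserting pairs of triangles never leaves the maps obtained from
    two triangles by widening each of the three sides into a [slot], a recursive bundle of parallel
    edges ([hierarchical_sclose]). A spanning tree with no edge on a cycle of length 2 is then one
    bit per leaf of the slots, and its connectedness and acyclicity force local conditions at each
    node ([slot_svalid]). The decorated slots satisfying them, split according to whether the tree
    joins their two ends, obey algebraic equations with a finite solution at [1/12], so that there
    are at most [138 n 12^n] rooted decorated triangulations ([count_hcodes]). Gluing can be undone,
    because the contour of the tree is the former outer face ([glue_inj]). The Apollonian pairing
    contributes a factor [4^n] ([count_noncrossing]) and a meander has at most [n] loops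
    ([loops_le]). The coefficients are thus at most [138 n (48 max(1, x))^n], and [inv_radius_le]
    concludes.

    Lower bound. It suffices to exhibit many meanders. Take outerplanar triangulations that are
    strips of triangles. Such a strip is a word, each triangle having one side on the top or on the
    bottom boundary, and sides with equal labels are glued. On words, a hierarchical insertion adds
    two adjacent letters with the same fresh label ([strip_insert]), and a subdivision replaces [y]
    by [x y x] with [x] on the other boundary ([strip_subdivide]). A labelled word determines its
    glued triangulation ([strip_iso]), so words made by these moves yield elements of [H_n] and
    [A_n] after gluing ([glue_in_Hgood], [glue_in_Agood]).

    Two moves of each kind can replace one letter by the same five letters in both words, raising
    [n] by 2 and the number of loops by 1 ([good_step]). There are three such expansions, each with
    three letters that are expanded again, so the family is indexed by ternary trees with three
    kinds of nodes. The tree can be read back from the meander, since the relative positions of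
    partners form a prefix code ([gent_prefix], [code_meander_inj]). With weight [q = z^2 x] per
    node, the sums over trees of bounded height iterate [S -> 1 + 3 q S^3] and are unbounded when
    [q > 4/81] ([sum_codes_ge]), which excludes convergence at [|z| > 2 / (9 sqrt x)]. *)

(** * Orbits as the cells of a map, and their number *)

Section Orbits.
Variables (D : finType) (g : D -> D).
Hypothesis gI : injective g.

Definition orb (d : D) : {set D} := finset (fconnect g d).

Lemma in_orb d e : (e \in orb d) = fconnect g d e.
Proof. by rewrite inE. Qed.

Lemma orb_eq d e : (orb d == orb e) = fconnect g d e.
Proof.
apply/eqP/idP => [E|h].
  by rewrite -in_orb E in_orb connect0.
apply/setP=> x; rewrite !in_orb.
exact: (same_connect (fconnect_sym gI) h).
Qed.

Lemma orb_step d : orb (g d) = orb d.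
Proof. by apply/esym/eqP; rewrite orb_eq fconnect1. Qed.

(** Orbits are counted by any complete invariant. The vertices of the maps constructed later are
    counted in this way. *)
Lemma card_orb_label (L : finType) (lab : D -> L) :
    (forall d, lab (g d) = lab d) ->
    (forall d e, lab d = lab e -> fconnect g d e) ->
  #|orb @: [set: D]| = #|lab @: [set: D]|.
Proof.
move=> h1 h2.
have key d e : orb d = orb e <-> lab d = lab e.
  split=> [/eqP|/h2 h]; last by apply/eqP; rewrite orb_eq.
  rewrite orb_eq => /connectP[p]; elim: p d => [|x p IH] d /= => [_ ->//|].
  by case/andP=> /eqP<- hp /(IH _ hp) <-; rewrite h1.
pose rep (X : {set D}) : option L := omap lab [pick x in X].
have repE d : rep (orb d) = Some (lab d).
  rewrite /rep; case: pickP => [x|/(_ d)]; last by rewrite in_orb connect0.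
  by rewrite in_orb -orb_eq => /eqP/key ->.
have -> : #|lab @: [set: D]| = #|Some @: (lab @: [set: D])|.
  by rewrite [RHS]card_imset // => ? ? [].
rewrite -(card_in_imset (f := rep) (D := mem (orb @: [set: D]))).
  apply: eq_card => x; apply/imsetP/imsetP.
    case=> X /imsetP[d _ ->] ->; rewrite repE; exists (lab d) => //.
    by apply/imsetP; exists d.
  case=> l /imsetP[d _ ->] ->; exists (orb d); last by rewrite repE.
  by apply/imsetP; exists d.
move=> X Y /imsetP[d _ ->] /imsetP[e _ ->]; rewrite !repE => -[].
by move/key.
Qed.

(** Orbits partition the darts. For edges, and for faces of known degree, this gives the number of
    cells from the number of darts. *)
Lemma sum_card_orb : \sum_(X in orb @: [set: D]) #|X| = #|D|.
Proof.
have hp : finset.partition (orb @: [set: D]) [set: D].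
  apply/and3P; split.
  - apply/eqP/setP=> d; rewrite inE; apply/finset.bigcupP; exists (orb d).
      by apply/imsetP; exists d.
    by rewrite in_orb connect0.
  - apply/finset.trivIsetP=> X Y /imsetP[d _ ->] /imsetP[e _ ->].
    rewrite -finset.setI_eq0 => h; apply/eqP/setP=> x; rewrite !inE.
    apply/negP=> /andP[h1 h2]; move/negP: h; apply; rewrite orb_eq.
    by apply: (connect_trans h1); rewrite fconnect_sym.
  - apply/negP=> /imsetP[d _ /setP/(_ d)]; by rewrite inE in_orb connect0.
by rewrite -cardsT (finset.card_partition hp).
Qed.

End Orbits.

(** * Invariance under isomorphism *)

Section OrbitMorphism.
Variables (D D' : finType) (g : D -> D) (g' : D' -> D') (f : D -> D').
Hypothesis fB : bijective f.
Hypothesis fg : {morph f : d / g d >-> g' d}.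

Lemma fconnect_morph d e : fconnect g' (f d) (f e) = fconnect g d e.
Proof.
have fiter n x : f (iter n g x) = iter n g' (f x).
  by elim: n => //= n <-; rewrite fg.
apply/idP/idP => [/iter_findex h|h].
  have /(bij_inj fB) <- : f (iter (findex g' (f d) (f e)) g d) = f e.
    by rewrite fiter.
  exact: fconnect_iter.
by rewrite -(iter_findex h) fiter; exact: fconnect_iter.
Qed.

Lemma orb_morph d : orb g' (f d) = f @: orb g d.
Proof.
case: fB => f' fK f'K.
apply/setP=> x; rewrite inE -(f'K x) fconnect_morph.
by rewrite mem_imset ?inE //; exact: bij_inj.
Qed.

Lemma card_orbs_morph : #|orb g' @: [set: D']| = #|orb g @: [set: D]|.
Proof.
have fI := bij_inj fB.
rewrite -(card_imset _ (imset_inj fI)); apply: eq_card => X.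
case: fB => f' fK f'K.
apply/imsetP/imsetP => [[d _ ->]|[Y /imsetP[d _ ->] ->]].
  exists (orb g (f' d)); first by apply/imsetP; exists (f' d).
  by rewrite -orb_morph f'K.
by exists (f d) => //; rewrite orb_morph.
Qed.

End OrbitMorphism.

Section MapMorphism.
Variables (D D' : finType) (M : cmap D) (M' : cmap D') (f : D -> D').
Hypothesis fB : bijective f.
Hypothesis fo : {morph f : d / opp M d >-> opp M' d}.
Hypothesis fn : {morph f : d / lnext M d >-> lnext M' d}.

Let fI := bij_inj fB.

Lemma morph_vrot : {morph f : d / vrot M d >-> vrot M' d}.
Proof. by move=> d; rewrite /vrot fn fo. Qed.

Lemma vertex_morph d : vertex M' (f d) = f @: vertex M d.
Proof. exact: (orb_morph fB morph_vrot). Qed.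

Lemma vertex_morph_eq d e : (vertex M' (f d) == vertex M' (f e)) = (vertex M d == vertex M e).
Proof. by rewrite !vertex_morph (inj_eq (imset_inj fI)). Qed.

Lemma card_vertices_morph : #|vertices M'| = #|vertices M|.
Proof. exact: (card_orbs_morph fB morph_vrot). Qed.

Lemma connect_morph (r : rel D) (r' : rel D') :
  (forall d e, r' (f d) (f e) = r d e) ->
  forall d e, connect r' (f d) (f e) = connect r d e.
Proof.
move=> h d e; apply/connectP/connectP => [[p hp he]|[p hp ->]].
  case: fB => f' fK f'K; exists (map f' p); last first.
    by apply: fI; rewrite he -(last_map f) (mapK f'K).
  elim: p d hp {he} => //= x p IH d /andP[h1 h2].
  by rewrite -h f'K h1 IH // f'K.
exists (map f p); last by rewrite last_map.
by elim: p d hp => //= x p IH d /andP[h1 /IH ->]; rewrite h h1.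
Qed.

Lemma planar_map_morph : planar_map M -> planar_map M'.
Proof.
have := fB => -[f' fK f'K] [h1 h2 h3 h4 h5]; split.
- by move=> d; rewrite -(f'K d) -!fo h1.
- by move=> d; rewrite -(f'K d) -fo (inj_eq fI).
- by move=> d e; rewrite -(f'K d) -(f'K e) -!fn => /fI/h3 ->.
- move=> d e; rewrite -(f'K d) -(f'K e) (@connect_morph [rel u v | (v == opp M u) || (v == lnext M u)]) //.
  by move=> x y /=; rewrite -fo -fn !(inj_eq fI).
- rewrite card_vertices_morph (card_orbs_morph fB fn : #|faces M'| = #|faces M|).
  by rewrite (card_orbs_morph fB fo : #|edges M'| = #|edges M|).
Qed.

Lemma card_face_morph d : #|face M' (f d)| = #|face M d|.
Proof. by rewrite (orb_morph fB fn d : face M' (f d) = f @: face M d) card_imset. Qed.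

Lemma planar_triangulation_morph : planar_triangulation M -> planar_triangulation M'.
Proof.
case=> h1 h2; split; first exact: planar_map_morph.
by case: fB => f' fK f'K d; rewrite -(f'K d) card_face_morph h2.
Qed.

Lemma is_cycle_morph c : is_cycle M' (map f c) = is_cycle M c.
Proof.
rewrite /is_cycle; congr [&& _, _, _ & _].
- by case: c.
- by rewrite cycle_map; apply: eq_cycle => x y /=; rewrite -fo vertex_morph_eq.
- rewrite -map_comp.
  have -> : map (vertex M' \o f) c = map (fun X : {set D} => f @: X) (map (vertex M) c).
    by rewrite -map_comp; apply: eq_map => x /=; rewrite vertex_morph.
  by rewrite map_inj_uniq //; exact: imset_inj.
- rewrite all_map; apply: eq_all => x /=.
  by rewrite -fo mem_map.
Qed.

Lemma spanning_tree_morph (T : {set D}) :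
  spanning_tree M T -> spanning_tree M' (f @: T).
Proof.
have := fB => -[f' fK f'K] [h1 h2 h3]; split.
- by move=> d; rewrite -(f'K d) -fo !mem_imset.
- move=> d e; rewrite -(f'K d) -(f'K e).
  rewrite (@connect_morph [rel u v | (vertex M v == vertex M u) || (u \in T) && (v == opp M u)]) //.
  by move=> x y /=; rewrite vertex_morph_eq -fo (inj_eq fI) mem_imset.
- move=> c; rewrite -[c](mapK f'K) is_cycle_morph => /h3; apply: contra.
  by rewrite all_map => /allP h; apply/allP=> x /h; rewrite /= mem_imset.
Qed.

End MapMorphism.

Lemma isomorphic_sym (D D' : finType) (M : cmap D) (M' : cmap D') :
  isomorphic M M' -> isomorphic M' M.
Proof.
case=> f [fB fo fn]; case: (fB) => g fK gK; exists g; split; first by exists f.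
  by move=> d; apply: (bij_inj fB); rewrite fo !gK.
by move=> d; apply: (bij_inj fB); rewrite fn !gK.
Qed.

Lemma isomorphic_trans (D D' D'' : finType) (M : cmap D) (M' : cmap D') (M'' : cmap D'') :
  isomorphic M M' -> isomorphic M' M'' -> isomorphic M M''.
Proof.
case=> f [fB fo fn] [g [gB go gn]]; exists (g \o f); split; first exact: bij_comp.
  by move=> d; rewrite /= fo go.
by move=> d; rewrite /= fn gn.
Qed.

Lemma risomorphic_refl (D : finType) (M : rmap D) : risomorphic M M.
Proof. by exists id; split=> //; exists id. Qed.

Lemma risomorphic_sym (D D' : finType) (M : rmap D) (M' : rmap D') :
  risomorphic M M' -> risomorphic M' M.
Proof.
case=> f [fB fo fn fr]; case: (fB) => g fK gK; exists g; split; first by exists f.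
- by move=> d; apply: (bij_inj fB); rewrite fo !gK.
- by move=> d; apply: (bij_inj fB); rewrite fn !gK.
- by rewrite -fr fK.
Qed.

Lemma risomorphic_trans (D D' D'' : finType) (M : rmap D) (M' : rmap D') (M'' : rmap D'') :
  risomorphic M M' -> risomorphic M' M'' -> risomorphic M M''.
Proof.
case=> f [fB fo fn fr] [g [gB go gn gr]]; exists (g \o f); split; first exact: bij_comp.
- by move=> d; rewrite /= fo go.
- by move=> d; rewrite /= fn gn.
- by rewrite /= fr gr.
Qed.

Section DecoratedMorphism.
Variables (n : nat) (D D' : finType) (s : rmap D) (s' : rmap D') (f : D -> D').
Hypothesis fB : bijective f.
Hypothesis fo : {morph f : d / opp s d >-> opp s' d}.
Hypothesis fn : {morph f : d / lnext s d >-> lnext s' d}.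
Hypothesis fr : f (root s) = root s'.
Variable T : {set D}.

Lemma in_S_morph : in_S n s T -> in_S n s' (f @: T).
Proof.
case=> h1 h2 h3 h4; split.
- exact: (planar_triangulation_morph fB fo fn).
- by rewrite (card_vertices_morph fB fo fn).
- exact: spanning_tree_morph.
- by rewrite -fr mem_imset //; exact: bij_inj.
Qed.

Lemma in_H_morph : in_H n s T -> in_H n s' (f @: T).
Proof.
case=> h1 h2 h3; split; first exact: in_S_morph.
  by apply: (hierarchical_iso _ h2); exists f.
have := fB => -[f' fK f'K] c d; rewrite -[c](mapK f'K) (is_cycle_morph fB fo fn).
rewrite size_map -(f'K d) (mem_map (bij_inj fB)) (mem_imset _ _ (bij_inj fB)).
exact: h3.
Qed.

Lemma in_A_morph : in_A n s T -> in_A n s' (f @: T).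
Proof.
case=> h1 h2; split; first exact: in_S_morph.
by apply: (apollonian_iso _ h2); exists f.
Qed.

End DecoratedMorphism.

(** * Hierarchical triangulations as trees of slots *)

(* [N X Y R] is a bundle of parallel edges: a first edge, then a pair of       *)
(* triangles whose two other sides are the slots [X] and [Y], then the          *)
(* remaining bundle [R].                                                        *)
Inductive slot := L | N of slot & slot & slot.

Fixpoint sdart (c : slot) : finType :=
  match c with
  | L => bool
  | N X Y R => (bool + (sdart X + (sdart Y + sdart R)))%type
  end.

Fixpoint nnodes (c : slot) : nat :=
  match c with L => 0 | N X Y R => (nnodes X + nnodes Y + nnodes R).+1 end.

(** [slft] and [srgt] are the two darts that face the outside of the slot. They join its two ends in
    opposite directions. *)
Fixpoint slft (c : slot) : sdart c :=
  match c with L => true | N X Y R => inl true end.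

Fixpoint srgt (c : slot) : sdart c :=
  match c with L => false | N X Y R => inr (inr (inr (srgt R))) end.

Fixpoint sopp (c : slot) : sdart c -> sdart c :=
  match c with
  | L => negb
  | N X Y R => fun d => match d with
    | inl b => inl (~~ b)
    | inr (inl x) => inr (inl (sopp x))
    | inr (inr (inl y)) => inr (inr (inl (sopp y)))
    | inr (inr (inr r)) => inr (inr (inr (sopp r)))
    end
  end.

(* [None] on the two outer darts [slft c] and [srgt c], whose successors lie    *)
(* outside of the slot.                                                         *)
Fixpoint snxt (c : slot) : sdart c -> option (sdart c) :=
  match c with
  | L => fun _ => None
  | N X Y R => fun d => match d with
    | inl b => if b then None else Some (inr (inl (slft X)))
    | inr (inl x) => Some (
        if snxt x is Some x' then inr (inl x')
        else if x == slft X then inr (inr (inl (slft Y)))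
        else inr (inr (inr (slft R))))
    | inr (inr (inl y)) => Some (
        if snxt y is Some y' then inr (inr (inl y'))
        else if y == slft Y then inl false
        else inr (inl (srgt X)))
    | inr (inr (inr r)) =>
        if snxt r is Some r' then Some (inr (inr (inr r')))
        else if r == slft R then Some (inr (inr (inl (srgt Y))))
        else None
    end
  end.

Lemma card_sdart c : #|sdart c| = 2 + 6 * nnodes c.
Proof.
elim: c => [|X hX Y hY R hR] /=; first exact: card_bool.
rewrite !card_sum card_bool hX hY hR; lia.
Qed.

Lemma slft_neq_srgt c : (slft c == srgt c) = false.
Proof. by case: c. Qed.

Lemma soppK c : involutive (@sopp c).
Proof.
elim: c => [|X hX Y hY R hR] /=; first by case.
by case=> [[]|[x|[y|r]]] //=; rewrite ?hX ?hY ?hR.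
Qed.

Lemma snxt_lft c : snxt (slft c) = None.
Proof. by case: c. Qed.

Lemma snxt_rgt c : snxt (srgt c) = None.
Proof.
by elim: c => [|X hX Y hY R hR] //=; rewrite hR eq_sym slft_neq_srgt.
Qed.

Lemma snxt_None c (d : sdart c) : snxt d = None -> d != slft c -> d = srgt c.
Proof.
elim: c d => [|X hX Y hY R hR] /=; first by case.
case=> [[]|[x|[y|r]]] //=.
case E: (snxt r) => //; case: eqP => // /eqP h _ _.
by rewrite (hR _ E h).
Qed.

Lemma Z3P (P : 'Z_3 -> Prop) : P 0%R -> P 1%R -> P 2%R -> forall i, P i.
Proof.
move=> h0 h1 h2 [[|[|[|]]] // h].
- by rewrite (_ : Ordinal h = 0%R) //; apply: val_inj.
- by rewrite (_ : Ordinal h = 1%R) //; apply: val_inj.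
- by rewrite (_ : Ordinal h = 2%R) //; apply: val_inj.
Qed.

Definition insert_nxt (c : slot) (u : sdart c + bool * 'Z_3) : option (sdart c + bool * 'Z_3) :=
  match u with
  | inl e => omap inl (snxt e)
  | inr (b, i) => Some (inr (b, (i + 1)%R))
  end.

(** The opposites in [insert_pair] depend only on the opposites of the map, so any successor
    function, here [id], will do. *)
Definition insert_opp (c : slot) (d : sdart c) :=
  opp (insert_pair (CMap (@sopp c) id) d).

(** The outer darts have to be preserved so that the new slot can take the place of the old one
    inside a larger map. *)
Definition slot_insert (c : slot) (d : sdart c) (c' : slot)
    (h : sdart c + bool * 'Z_3 -> sdart c') : Prop :=
  [/\ injective h, nnodes c' = (nnodes c).+1,
      h (inl (slft c)) = slft c' /\ h (inl (srgt c)) = srgt c',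
      forall u, h (insert_opp d u) = sopp (h u)
    & forall u, omap h (insert_nxt u) = snxt (h u)].

(** Places the six new darts in a node whose two inner slots are single edges. The bit [s] exchanges
    the two triangles, since the chosen dart may lie on either side of the opened edge. *)
Definition pair_dart (R : slot) (s : bool) (p : bool * 'Z_3) : sdart (N L L R) :=
  let (b, i) := p in
  if b (+) s then
    (if i == 0%R then inr (inr (inr (slft R)))
     else if i == 1%R then inr (inr (inl false)) else inr (inl false))
  else
    (if i == 0%R then inl false
     else if i == 1%R then inr (inl true) else inr (inr (inl true))).

Ltac z3 := rewrite ?/insert_opp /=; repeat match goal with i : _ |- _ => elim/Z3P: i; rewrite /=; try done end.

Lemma inl_eq (A B : eqType) (a b : A) : (inl a == inl b :> A + B) = (a == b).
Proof. by []. Qed.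

(** Opening an edge stays within the grammar of slots: a leaf becomes a node, the first edge of a
    node gains a new node in front of the old one, and any other edge belongs to one of the three
    subslots. *)
Lemma slot_insert_ex c (d : sdart c) : exists c' h, @slot_insert c d c' h.
Proof.
elim: c d => [|X hX Y hY R hR] d.
- exists (N L L L).
  exists (fun u : bool + bool * 'Z_3 => match u with
     | inl b => if b then inl true else inr (inr (inr false))
     | inr p => pair_dart L (~~ d) p end).
  split=> //.
  + by case: d; move=> [[]|[[] i]] [[]|[[] j]] //=; z3.
  + by case: d; case=> [[]|[[] i]] //=; z3.
  + by case: d; case=> [[]|[[] i]] //=; z3.
- case: d => [b|[x|[y|r]]].
  (* Of the two copies of the opened edge, one is the first edge of the new node and the other that
     of the old node, which is now the rest of the bundle. *)
  + exists (N L L (N X Y R)).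
    exists (fun u : sdart (N X Y R) + bool * 'Z_3 => match u with
     | inl (inl true) => inl true
     | inl e => inr (inr (inr e))
     | inr p => pair_dart (N X Y R) (~~ b) p end).
    split=> //=.
    * by case: b; move=> [[[]|[x|[y|r]]]|[[] i]] [[[]|[x'|[y'|r']]]|[[] j]] //=;
      try (by case=> ->); z3.
    * by case: b; case=> [[[]|[x|[y|r]]]|[[] i]] //=; z3.
    * by case: b; case=> [[[]|[x|[y|r]]]|[[] i]] //=; z3;
      try (by case: snxt => //=; case: eqP).
  + have [c' [h [h1 h2 [h3 h3'] h4 h5]]] := hX x.
    exists (N c' Y R).
    exists (fun u : sdart (N X Y R) + bool * 'Z_3 => match u with
     | inl (inl b) => inl b
     | inl (inr (inl z)) => inr (inl (h (inl z)))
     | inl (inr (inr z)) => inr (inr z)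
     | inr p => inr (inl (h (inr p))) end).
    split=> //=.
    * move=> [[b|[z|z]]|p] [[b'|[z'|z']]|p'] //=; try (by case=> ->);
      try (by case=> /h1 // [->]).
    * lia.
    * case=> [[[]|[z|[z|z]]]|p] //=.
      - rewrite -h4 /insert_opp /=.
        have e (a b : sdart X) : (inr (inl a) == inr (inl b) :> sdart (N X Y R)) = (a == b) by [].
        by rewrite !e; case: eqP => //; case: eqP.
      - by rewrite -h4 /insert_opp; case: p => b i /=; case: eqP => //; case: b.
    * case=> [[[]|[z|[z|z]]]|[b i]] //=.
      - by rewrite -h3.
      - have := h5 (inl z); rewrite /= => <-; case: (snxt z) => //=.
        by rewrite -h3 (inj_eq h1) inl_eq; case: eqP.
      - by case: snxt => //=; case: eqP => //= _; rewrite h3'.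
      - by case: snxt => //=; case: eqP.
      - by rewrite -h5.
  + have [c' [h [h1 h2 [h3 h3'] h4 h5]]] := hY y.
    exists (N X c' R).
    exists (fun u : sdart (N X Y R) + bool * 'Z_3 => match u with
     | inl (inl b) => inl b
     | inl (inr (inl z)) => inr (inl z)
     | inl (inr (inr (inl z))) => inr (inr (inl (h (inl z))))
     | inl (inr (inr (inr z))) => inr (inr (inr z))
     | inr p => inr (inr (inl (h (inr p)))) end).
    split=> //=.
    * move=> [[b|[z|[z|z]]]|p] [[b'|[z'|[z'|z']]]|p'] //=; try (by case=> ->);
      try (by case=> /h1 // [->]).
    * lia.
    * case=> [[[]|[z|[z|z]]]|p] //=.
      - rewrite -h4 /insert_opp /=.
        have e (a b : sdart Y) : (inr (inr (inl a)) == inr (inr (inl b)) :> sdart (N X Y R)) = (a == b) by [].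
        by rewrite !e; case: eqP => //; case: eqP.
      - by rewrite -h4 /insert_opp; case: p => b i /=; case: eqP => //; case: b.
    * case=> [[[]|[z|[z|z]]]|[b i]] //=.
      - by case: snxt => //=; case: eqP => //= _; rewrite h3.
      - have := h5 (inl z); rewrite /= => <-; case: (snxt z) => //=.
        by rewrite -h3 (inj_eq h1) inl_eq; case: eqP.
      - by case: snxt => //=; case: eqP => //= _; rewrite h3'.
      - by rewrite -h5.
  + have [c' [h [h1 h2 [h3 h3'] h4 h5]]] := hR r.
    exists (N X Y c').
    exists (fun u : sdart (N X Y R) + bool * 'Z_3 => match u with
     | inl (inl b) => inl b
     | inl (inr (inl z)) => inr (inl z)
     | inl (inr (inr (inl z))) => inr (inr (inl z))
     | inl (inr (inr (inr z))) => inr (inr (inr (h (inl z))))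
     | inr p => inr (inr (inr (h (inr p)))) end).
    split=> //=.
    * move=> [[b|[z|[z|z]]]|p] [[b'|[z'|[z'|z']]]|p'] //=; try (by case=> ->);
      try (by case=> /h1 // [->]).
    * lia.
    * by rewrite h3'.
    * case=> [[[]|[z|[z|z]]]|p] //=.
      - rewrite -h4 /insert_opp /=.
        have e (a b : sdart R) : (inr (inr (inr a)) == inr (inr (inr b)) :> sdart (N X Y R)) = (a == b) by [].
        by rewrite !e; case: eqP => //; case: eqP.
      - by rewrite -h4 /insert_opp; case: p => b i /=; case: eqP => //; case: b.
    * case=> [[[]|[z|[z|z]]]|[b i]] //=.
      - by case: snxt => //=; case: eqP => //= _; rewrite h3.
      - by case: snxt => //=; case: eqP.
      - have := h5 (inl z); rewrite /= => <-; case: (snxt z) => //=.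
        by rewrite -h3 (inj_eq h1) inl_eq; case: eqP.
      - by rewrite -h5.
Qed.

Section Closing.
Variables X Y Z : slot.

Definition sclose_dart : finType := (sdart X + (sdart Y + sdart Z))%type.

(** Two triangles glued along their three sides, where each side is widened into a slot. *)
Definition sclose : cmap sclose_dart :=
  CMap (fun u : sclose_dart => match u with
        | inl x => inl (sopp x)
        | inr (inl y) => inr (inl (sopp y))
        | inr (inr z) => inr (inr (sopp z))
        end)
       (fun u : sclose_dart => match u with
        | inl x => if snxt x is Some x' then inl x'
                   else if x == slft X then inr (inl (slft Y)) else inr (inr (srgt Z))
        | inr (inl y) => if snxt y is Some y' then inr (inl y')
                   else if y == slft Y then inr (inr (slft Z)) else inl (srgt X)
        | inr (inr z) => if snxt z is Some z' then inr (inr z')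
                   else if z == slft Z then inl (slft X) else inr (inl (srgt Y))
        end).

Lemma card_sclose_dart : #|sclose_dart| = 6 + 6 * (nnodes X + nnodes Y + nnodes Z).
Proof. rewrite !card_sum !card_sdart; lia. Qed.

End Closing.

Lemma card_pair_dart : #|{: bool * 'Z_3}| = 6.
Proof. by rewrite card_prod card_bool card_ord. Qed.

Lemma sclose_insert X Y Z (d : sclose_dart X Y Z) :
  exists X' Y' Z', isomorphic (insert_pair (sclose X Y Z) d) (sclose X' Y' Z').
Proof.
case: d => [x|[y|z]].
- have [c' [h [h1 h2 [h3 h3'] h4 h5]]] := slot_insert_ex x.
  exists c', Y, Z.
  exists (fun u : sclose_dart X Y Z + bool * 'Z_3 => match u with
     | inl (inl z) => inl (h (inl z))
     | inl (inr z) => inr z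
     | inr p => inl (h (inr p)) end).
  split=> //=.
  + apply: inj_card_bij; last by rewrite [leqRHS]card_sum !card_sclose_dart card_pair_dart h2; lia.
    move=> [[b|[z|z]]|p] [[b'|[z'|z']]|p'] //=; try (by case=> ->);
      try (by case=> /h1 // [->]).
  + case=> [[z|[z|z]]|p] //=.
    - rewrite -h4 /insert_opp /=.
      have e (a b : sdart X) : (inl a == inl b :> sclose_dart X Y Z) = (a == b) by [].
      by rewrite !e; case: eqP => //; case: eqP.
    - by rewrite -h4 /insert_opp; case: p => b i /=; case: eqP => //; case: b.
  + case=> [[z|[z|z]]|[b i]] //=.
    - have := h5 (inl z); rewrite /= => <-; case: (snxt z) => //=.
      by rewrite -h3 (inj_eq h1) inl_eq; case: eqP.
    - by case: snxt => //=; case: eqP => //= _; rewrite h3'.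
    - by case: snxt => //=; case: eqP => //=; rewrite h3.
    - by rewrite -h5.
- have [c' [h [h1 h2 [h3 h3'] h4 h5]]] := slot_insert_ex y.
  exists X, c', Z.
  exists (fun u : sclose_dart X Y Z + bool * 'Z_3 => match u with
     | inl (inl z) => inl z
     | inl (inr (inl z)) => inr (inl (h (inl z)))
     | inl (inr (inr z)) => inr (inr z)
     | inr p => inr (inl (h (inr p))) end).
  split=> //=.
  + apply: inj_card_bij; last by rewrite [leqRHS]card_sum !card_sclose_dart card_pair_dart h2; lia.
    move=> [[b|[z|z]]|p] [[b'|[z'|z']]|p'] //=; try (by case=> ->);
      try (by case=> /h1 // [->]).
  + case=> [[z|[z|z]]|p] //=.
    - rewrite -h4 /insert_opp /=.
      have e (a b : sdart Y) : (inr (inl a) == inr (inl b) :> sclose_dart X Y Z) = (a == b) by [].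
      by rewrite !e; case: eqP => //; case: eqP.
    - by rewrite -h4 /insert_opp; case: p => b i /=; case: eqP => //; case: b.
  + case=> [[z|[z|z]]|[b i]] //=.
    - by case: snxt => //=; case: eqP => //= _; rewrite h3.
    - have := h5 (inl z); rewrite /= => <-; case: (snxt z) => //=.
      by rewrite -h3 (inj_eq h1) inl_eq; case: eqP.
    - by case: snxt => //=; case: eqP => //= _; rewrite h3'.
    - by rewrite -h5.
- have [c' [h [h1 h2 [h3 h3'] h4 h5]]] := slot_insert_ex z.
  exists X, Y, c'.
  exists (fun u : sclose_dart X Y Z + bool * 'Z_3 => match u with
     | inl (inl z) => inl z
     | inl (inr (inl z)) => inr (inl z)
     | inl (inr (inr z)) => inr (inr (h (inl z)))
     | inr p => inr (inr (h (inr p))) end).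
  split=> //=.
  + apply: inj_card_bij; last by rewrite [leqRHS]card_sum !card_sclose_dart card_pair_dart h2; lia.
    move=> [[b|[y|y]]|p] [[b'|[y'|y']]|p'] //=; try (by case=> ->);
      try (by case=> /h1 // [->]).
  + case=> [[y|[y|y]]|p] //=.
    - rewrite -h4 /insert_opp /=.
      have e (a b : sdart Z) : (inr (inr a) == inr (inr b) :> sclose_dart X Y Z) = (a == b) by [].
      by rewrite !e; case: eqP => //; case: eqP.
    - by rewrite -h4 /insert_opp; case: p => b i /=; case: eqP => //; case: b.
  + case=> [[y|[y|y]]|[b i]] //=.
    - by case: snxt => //=; case: eqP => //= _; rewrite h3'.
    - by case: snxt => //=; case: eqP => //= _; rewrite h3.
    - have := h5 (inl y); rewrite /= => <-; case: (snxt y) => //=.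
      by rewrite -h3 (inj_eq h1) inl_eq; case: eqP.
    - by rewrite -h5.
Qed.

Lemma insert_pair_morph (D D' : finType) (M : cmap D) (M' : cmap D') (f : D -> D') d :
    bijective f -> {morph f : d / opp M d >-> opp M' d} ->
    {morph f : d / lnext M d >-> lnext M' d} ->
  isomorphic (insert_pair M d) (insert_pair M' (f d)).
Proof.
move=> fB fo fn; case: (fB) => g fK gK.
exists (fun u : D + bool * 'Z_3 => match u with inl e => inl (f e) | inr p => inr p end).
split.
- by exists (fun u : D' + bool * 'Z_3 => match u with inl e => inl (g e) | inr p => inr p end); case=> //= e; rewrite ?fK ?gK.
- case=> [e|[b i]] /=.
    by rewrite -fo !(inj_eq (can_inj fK)); case: eqP => // _; case: eqP => //; rewrite fo.
  by case: eqP => //; case: b; rewrite ?fo.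
- by case=> [e|[b i]] //=; rewrite fn.
Qed.

Lemma two_triangles_sclose : isomorphic two_triangles (sclose L L L).
Proof.
exists (fun u : bool * 'Z_3 => let b := ~~ u.1 in
  if u.2 == 0%R then inl b else if u.2 == 1%R then inr (inl b) else inr (inr b)).
split=> /=.
- apply: inj_card_bij; last by rewrite !card_sum card_bool card_pair_dart.
  by case=> [[] i] [[] j] /=; elim/Z3P: i; elim/Z3P: j.
- by case=> [[] i] /=; elim/Z3P: i.
- by case=> [[] i] /=; elim/Z3P: i.
Qed.

(** An insertion changes a single slot and leaves the two others alone, so this normal form survives
    every step of the inductive definition. *)
Theorem hierarchical_sclose (D : finType) (M : cmap D) :
  hierarchical M -> exists X Y Z, isomorphic M (sclose X Y Z).
Proof.
elim=> {D M} [|D M d _ [X [Y [Z [f [fB fo fn]]]]]|D D' M M' hM _ [X [Y [Z h]]]].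
- by exists L, L, L; exact: two_triangles_sclose.
- have [X' [Y' [Z' h]]] := sclose_insert (f d).
  exists X', Y', Z'; apply: isomorphic_trans h.
  exact: insert_pair_morph.
- exists X, Y, Z; apply: isomorphic_trans h; exact: isomorphic_sym.
Qed.

(** * Slots decorated by the edges of a tree *)

Inductive dslot := dL of bool | dN of dslot & dslot & dslot.

(** Only leaves are recorded. The first edges of nodes are never in the tree, by [slot_initfree], so
    that [P] can be recovered, by [deco_inj]. *)
Fixpoint deco (c : slot) : (sdart c -> bool) -> dslot :=
  match c with
  | L => fun P => dL (P true)
  | N X Y R => fun P => dN (deco (fun x : sdart X => P (inr (inl x))))
                           (deco (fun y : sdart Y => P (inr (inr (inl y)))))
                           (deco (fun r : sdart R => P (inr (inr (inr r)))))
  end.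

(* Are the two ends of the slot joined by edges of the tree inside the slot? *)
Fixpoint sconn (d : dslot) : bool :=
  match d with dL b => b | dN X Y R => (sconn X && sconn Y) || sconn R end.

Definition is_dL1 (d : dslot) : bool := if d is dL true then true else false.

(** At a node, the apex of the pair of triangles must be joined to an end of the slot, as it would
    be cut off otherwise; [X], [Y] and [R] must not be crossed all three, which would close a cycle;
    and if [R] is a single edge, it is not in the tree, being parallel to the first edge. *)
Fixpoint svalid (d : dslot) : bool :=
  match d with
  | dL _ => true
  | dN X Y R => [&& svalid X, svalid Y, svalid R, sconn X || sconn Y,
                    ~~ [&& sconn X, sconn Y & sconn R] & ~~ is_dL1 R]
  end.

Fixpoint initfree (c : slot) : (sdart c -> bool) -> Prop :=
  match c with
  | L => fun P => True
  | N X Y R => fun P => [/\ forall b, P (inl b) = false,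
        initfree (fun x : sdart X => P (inr (inl x))),
        initfree (fun y : sdart Y => P (inr (inr (inl y)))) &
        initfree (fun r : sdart R => P (inr (inr (inr r))))]
  end.

(* The colour of a dart tells on which side of the slot the tree leaves its     *)
(* origin.                                                                      *)
Lemma slot_colouring (c : slot) (P : sdart c -> bool) :
    (forall x, P (sopp x) = P x) -> initfree P -> ~~ sconn (deco P) ->
  exists col : sdart c -> bool,
    [/\ col (slft c) /\ ~~ col (srgt c),
        col (sopp (srgt c)) /\ ~~ col (sopp (slft c)),
        forall x, P x -> col (sopp x) = col x
      & forall x y, snxt (sopp x) = Some y -> col y = col x].
Proof.
elim: c P => [|X hX Y hY R hR] P hP /=.
  move=> _ /negbTE h; have h' : P false = false by rewrite -[RHS]h -(hP true).
  by exists id; split=> //= -[]; rewrite ?h ?h'.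
case=> h0 h1 h2 h3; rewrite negb_or => /andP[h4 h5].
have {hR h5} [cR [[r1 r2] [r3 r4] r5 r6]] := hR _ (fun r => hP (inr (inr (inr r)))) h3 h5.
have [cX [cY [[x1 x2] [y1 y2] [x3 y3] [x4 y4]]]] : exists (cX : sdart X -> bool) (cY : sdart Y -> bool),
   [/\ (cX (slft X) /\ cX (srgt X) = cY (slft Y)),
       (cY (srgt Y) = false /\ cY (sopp (slft Y)) = false),
       cX (sopp (srgt X)) /\ cX (sopp (slft X)) = cX (srgt X)
     & cY (sopp (srgt Y)) = cX (srgt X) /\
   [/\ forall x, P (inr (inl x)) -> cX (sopp x) = cX x,
       forall x, P (inr (inr (inl x))) -> cY (sopp x) = cY x,
       forall x y, snxt (sopp x) = Some y -> cX y = cX x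
     & forall x y, snxt (sopp x) = Some y -> cY y = cY x]].
  case: (boolP (sconn (deco (fun x : sdart X => P (inr (inl x)))))) h4 => [c1 h4|c1 _].
    have {hY} [cY [[y1 y2] [y3 y4] y5 y6]] := hY _ (fun r => hP (inr (inr (inl r)))) h2 h4.
    by exists (fun _ => true), cY; split=> //; split=> //; rewrite ?y1 ?y3 ?(negbTE y2) ?(negbTE y4).
  have {hX} [cX [[x1 x2] [x3 x4] x5 x6]] := hX _ (fun r => hP (inr (inl r))) h1 c1.
  by exists cX, (fun _ => false); split=> //; split=> //; rewrite ?x1 ?x3 ?(negbTE x2) ?(negbTE x4).
case: y4 => y5 y6 x7 y7.
exists (fun u : sdart (N X Y R) => match u with
  | inl b => b | inr (inl x) => cX x | inr (inr (inl y)) => cY y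
  | inr (inr (inr r)) => cR r end).
split=> //=.
- case=> [b|[x|[y|r]]] /=; rewrite ?h0 //.
  + exact: y5.
  + exact: y6.
  + exact: r5.
- case=> [[]|[x|[y|r]]] y' //=.
  + by case=> <-.
  + case E: (snxt (sopp x)) => [x'|] [<-] //; first exact: x7.
    case: eqP => [e|/eqP e].
      by rewrite -x2 -y3 -e soppK.
    by rewrite r1 -(soppK x) (snxt_None E e) x3.
  + case E: (snxt (sopp y)) => [x'|] [<-] //; first exact: y7.
    case: eqP => [e|/eqP e].
      by rewrite -y2 -e soppK.
    by rewrite -x4 -(snxt_None E e) soppK.
  + case E: (snxt (sopp r)) => [x'|]; first by case=> <-; exact: r6.
    case: eqP => [e [<-]|//].
    by rewrite y1 -(soppK r) e (negbTE r4).
Qed.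

(** * Local conditions forced by a spanning tree that avoids cycles of length 2 *)

Section TreeInMap.
Variables (D : finType) (M : cmap D) (T : {set D}).
Hypothesis oK : involutive (opp M).
Hypothesis oN : forall d, opp M d != d.
Hypothesis nI : injective (lnext M).
Hypothesis hT : spanning_tree M T.

Lemma vrot_inj : injective (vrot M).
Proof. by move=> d e /nI /(can_inj oK). Qed.

Lemma vertex_vrot d : vertex M (vrot M d) = vertex M d.
Proof. exact: (orb_step vrot_inj). Qed.

Lemma vertex_opp_lnext d : vertex M (opp M d) = vertex M (lnext M d).
Proof. by rewrite -vertex_vrot /vrot oK. Qed.

Definition tree_rel (S : {set D}) : rel D :=
  [rel u v | (vertex M v == vertex M u) || (u \in S) && (v == opp M u)].

Lemma tree_rel_sym (S : {set D}) : (forall d, (opp M d \in S) = (d \in S)) ->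
  connect_sym (tree_rel S).
Proof.
move=> hS; apply: sym_connect_sym => u v; rewrite /tree_rel /= eq_sym; congr (_ || _).
apply/andP/andP => -[h /eqP ->]; rewrite ?hS ?oK //.
Qed.

Lemma tree_rel_mono (S S' : {set D}) : S \subset S' ->
  subrel (connect (tree_rel S)) (connect (tree_rel S')).
Proof.
move=> hS; apply: connect_sub => u v; rewrite /tree_rel /= => h; apply: connect1.
rewrite /tree_rel /=.
by case/orP: h => [/eqP->|/andP[/(subsetP hS) -> ->]]; rewrite ?eqxx ?orbT.
Qed.

Lemma reach_vertex (S : {set D}) u v : vertex M v = vertex M u -> connect (tree_rel S) u v.
Proof. by move=> h; apply: connect1; rewrite /tree_rel /= h eqxx. Qed.

(** A simple path of vertices joining the ends of [d] within the rest of the tree would close up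
    with [d] into a cycle. *)
Lemma tree_bridge d : d \in T -> ~~ connect (tree_rel (T :\ d :\ opp M d)) (opp M d) d.
Proof.
case: hT => Tc _ Ta dT; set S := T :\ d :\ opp M d; apply/negP=> h.
have Sc e : (opp M e \in S) = (e \in S).
  by rewrite !inE Tc (inj_eq (can_inj oK)) (can2_eq oK oK) andbCA.
(* Adjacency of vertices through [S]. A path of darts projects to a path of vertices; this one is
   made simple by [shortenP] and then lifted to a list [c] of darts. *)
pose eV : rel {set D} := [rel v w | [exists e in S, (vertex M e == v) && (vertex M (opp M e) == w)]].
have {h} : connect eV (vertex M (opp M d)) (vertex M d).
  have : forall u v, connect (tree_rel S) u v -> connect eV (vertex M u) (vertex M v).
    move=> u v /connectP[p]; elim: p u => [|x p IH] u /= => [_ ->|]; first exact: connect0.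
    case/andP=> hux hp hv; have := IH _ hp hv; apply: connect_trans.
    case/orP: hux => [/eqP ->|/andP[uS /eqP ->]]; first exact: connect0.
    by apply: connect1 => /=; apply/existsP; exists u; rewrite uS !eqxx.
  by apply.
case/connectP=> p0 /shortenP[p hp up _ {p0}] hl.
have [c [sc hc]] : exists c : seq D, size c = size p /\
   forall i, i < size p -> [/\ nth d c i \in S,
     vertex M (nth d c i) = nth set0 (vertex M (opp M d) :: p) i &
     vertex M (opp M (nth d c i)) = nth set0 p i].
  elim: p {up hl} (vertex M (opp M d)) hp => [|x p IH] v /=; first by exists [::].
  case/andP=> /existsP[e /and3P[eS /eqP e1 /eqP e2]] /IH[c [sc hc]].
  exists (e :: c); split; first by rewrite /= sc.
  by case=> //= i hi; apply: hc.
have cS e : e \in c -> e \in S.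
  by move/(nthP d)=> [i hi <-]; rewrite sc in hi; case: (hc _ hi).
have : is_cycle M (d :: c).
  apply/and4P; split=> //.
  - apply/(pathP d) => i; rewrite size_rcons ltnS => hi /=.
    case: i hi => [|i] hi /=.
      case: c sc hc {cS hi} => [|e c] /= sc hc.
        by rewrite hl; case: p sc {hc up hp hl}.
      by case: (hc 0) => [|_ -> _]; rewrite -?sc.
    rewrite nth_rcons hi; have hi' : i < size p by rewrite -sc.
    case: (hc _ hi') => _ _ ->.
    rewrite nth_rcons; case: ltnP => h.
      by case: (hc i.+1) => [|_ -> _]; rewrite -?sc.
    have -> : i.+1 == size c by rewrite eqn_leq hi h.
    rewrite hl (last_nth set0).
    by have -> : size p = i.+1 by rewrite -sc; apply/eqP; rewrite eqn_leq hi h.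
  - rewrite /=; have -> : map (vertex M) c = belast (vertex M (opp M d)) p.
      apply: (@eq_from_nth _ set0); first by rewrite size_map size_belast.
      move=> i; rewrite size_map => hi; rewrite (nth_map d) //.
      rewrite sc in hi; case: (hc _ hi) => _ -> _.
      by rewrite lastI nth_rcons size_belast hi.
    by rewrite /= hl -rcons_uniq -lastI.
  - apply/allP=> e; rewrite !inE => /orP[/eqP ->|ec].
      rewrite (negbTE (oN d)) /=; apply/negP=> /cS.
      by rewrite !inE eqxx.
    rewrite negb_or; apply/andP; split.
      by apply/eqP=> E; have := cS _ ec; rewrite -Sc E !inE eqxx andbF.
    (* Going back and forth along an edge would make two positions of the simple path successors of
       each other. *)
    apply/negP=> oc; case/(nthP d): ec => i; rewrite sc => hi ei.
    case/(nthP d): oc => j; rewrite sc => hj ej.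
    case: (hc _ hi) => _; rewrite ei => v1 v2.
    case: (hc _ hj) => _; rewrite ej oK => v3 v4.
    have := up => /uniqP un.
    have e1 : i.+1 = j by apply: (un set0); rewrite ?inE /= ?ltnS //; [exact: ltnW|rewrite -v3 -v2].
    have e2 : j.+1 = i by apply: (un set0); rewrite ?inE /= ?ltnS //; [exact: ltnW|rewrite -v1 -v4].
    by have := ltnSn i; rewrite -{1}e2 -e1 ltnNge leqW.
move/Ta; rewrite /= dT /=; case/negP; apply/allP=> e /cS.
by rewrite !inE => /and3P[].
Qed.

Hypothesis hH : forall c d, is_cycle M c -> size c = 2 -> d \in c -> d \notin T.

(** A tree edge with a parallel companion lies on a cycle of length 2, unless it is a loop, which a
    tree cannot contain. *)
Lemma no_parallel d e : d \in T -> vertex M e = vertex M (opp M d) ->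
  vertex M (opp M e) = vertex M d -> e = opp M d.
Proof.
move=> dT h1 h2; apply/eqP/negPn/negP=> ne.
case: (eqVneq (vertex M d) (vertex M (opp M d))) => hv.
  case: hT => _ _ /(_ [:: d]); rewrite /= dT /is_cycle /=.
  by rewrite -hv eqxx inE (oN d) => /(_ isT).
have : is_cycle M [:: d; e].
  rewrite /is_cycle /= h1 h2 !eqxx !inE hv /= !negb_or oN oN (eq_sym _ e) ne !andbT.
  by rewrite -(inj_eq (can_inj oK)) oK ne.
by move/hH => /(_ d erefl); rewrite inE eqxx dT => /(_ isT).
Qed.

(** The successors of the outer darts stay free, since they depend on what surrounds the slot. *)
Definition slot_embeds (c : slot) (f : sdart c -> D) : Prop :=
  [/\ injective f, forall x, opp M (f x) = f (sopp x)
    & forall x x', snxt x = Some x' -> lnext M (f x) = f x'].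

Lemma slot_embeds_sub X Y R (f : sdart (N X Y R) -> D) : slot_embeds f ->
  [/\ slot_embeds (fun x => f (inr (inl x))), slot_embeds (fun y => f (inr (inr (inl y))))
    & slot_embeds (fun r => f (inr (inr (inr r))))].
Proof.
case=> fI fo fn; split; split=> [x y /fI[]|x|x x' h] //; rewrite ?fo //.
- by apply: fn; rewrite /= h.
- by apply: fn; rewrite /= h.
- by apply: fn; rewrite /= h.
Qed.

Lemma slot_ends c (f : sdart c -> D) : slot_embeds f ->
  vertex M (f (sopp (srgt c))) = vertex M (f (slft c)) /\
  vertex M (f (sopp (slft c))) = vertex M (f (srgt c)).
Proof.
elim: c f => [|X hX Y hY R hR] f hf; first by [].
have [eX eY eR] := slot_embeds_sub hf; case: (hf) => fI fo fn.
have [/= x1 x2] := hX _ eX; have [/= y1 y2] := hY _ eY; have [/= r1 r2] := hR _ eR.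
split=> /=.
  rewrite r1 -(fn (inr (inl (srgt X)))); last first.
    by rewrite /= snxt_rgt eq_sym slft_neq_srgt.
  rewrite -vertex_opp_lnext fo /= x1 -(fn (inl false)) //.
  by rewrite -vertex_opp_lnext fo.
rewrite -(fn (inr (inr (inl (slft Y))))); last by rewrite /= snxt_lft eqxx.
rewrite -vertex_opp_lnext fo /= y2 -(fn (inr (inr (inr (slft R))))); last by rewrite /= snxt_lft eqxx.
by rewrite -vertex_opp_lnext fo /= r2.
Qed.

Lemma slot_ends_sub X Y R (f : sdart (N X Y R) -> D) : slot_embeds f ->
  [/\ vertex M (f (inr (inl (slft X)))) = vertex M (f (slft (N X Y R))),
      vertex M (f (inr (inr (inr (slft R))))) = vertex M (f (slft (N X Y R))),
      vertex M (f (inr (inr (inl (slft Y))))) = vertex M (f (inr (inl (srgt X)))) &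
      vertex M (f (inr (inr (inl (srgt Y))))) = vertex M (f (srgt (N X Y R)))].
Proof.
move=> hf; have [eX eY eR] := slot_embeds_sub hf; case: (hf) => fI fo fn.
have [x1 x2] := slot_ends eX; have [y1 y2] := slot_ends eY; have [r1 r2] := slot_ends eR.
split=> /=.
- by rewrite -(fn (inl false)) // -vertex_opp_lnext fo.
- rewrite -(fn (inr (inl (srgt X)))); last by rewrite /= snxt_rgt eq_sym slft_neq_srgt.
  by rewrite -vertex_opp_lnext fo /= x1 -(fn (inl false)) // -vertex_opp_lnext fo.
- rewrite -(fn (inr (inl (slft X)))); last by rewrite /= snxt_lft eqxx.
  by rewrite -vertex_opp_lnext fo /= x2.
- rewrite -(fn (inr (inr (inr (slft R))))); last by rewrite /= snxt_lft eqxx.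
  by rewrite -vertex_opp_lnext fo /= r2.
Qed.

Lemma sopp_mem c (f : sdart c -> D) : slot_embeds f -> forall x, (f (sopp x) \in T) = (f x \in T).
Proof. by case=> _ fo _ x; rewrite -fo; case: hT => ->. Qed.

(** The first edge of a node is parallel to the first edge of the remaining bundle [R], and these
    edges are distinct. *)
Lemma slot_initfree c (f : sdart c -> D) : slot_embeds f -> initfree (fun x => f x \in T).
Proof.
elim: c f => [|X hX Y hY R hR] f hf //=.
have [eX eY eR] := slot_embeds_sub hf; case: (hf) => fI fo fn.
split; [|exact: hX|exact: hY|exact: hR].
suff h : f (inl true) \notin T.
  by case; first exact: negbTE; rewrite -[inl false]/(sopp (slft (N X Y R))) (sopp_mem hf); exact: negbTE.
apply/negP=> h.
have [e1 e2 e3 e4] := slot_ends_sub hf.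
have [n1 n2] := slot_ends hf.
have [r1 r2] := slot_ends eR.
have := @no_parallel (f (inl true)) (f (inr (inr (inr (sopp (slft R)))))) h.
by rewrite !fo /= soppK => H; have /fI := H (etrans r2 (esym n2)) e2.
Qed.

(** The same parallelism, used in the other direction when [R] is a single edge. *)
Lemma slot_last_edge X Y R (f : sdart (N X Y R) -> D) : slot_embeds f ->
  ~~ is_dL1 (deco (fun r : sdart R => f (inr (inr (inr r))) \in T)).
Proof.
case: R f => // f hf; case: (hf) => fI fo fn /=.
have [e1 e2 e3 e4] := slot_ends_sub hf.
have [n1 n2] := slot_ends hf.
case h : (f _ \in T) => //.
by have := no_parallel h; rewrite fo /= => /(_ (f (inl false)) n2); rewrite fo /= => /(_ (esym e2)) /fI.
Qed.

(** Singles out a tree edge on the path joining the two ends, such that the two pieces of the path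
    on its sides avoid it. This is the form needed to contradict [tree_bridge]. *)
Lemma slot_conn_edge c (f : sdart c -> D) : slot_embeds f -> sconn (deco (fun x => f x \in T)) ->
  exists x, let S := (T :&: (f @: [set: sdart c])) :\ f x :\ opp M (f x) in
  [/\ f x \in T, connect (tree_rel S) (f (slft c)) (f x)
    & connect (tree_rel S) (opp M (f x)) (f (srgt c))].
Proof.
elim: c f => [|X hX Y hY R hR] f hf.
  by move=> /= h; exists true; split=> //; case: hf => _ -> _ /=; exact: connect0.
have [eX eY eR] := slot_embeds_sub hf; case: (hf) => fI fo fn /=.
have [e1 e2 e3 e4] := slot_ends_sub hf.
case/orP=> [/andP[cX cY]|cR].
  have [x [xT x1 x2]] := hX _ eX cX; have [y [yT y1 y2]] := hY _ eY cY.
  set S := _ :\ _ :\ _ in x1 x2; set S' := _ :\ _ :\ _ in y1 y2.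
  exists (inr (inl x)); set S0 := _ :\ _ :\ _.
  have sS : S \subset S0.
    by apply/subsetP=> d; rewrite !inE => /and4P[-> -> -> /imsetP[z _ ->]]; rewrite imset_f.
  have sS' : S' \subset S0.
    apply/subsetP=> d; rewrite !inE => /and4P[_ _ -> /imsetP[z _ ->]]; rewrite imset_f //.
    rewrite fo !(inj_eq fI) //.
  split=> //.
    apply: (connect_trans (reach_vertex S0 e1)); exact: (tree_rel_mono sS).
  apply: (connect_trans (tree_rel_mono sS x2)).
  apply: (connect_trans (reach_vertex S0 e3)).
  have hy : connect (tree_rel S0) (f (inr (inr (inl y)))) (opp M (f (inr (inr (inl y))))).
    by apply: connect1; apply/orP; right; rewrite !inE yT imset_f // !fo !(inj_eq fI) /= !eqxx.
  apply: (connect_trans (tree_rel_mono sS' y1)); apply: (connect_trans hy).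
  apply: (connect_trans (tree_rel_mono sS' y2)).
  exact: (reach_vertex S0 (esym e4)).
have [x [xT x1 x2]] := hR _ eR cR; set S := _ :\ _ :\ _ in x1 x2.
exists (inr (inr (inr x))); set S0 := _ :\ _ :\ _.
have sS : S \subset S0.
  by apply/subsetP=> d; rewrite !inE => /and4P[-> -> -> /imsetP[z _ ->]]; rewrite imset_f.
split=> //.
  by apply: (connect_trans (reach_vertex S0 e2)); exact: (tree_rel_mono sS).
exact: (tree_rel_mono sS).
Qed.

Lemma slot_conn_reach c (f : sdart c -> D) : slot_embeds f -> sconn (deco (fun x => f x \in T)) ->
  connect (tree_rel (T :&: (f @: [set: sdart c]))) (f (slft c)) (f (srgt c)).
Proof.
move=> hf /(slot_conn_edge hf)[x]; set S := _ :\ _ :\ _ => -[xT h1 h2].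
have sS : S \subset T :&: (f @: [set: sdart c]).
  by apply/subsetP=> d; rewrite !inE => /and3P[].
apply: (connect_trans (tree_rel_mono sS h1)).
apply: connect_trans (tree_rel_mono sS h2).
by apply: connect1; rewrite /tree_rel /= !inE xT imset_f // eqxx orbT.
Qed.

(** If the tree crossed neither [X] nor [Y], the colourings of these slots would cut out a set of
    darts around the apex, closed under rotation and along tree edges, which the tree could not join
    to the first edge. *)
Lemma slot_not_both_apart X Y R (f : sdart (N X Y R) -> D) : slot_embeds f ->
  sconn (deco (fun x : sdart X => f (inr (inl x)) \in T)) ||
  sconn (deco (fun y : sdart Y => f (inr (inr (inl y))) \in T)).
Proof.
move=> hf; apply/negPn; rewrite negb_or; apply/negP=> /andP[cX cY].
have [eX eY eR] := slot_embeds_sub hf; case: (hf) => fI fo fn /=.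
have [kX [[x1 x2] [x3 x4] x5 x6]] := slot_colouring (sopp_mem eX) (slot_initfree eX) cX.
have [kY [[y1 y2] [y3 y4] y5 y6]] := slot_colouring (sopp_mem eY) (slot_initfree eY) cY.
(* The darts of [X] and of [Y] that lie on the apex side of the two cuts. *)
pose Z := [set f (inr (inl x)) | x in [pred x | ~~ kX x]] :|:
          [set f (inr (inr (inl y))) | y in [pred y | kY y]].
have Zr d : d \in Z -> vrot M d \in Z.
  rewrite !inE => /orP[] /imsetP[x]; rewrite inE => hx ->; rewrite /vrot fo /=.
    case E: (snxt (sopp x)) => [x'|].
      rewrite (fn _ (inr (inl x'))) /= ?E //.
      by apply/orP; left; apply: imset_f; rewrite inE (x6 _ _ E).
    case: (eqVneq (sopp x) (slft X)) => e.
      rewrite (fn _ (inr (inr (inl (slft Y))))) /= ?E ?e ?eqxx //.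
      by apply/orP; right; apply: imset_f; rewrite inE.
    by move: hx; rewrite -(soppK x) (snxt_None E e) x3.
  case E: (snxt (sopp x)) => [x'|].
    rewrite (fn _ (inr (inr (inl x')))) /= ?E //.
    by apply/orP; right; apply: imset_f; rewrite inE (y6 _ _ E).
  case: (eqVneq (sopp x) (slft Y)) => e.
    by move: hx; rewrite -(soppK x) e (negbTE y4).
  rewrite (fn _ (inr (inl (srgt X)))) /= ?E ?(negbTE e) //.
  by apply/orP; left; apply: imset_f; rewrite inE.
have Zo d : d \in Z -> d \in T -> opp M d \in Z.
  rewrite !inE => /orP[] /imsetP[x]; rewrite inE => hx -> hxT; rewrite fo /=.
    by apply/orP; left; apply: imset_f; rewrite inE x5.
  by apply/orP; right; apply: imset_f; rewrite inE y5.
have Zv d e : vertex M e = vertex M d -> d \in Z -> e \in Z.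
  move/esym/eqP; rewrite (orb_eq vrot_inj) => /connectP[p hp ->].
  by elim: p d hp => //= x p IH d /andP[/eqP <- hp] /Zr/IH; apply.
have Zc d e : connect (tree_rel T) d e -> d \in Z -> e \in Z.
  case/connectP=> p hp ->; elim: p d hp => //= x p IH d /andP[h hp] dZ.
  apply: IH => //; case/orP: h => [/eqP h|/andP[h1 /eqP ->]]; first exact: Zv dZ.
  exact: Zo.
case: hT => _ /(_ (f (inr (inl (srgt X)))) (f (inl true))) /Zc + _.
have -> : f (inr (inl (srgt X))) \in Z.
  by rewrite inE; apply/orP; left; apply: imset_f; rewrite inE.
by rewrite inE => /(_ isT)/orP[] /imsetP[x _] /fI.
Qed.

(** The paths through [X] and [Y] form a detour around a tree edge of [R], against [tree_bridge]. *)
Lemma slot_not_all_joined X Y R (f : sdart (N X Y R) -> D) : slot_embeds f ->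
  ~~ [&& sconn (deco (fun x : sdart X => f (inr (inl x)) \in T)),
         sconn (deco (fun y : sdart Y => f (inr (inr (inl y))) \in T))
       & sconn (deco (fun r : sdart R => f (inr (inr (inr r))) \in T))].
Proof.
move=> hf; apply/negP=> /and3P[cX cY cR].
have [eX eY eR] := slot_embeds_sub hf; case: (hf) => fI fo fn /=.
have [e1 e2 e3 e4] := slot_ends_sub hf.
have [r] := slot_conn_edge eR cR; set S := _ :\ _ :\ _ => -[rT r1 r2].
have := tree_bridge rT; set S0 := _ :\ _ :\ _ => /negP; apply.
have sS : S \subset S0.
  by apply/subsetP=> d; rewrite !inE => /and4P[-> -> ->].
have S0c d : (opp M d \in S0) = (d \in S0).
  by rewrite !inE (inj_eq (can_inj oK)) (can2_eq oK oK); case: hT => ->; rewrite andbCA.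
have sX : T :&: [set f (inr (inl x)) | x in [set: sdart X]] \subset S0.
  by apply/subsetP=> d; rewrite !inE => /andP[-> /imsetP[z _ ->]]; rewrite fo !(inj_eq fI).
have sY : T :&: [set f (inr (inr (inl y))) | y in [set: sdart Y]] \subset S0.
  by apply/subsetP=> d; rewrite !inE => /andP[-> /imsetP[z _ ->]]; rewrite fo !(inj_eq fI).
apply: (connect_trans (tree_rel_mono sS r2)).
rewrite (tree_rel_sym S0c).
have := tree_rel_mono sS r1; rewrite (tree_rel_sym S0c) => r1'.
apply: (connect_trans r1').
apply: (connect_trans (reach_vertex S0 (etrans e1 (esym e2)))).
apply: (connect_trans (tree_rel_mono sX (slot_conn_reach eX cX))).
apply: (connect_trans (reach_vertex S0 e3)).
apply: (connect_trans (tree_rel_mono sY (slot_conn_reach eY cY))).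
exact: (reach_vertex S0 (esym e4)).
Qed.

Lemma slot_svalid c (f : sdart c -> D) : slot_embeds f -> svalid (deco (fun x => f x \in T)).
Proof.
elim: c f => [|X hX Y hY R hR] f hf //=.
have [eX eY eR] := slot_embeds_sub hf.
rewrite hX // hY // hR // (slot_not_both_apart hf) (slot_not_all_joined hf).
exact: (slot_last_edge hf).
Qed.

End TreeInMap.

(** * Counting decorated slots with a generating function *)

HB.instance Definition _ := gen_eqMixin dslot.
HB.instance Definition _ := gen_choiceMixin dslot.

Fixpoint shape (d : dslot) : slot :=
  match d with dL _ => L | dN X Y R => N (shape X) (shape Y) (shape R) end.

Fixpoint dnodes (d : dslot) : nat :=
  match d with dL _ => 0 | dN X Y R => (dnodes X + dnodes Y + dnodes R).+1 end.

Lemma shape_deco c (P : sdart c -> bool) : shape (deco P) = c.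
Proof. by elim: c P => //= X hX Y hY R hR P; rewrite hX hY hR. Qed.

Lemma dnodes_deco c (P : sdart c -> bool) : dnodes (deco P) = nnodes c.
Proof. by elim: c P => //= X hX Y hY R hR P; rewrite hX hY hR. Qed.

Lemma deco_inj c (P P' : sdart c -> bool) :
    (forall x, P (sopp x) = P x) -> (forall x, P' (sopp x) = P' x) ->
    initfree P -> initfree P' -> deco P = deco P' -> P =1 P'.
Proof.
elim: c P P' => [|X hX Y hY R hR] P P' hP hP' /=.
  by move=> _ _ [] e [] //; move: (hP true) (hP' true) => /= -> ->.
case=> i0 i1 i2 i3 [j0 j1 j2 j3] [e1 e2 e3] [b|[x|[y|r]]]; first by rewrite i0 j0.
- by apply: (hX _ _ _ _ i1 j1 e1) => z; [exact: (hP (inr (inl z)))|exact: (hP' (inr (inl z)))].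
- by apply: (hY _ _ _ _ i2 j2 e2) => z; [exact: (hP (inr (inr (inl z))))|exact: (hP' (inr (inr (inl z))))].
- by apply: (hR _ _ _ _ i3 j3 e3) => z; [exact: (hP (inr (inr (inr z))))|exact: (hP' (inr (inr (inr z))))].
Qed.

Section Weights.
Local Open Scope ring_scope.

(** With these weights, a bound on the total weight of the valid slots, uniform in their height,
    shows that those with [k] nodes are [O(12^k)] in number. *)
Definition dwt (d : dslot) : rat := 12%:R ^- dnodes d.

Definition dsum (A : seq dslot) : rat := \sum_(x <- A) dwt x.

Definition dmk (A B C : seq dslot) : seq dslot :=
  [seq dN p.1 p.2 r | p <- [seq (x, y) | x <- A, y <- B], r <- C].

Lemma dsum_mk A B C : dsum (dmk A B C) = dsum A * dsum B * dsum C / 12%:R.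
Proof.
rewrite /dsum /dmk big_allpairs_dep big_allpairs_dep /= -mulrA mulr_suml mulr_suml.
apply: eq_bigr => x _; rewrite mulr_sumr mulr_suml; apply: eq_bigr => y _.
rewrite mulr_suml mulr_sumr; apply: eq_bigr => r _.
rewrite /dwt /= exprS !exprD !invfM; ring.
Qed.

Lemma dsum_cat A B : dsum (A ++ B) = dsum A + dsum B.
Proof. by rewrite /dsum big_cat. Qed.

Lemma dwt_gt0 d : 0 < dwt d.
Proof. by rewrite invr_gt0 exprn_gt0. Qed.

Lemma dsum_ge0 A : 0 <= dsum A.
Proof. by apply: sumr_ge0 => x _; apply: ltW; apply: dwt_gt0. Qed.

(* Disconnected slots; connected slots; connected slots other than a single     *)
(* edge of the tree.                                                            *)
Fixpoint slots_upto (h : nat) : seq dslot * seq dslot * seq dslot :=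
  if h is h'.+1 then
    let: (D, C, C') := slots_upto h' in
    let C1 := dmk C C D ++ dmk C D C' ++ dmk D C C' in
    (dL false :: dmk C D D ++ dmk D C D, dL true :: C1, C1)
  else ([::], [::], [::]).

(* The bounds are the fixed point of                                            *)
(* [D = 1 + 2 C D^2 / 12], [C' = (C^2 D + 2 C D C') / 12], [C = 1 + C'].        *)
Lemma slots_upto_sum h : let: (D, C, C') := slots_upto h in
  [/\ dsum D <= 3 / 2, dsum C <= 4 / 3 & dsum C' <= 1 / 3].
Proof.
elim: h => [|h] /=; first by rewrite /dsum !big_nil.
case: (slots_upto h) => [[D C] C'] [hD hC hC'].
have d0 := dsum_ge0 D; have c0 := dsum_ge0 C; have c'0 := dsum_ge0 C'.
have e b s : dsum (dL b :: s) = 1 + dsum s.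
  by rewrite /dsum big_cons /dwt /= expr0 invr1.
rewrite !e !dsum_cat !dsum_mk.
set d := dsum D in hD d0 *; set c := dsum C in hC c0 *; set c' := dsum C' in hC' c'0 *.
have hcd : c * d <= 4 / 3 * (3 / 2) by apply: ler_pM.
have cd0 : 0 <= c * d by apply: mulr_ge0.
have h1 : c * d * d <= 4 / 3 * (3 / 2) * (3 / 2) by apply: ler_pM.
have h2 : c * d * c <= 4 / 3 * (3 / 2) * (4 / 3) by apply: ler_pM.
have h3 : c * d * c' <= 4 / 3 * (3 / 2) * (1 / 3) by apply: ler_pM.
split; lra.
Qed.

Lemma mem_dmk (A B C : seq dslot) x y r : x \in A -> y \in B -> r \in C -> dN x y r \in dmk A B C.
Proof.
move=> hx hy hr; apply/allpairsP; exists ((x, y), r); split=> //.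
by apply/allpairsP; exists (x, y).
Qed.

(** The validity conditions leave five combinations of connected and disconnected subslots, one for
    each [dmk] in [slots_upto]. *)
Lemma slots_upto_mem h d : svalid d -> (dnodes d < h)%N ->
  let: (D, C, C') := slots_upto h in
  if sconn d then (d \in C) && (is_dL1 d || (d \in C')) else d \in D.
Proof.
elim: h d => [|h IH] [b|X Y R] //=.
  by case: (slots_upto h) => [[D C] C'] _ _; case: b; rewrite /= inE eqxx.
case/and5P=> vX vY vR c1 /andP[c2 c3] hn.
have lX : (dnodes X < h)%N by lia.
have lY : (dnodes Y < h)%N by lia.
have lR : (dnodes R < h)%N by lia.
move: (IH _ vX lX) (IH _ vY lY) (IH _ vR lR).
case: (slots_upto h) => [[D C] C'].
case: (sconn X) c1 c2 => c1 c2; case: (sconn Y) c1 c2 => //= _ c2; case: (sconn R) c2 => //= _; rewrite ?(negbTE c3) /=.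
- move=> /andP[hX _] /andP[hY _] hR.
  by rewrite inE !mem_cat (mem_dmk hX hY hR) /= orbT.
- move=> /andP[hX _] hY /andP[_ hR].
  by rewrite inE !mem_cat (mem_dmk hX hY hR) /= !orbT.
- move=> /andP[hX _] hY hR.
  by rewrite inE !mem_cat (mem_dmk hX hY hR) /= ?orbT.
- move=> hX /andP[hY _] /andP[_ hR].
  by rewrite inE !mem_cat (mem_dmk hX hY hR) /= !orbT.
- move=> hX /andP[hY _] hR.
  by rewrite inE !mem_cat (mem_dmk hX hY hR) /= !orbT.
Qed.

Lemma sum_undup (I : eqType) (s : seq I) (F : I -> rat) : (forall x, 0 <= F x) ->
  \sum_(x <- undup s) F x <= \sum_(x <- s) F x.
Proof.
move=> hF; elim: s => //= x s IH; rewrite big_cons; case: ifP => _.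
  by apply: (le_trans IH); rewrite lerDr.
by rewrite big_cons lerD2l.
Qed.

Lemma sum_uniq_subset (I : eqType) (s s' : seq I) (F : I -> rat) : (forall x, 0 <= F x) ->
  uniq s -> {subset s <= s'} -> \sum_(x <- s) F x <= \sum_(x <- s') F x.
Proof.
move=> hF us hs; apply: (le_trans _ (sum_undup s' hF)).
have hp : perm_eq s [seq x <- undup s' | x \in s].
  apply: uniq_perm => //; first by rewrite filter_uniq ?undup_uniq.
  move=> x; rewrite mem_filter mem_undup /=.
  by case hx: (x \in s) => //=; rewrite hs.
rewrite (perm_big _ hp) /= big_filter big_mkcond /=.
by apply: ler_sum => x _; case: ifP.
Qed.

(** The total weight is at most [(3/2 + 4/3)^3 = (17/6)^3 < 23], and each of these triples weighs
    [12^-m]. *)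
Lemma count_valid_triples (m : nat) (s : seq (dslot * dslot * dslot)) :
    uniq s ->
    (forall t, t \in s -> [/\ svalid t.1.1, svalid t.1.2, svalid t.2 &
       (dnodes t.1.1 + dnodes t.1.2 + dnodes t.2 = m)%N]) ->
  (size s <= 23 * 12 ^ m)%N.
Proof.
move=> us hs.
pose DC := (slots_upto m.+1).1.1 ++ (slots_upto m.+1).1.2.
pose all3 := [seq (p, r) | p <- [seq (x, y) | x <- DC, y <- DC], r <- DC].
pose w (t : dslot * dslot * dslot) := dwt t.1.1 * dwt t.1.2 * dwt t.2.
have mDC d : svalid d -> (dnodes d < m.+1)%N -> d \in DC.
  move=> v l; have := slots_upto_mem v l; rewrite /DC mem_cat.
  by case: (slots_upto m.+1) => [[D C] C'] /=; case: ifP => _ => [/andP[-> _]|->]; rewrite ?orbT.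
have sub : {subset s <= all3}.
  move=> [[x y] r] /hs[/= v1 v2 v3 e].
  apply/allpairsP; exists ((x, y), r); split=> //=; last by apply: mDC => //; lia.
  by apply/allpairsP; exists (x, y); split=> //=; apply: mDC => //; lia.
have sDC : dsum DC <= 17 / 6.
  have := slots_upto_sum m.+1; rewrite /DC dsum_cat.
  by case: (slots_upto m.+1) => [[D C] C'] /= [h1 h2 h3]; lra.
have : \sum_(t <- s) w t <= 23.
  apply: (@le_trans _ _ (\sum_(t <- all3) w t)).
    by apply: sum_uniq_subset => // t; rewrite !mulr_ge0 // ltW ?dwt_gt0.
  have -> : \sum_(t <- all3) w t = dsum DC * dsum DC * dsum DC.
    rewrite /all3 big_allpairs_dep big_allpairs_dep /= -mulrA {1}/dsum mulr_suml.
    apply: eq_bigr => x _; rewrite mulr_suml mulr_sumr; apply: eq_bigr => y _.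
    by rewrite mulr_sumr mulr_sumr; apply: eq_bigr => r _; rewrite /w mulrA.
  have d0 := dsum_ge0 DC.
  have h2 : dsum DC * dsum DC <= 17 / 6 * (17 / 6) by apply: ler_pM.
  have h3 : dsum DC * dsum DC * dsum DC <= 17 / 6 * (17 / 6) * (17 / 6).
    by apply: ler_pM => //; apply: mulr_ge0.
  by lra.
have -> : \sum_(t <- s) w t = (size s)%:R * 12%:R ^- m.
  rewrite big_seq (eq_bigr (fun=> 12%:R ^- m)).
    by rewrite -big_seq big_const_seq count_predT iter_addr_0 mulr_natl.
  by move=> [[x y] r] /hs[/= _ _ _ <-]; rewrite /w /dwt /= !exprD !invfM.
rewrite ler_pdivrMr ?exprn_gt0 // -natrX -natrM ler_nat.
exact.
Qed.

End Weights.

(** * Codes of rooted decorated hierarchical triangulations *)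

Lemma card_opp_orb (D : finType) (f : D -> D) (d : D) : involutive f -> f d != d ->
  #|orb f d| = 2.
Proof.
move=> fK fd; have -> : orb f d = [set d; f d].
  apply/setP=> x; rewrite !inE; apply/idP/orP => [/connectP[p]|[]/eqP->]; last first.
  - exact: fconnect1.
  - exact: connect0.
  have : forall y, (y == d) || (y == f d) -> fpath f y p -> x = last y p -> x == d \/ x == f d.
    elim: p => [|z p IH] y hy /= => [_ ->|/andP[/eqP<- hp] hx]; first exact/orP.
    apply: (IH (f y)) => //; case/orP: hy => /eqP ->; rewrite ?fK eqxx ?orbT //.
  by apply; rewrite eqxx.
by rewrite cards2 eq_sym fd.
Qed.

Lemma card_edges (D : finType) (M : cmap D) : involutive (opp M) -> (forall d, opp M d != d) ->
  #|edges M| * 2 = #|D|.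
Proof.
move=> oK oN; rewrite -(sum_card_orb (can_inj oK)) -sum_nat_const.
by apply: eq_bigr => X /imsetP[d _ ->]; rewrite card_opp_orb.
Qed.

(** Both [2E] and [3F] are the number of darts, which turns Euler's formula into a relation between
    darts and vertices. *)
Lemma card_darts_triangulation (D : finType) (M : cmap D) : planar_triangulation M ->
  #|D| + 12 = 6 * #|vertices M|.
Proof.
case=> [[oK oN nI _ eul] h3].
have h1 := card_edges oK oN.
have h2 : #|faces M| * 3 = #|D|.
  rewrite -(sum_card_orb nI) -sum_nat_const.
  by apply: eq_bigr => X /imsetP[d _ ->]; rewrite -(h3 d).
lia.
Qed.

(** The three decorated slots of a closed map, and the rank of the root among its darts. *)
Definition hcode := (dslot * dslot * dslot * nat)%type.

Definition hrep (D : finType) (s : rmap D) (T : {set D}) (c : hcode) : Prop :=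
  exists X Y Z (f : sclose_dart X Y Z -> D) (e : sclose_dart X Y Z),
  [/\ bijective f, {morph f : d / opp (sclose X Y Z) d >-> opp s d},
      {morph f : d / lnext (sclose X Y Z) d >-> lnext s d},
      f e = root s &
      [/\ initfree (fun x => f (inl x) \in T), initfree (fun y => f (inr (inl y)) \in T),
          initfree (fun z => f (inr (inr z)) \in T),
          (forall d, (opp s d \in T) = (d \in T)) &
      c = (deco (fun x => f (inl x) \in T), deco (fun y => f (inr (inl y)) \in T),
           deco (fun z => f (inr (inr z)) \in T), val (enum_rank e))]].

(** The shapes of the decorated slots rebuild the map, their leaves the tree, and the last component
    the root. *)
Lemma hrep_inj (D D' : finType) (s : rmap D) (s' : rmap D') T T' c :
    hrep s T c -> hrep s' T' c ->
  exists f : D -> D', [/\ bijective f, {morph f : d / opp s d >-> opp s' d},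
    {morph f : d / lnext s d >-> lnext s' d}, f (root s) = root s'
    & forall d, (f d \in T') = (d \in T)].
Proof.
case=> X [Y [Z [f [e [fB fo fn fr [i1 i2 i3 Ti ->]]]]]].
case=> X' [Y' [Z' [f' [e' [f'B f'o f'n f'r [j1 j2 j3 Tj []]]]]]] E1 E2 E3 E4.
have eX : X' = X by rewrite -(shape_deco (fun x => f (inl x) \in T)) E1 shape_deco.
have eY : Y' = Y by rewrite -(shape_deco (fun x => f (inr (inl x)) \in T)) E2 shape_deco.
have eZ : Z' = Z by rewrite -(shape_deco (fun x => f (inr (inr x)) \in T)) E3 shape_deco.
subst X' Y' Z'.
have ee : e = e' by apply: enum_rank_inj; apply: val_inj.
subst e'.
case: (fB) => g fK gK.
have Tf x : (f (opp (sclose X Y Z) x) \in T) = (f x \in T) by rewrite fo Ti.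
have Tf' x : (f' (opp (sclose X Y Z) x) \in T') = (f' x \in T') by rewrite f'o Tj.
have TT x : (f x \in T) = (f' x \in T').
  case: x => [x|[y|z]].
  - apply: (deco_inj _ _ i1 j1 E1) => z; [exact: (Tf (inl z))|exact: (Tf' (inl z))].
  - apply: (deco_inj _ _ i2 j2 E2) => z; [exact: (Tf (inr (inl z)))|exact: (Tf' (inr (inl z)))].
  - apply: (deco_inj _ _ i3 j3 E3) => x; [exact: (Tf (inr (inr x)))|exact: (Tf' (inr (inr x)))].
exists (f' \o g); split.
- by apply: bij_comp => //; exists f.
- by move=> d; rewrite /= -f'o -{1}(gK d) -fo fK.
- by move=> d; rewrite /= -f'n -{1}(gK d) -fn fK.
- by rewrite /= -fr fK.
- by move=> d; rewrite /= -TT gK.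
Qed.

Definition hcode_ok (n : nat) (c : hcode) : Prop :=
  [/\ svalid c.1.1.1, svalid c.1.1.2, svalid c.1.2,
      dnodes c.1.1.1 + dnodes c.1.1.2 + dnodes c.1.2 + 2 = n & c.2 < 6 * n].

Lemma in_H_hrep n (D : finType) (s : rmap D) (T : {set D}) : in_H n s T ->
  exists2 c, hrep s T c & hcode_ok n c.
Proof.
case=> [[hp hv hT hr] hh hc].
have [X [Y [Z /isomorphic_sym[f [fB fo fn]]]]] := hierarchical_sclose hh.
case: (fB) => g fK gK.
case: (hp) => [[oK oN nI _ _] _].
have eX : slot_embeds s (fun x => f (inl x)).
  split=> [x y /(can_inj fK)[]|x|x x' h] //; first by rewrite -fo.
  by rewrite -fn /= h.
have eY : slot_embeds s (fun x => f (inr (inl x))).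
  split=> [x y /(can_inj fK)[]|x|x x' h] //; first by rewrite -fo.
  by rewrite -fn /= h.
have eZ : slot_embeds s (fun x => f (inr (inr x))).
  split=> [x y /(can_inj fK)[]|x|x x' h] //; first by rewrite -fo.
  by rewrite -fn /= h.
have hcard : #|D| = #|sclose_dart X Y Z| by apply: (bij_eq_card (f := g)); exists f.
have := card_darts_triangulation hp; rewrite hv hcard card_sclose_dart => hD.
eexists.
  exists X, Y, Z, f, (g (root s)); split=> //; split; last reflexivity.
  - exact: (slot_initfree oK oN nI hT hc eX).
  - exact: (slot_initfree oK oN nI hT hc eY).
  - exact: (slot_initfree oK oN nI hT hc eZ).
  - by case: hT.
split=> /=.
- exact: (slot_svalid oK oN nI hT hc eX).
- exact: (slot_svalid oK oN nI hT hc eY).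
- exact: (slot_svalid oK oN nI hT hc eZ).
- rewrite !dnodes_deco; lia.
- apply: (leq_trans (ltn_ord _)); rewrite card_sclose_dart; lia.
Qed.

Lemma count_hcodes n (s : seq hcode) : uniq s -> (forall c, c \in s -> hcode_ok n c) ->
  size s <= 6 * n * (23 * 12 ^ n).
Proof.
move=> us hs.
pose A := undup (map fst s).
have hA : size A <= 23 * 12 ^ n.
  case: (posnP (size A)) => [->//|A0].

  (* The slots of a code have [n - 2] nodes in total; the exponent is rounded up to [n]. *)
  apply: (@leq_trans (23 * 12 ^ (n - 2))); last by rewrite leq_mul2l leq_pexp2l // leq_subr.
  apply: count_valid_triples; first exact: undup_uniq.
  move=> t; rewrite mem_undup => /mapP[c' /hs[h1 h2 h3 h4 h5] ->]; split=> //; by rewrite -h4 addnK.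
pose B := [seq (t, k) | t <- A, k <- iota 0 (6 * n)].
have sB : {subset s <= B}.
  move=> c cs; apply/allpairsP; exists c; case: (hs _ cs) => _ _ _ _ lt; split.
  - by rewrite mem_undup map_f.
  - by rewrite mem_iota.
  - by case: c {cs lt}.
apply: (leq_trans (uniq_leq_size us sB)).
by rewrite size_allpairs size_iota mulnC leq_mul2l hA orbT.
Qed.

(** * Gluing is injective *)

Section Outerplanar.
Variables (D : finType) (t : rmap D) (n : nat).
Hypothesis hn : 1 < n.
Hypothesis ht : outerplanar t n.*2.

Let oK : involutive (opp t). Proof. by case: ht => -[]. Qed.
Let oN : forall d, opp t d != d. Proof. by case: ht => -[]. Qed.
Let nI : injective (lnext t). Proof. by case: ht => -[]. Qed.

Definition odart (i : nat) : D := iter i (finv (lnext t)) (opp t (root t)).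

Lemma sideE i : side t i = opp t (odart i). Proof. by []. Qed.

Lemma opp_side i : opp t (side t i) = odart i. Proof. exact: oK. Qed.

Lemma lnext_odart i : lnext t (odart i.+1) = odart i.
Proof. by rewrite /odart iterS f_finv. Qed.

Lemma outerE d : (d \in outer t) = fconnect (lnext t) (opp t (root t)) d.
Proof. by rewrite inE. Qed.

Lemma lnext_outer d : (lnext t d \in outer t) = (d \in outer t).
Proof. by rewrite !outerE -same_fconnect1_r. Qed.

Lemma order_outer : order (lnext t) (opp t (root t)) = n.*2.
Proof.
case: ht => _ _ <- _ _; rewrite /order; apply: eq_card => x.
by rewrite outerE.
Qed.

Lemma order_outer_finv : order (finv (lnext t)) (opp t (root t)) = n.*2.
Proof. by rewrite -order_outer; apply: eq_card => x; rewrite !inE same_fconnect_finv. Qed.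

Lemma odart_outer i : odart i \in outer t.
Proof. by rewrite outerE -(same_fconnect_finv nI) fconnect_iter. Qed.

Lemma odart_inj i j : i < n.*2 -> j < n.*2 -> odart i = odart j -> i = j.
Proof.
rewrite -order_outer_finv => hi hj.
rewrite /odart -(nth_traject _ hi) -(nth_traject _ hj) => /eqP.
by rewrite nth_uniq ?size_traject // => [/eqP//|]; exact: orbit_uniq.
Qed.

Lemma odart_period i : odart (i + n.*2) = odart i.
Proof. by rewrite /odart iterD -order_outer_finv iter_order //; exact: finv_inj. Qed.

Lemma outer_odart d : d \in outer t -> exists2 i, i < n.*2 & d = odart i.
Proof.
rewrite outerE -(same_fconnect_finv nI) fconnect_orbit => /trajectP[i].
by rewrite order_outer_finv => hi ->; exists i.
Qed.

(** The outer face has as many darts as vertices, so each vertex carries a single outer dart. *)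
Lemma vertex_outer_inj d e : d \in outer t -> e \in outer t -> vertex t d = vertex t e -> d = e.
Proof.
case: ht => _ _ h1 h2 _ hd he.
have /imset_injP : #|vertex t @: outer t| == #|outer t| by rewrite h1 h2.
exact.
Qed.

(** If both darts of an edge were outer, the outer face would close up after these two darts, but
    its degree [2n] is larger. *)
Lemma opp_outer d : d \in outer t -> opp t d \notin outer t.
Proof.
move=> hd; apply/negP=> ho.
have v e : vertex t (opp t e) = vertex t (lnext t e) by rewrite (vertex_opp_lnext oK nI).
have e1 : lnext t d = opp t d by apply: vertex_outer_inj; rewrite ?lnext_outer // v.
have e2 : lnext t (opp t d) = d.
  by apply: vertex_outer_inj; rewrite ?lnext_outer // -v oK.
have hs : outer t \subset [set d; opp t d].
  apply/subsetP=> x hx.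
  have : fconnect (lnext t) d x.
    rewrite !outerE in hd hx; apply: (connect_trans _ hx).
    by rewrite (fconnect_sym nI).
  case/connectP=> p; rewrite inE.
  have : forall y, y \in [set d; opp t d] -> fpath (lnext t) y p -> x = last y p -> x \in [set d; opp t d].
    elim: p => [|z p IH] y hy /= => [_ ->//|/andP[/eqP<- hp] hx'].
    by apply: (IH _ _ hp hx'); move: hy; rewrite !inE => /orP[]/eqP->; rewrite ?e1 ?e2 eqxx ?orbT.
  move=> /(_ d); rewrite !inE eqxx => h hp hl; exact: h.
have := subset_leq_card hs; case: ht => _ _ -> _ _; rewrite cards2.
by case: (d != _) => /=; lia.
Qed.

Lemma side_notin i : side t i \notin outer t.
Proof. by apply: opp_outer; exact: odart_outer. Qed.

Lemma side_inj i j : i < n.*2 -> j < n.*2 -> side t i = side t j -> i = j.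
Proof. by move=> hi hj /(can_inj oK); exact: odart_inj. Qed.

Lemma opp_notin d : d \notin outer t -> (forall i : 'I_n.*2, d != side t i) -> opp t d \notin outer t.
Proof.
move=> hd h; apply/negP=> /outer_odart[i hi e].
by have := h (Ordinal hi); rewrite sideE -e oK eqxx.
Qed.

Lemma vrot_side i : vrot t (side t i.+1) = odart i.
Proof. by rewrite /vrot opp_side lnext_odart. Qed.

(** The vertex between two consecutive sides carries one outer dart only, so the rotation around it
    meets neither an outer dart nor a side before reaching the next side. After gluing, the sides
    are therefore the contour of the tree, in order. *)
Lemma next_side i : exists k, side t i.+1 = iter k (vrot t) (lnext t (side t i)) /\
  forall j, j < k -> iter j (vrot t) (lnext t (side t i)) \notin outer t /\
    forall i', iter j (vrot t) (lnext t (side t i)) != side t i'.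
Proof.
have vI := vrot_inj oK nI.
have e0 : lnext t (side t i) = vrot t (odart i) by [].
set x := odart i in e0; have xo : x \in outer t by exact: odart_outer.
set N := order (vrot t) x.
have eN : iter N.-1 (vrot t) x = side t i.+1.
  by apply: (vI); rewrite vrot_side -iterS prednK /N ?order_gt0 // (iter_order vI).
have N2 : 1 < N.
  rewrite ltn_neqAle order_gt0 andbT; apply/eqP=> e.
  have := side_notin i.+1; by rewrite -eN -e /= xo.
exists (N - 2); rewrite e0 -iterSr.
have -> : (N - 2).+1 = N.-1 by lia.
split; first by rewrite eN.
have key j : 0 < j < N -> iter j (vrot t) x \notin outer t.
  case/andP=> j0 jN; apply/negP=> ho.
  have : iter j (vrot t) x = x.
    apply: vertex_outer_inj => //; apply/eqP; rewrite (orb_eq vI) (fconnect_sym vI).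
    exact: fconnect_iter.
  have := orbit_uniq (vrot t) x; rewrite /orbit -/N => un.
  have := nth_uniq x (_ : j < size (traject (vrot t) x N)) (_ : 0 < size (traject (vrot t) x N)) un.
  rewrite size_traject !nth_traject // ?order_gt0 // => /(_ jN isT) /= h e.
  by move: h; rewrite e eqxx; move: j0; case: (j).
move=> j hj; rewrite -iterSr; split; first by apply: key; lia.
move=> i'; apply/eqP=> e.
have := key j.+2; rewrite iterS e /vrot opp_side lnext_outer odart_outer => /(_ _)/negP h.
by apply: h => //; lia.
Qed.

End Outerplanar.

Section GlueMap.
Variables (D : finType) (t : rmap D) (n : nat) (pi : {perm 'I_n.*2}).
Hypothesis hn : 1 < n.
Hypothesis ht : outerplanar t n.*2.

Definition gside (i : nat) : glue_dart t := Sub (side t i) (side_notin hn ht i).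

Lemma glue_opp_side (u : glue_dart t) (i : 'I_n.*2) : val u = side t i ->
  val (opp (glue_map t pi) u) = side t (pi i).
Proof.
move=> e /=; case: pickP => [j|/(_ i)]; last by rewrite e eqxx.
rewrite e => /eqP/(side_inj ht (ltn_ord _) (ltn_ord _))/val_inj <-.
by rewrite insubdK // -topredE /= (side_notin hn ht).
Qed.

Lemma glue_opp_inner (u : glue_dart t) : (forall i : 'I_n.*2, val u != side t i) ->
  val (opp (glue_map t pi) u) = opp t (val u).
Proof.
move=> h /=; case: pickP => [j|_]; first by rewrite (negbTE (h j)).
by rewrite insubdK // -topredE /= (opp_notin ht) // (valP u).
Qed.

Lemma glue_lnext (u : glue_dart t) : val (lnext (glue_map t pi) u) = lnext t (val u).
Proof. by rewrite /= insubdK // -topredE /= (lnext_outer ht) (valP u). Qed.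

Lemma glue_treeP (u : glue_dart t) :
  reflect (exists i : 'I_n.*2, val u = side t i) (u \in glue_tree t n).
Proof. by rewrite inE; apply: (iffP existsP) => -[i /eqP]; exists i => //; apply/eqP. Qed.

Lemma next_gside i : exists k, gside i.+1 = iter k (vrot (glue_map t pi)) (lnext (glue_map t pi) (gside i)) /\
  forall j, j < k -> iter j (vrot (glue_map t pi)) (lnext (glue_map t pi) (gside i)) \notin glue_tree t n.
Proof.
have [k [h1 h2]] := next_side hn ht i; exists k.
have h j : j <= k -> val (iter j (vrot (glue_map t pi)) (lnext (glue_map t pi) (gside i))) =
   iter j (vrot t) (lnext t (side t i)).
  elim: j => [|j IH] hj; first by rewrite /= glue_lnext.
  rewrite !iterS {1}/vrot glue_lnext glue_opp_inner; first by rewrite IH // ltnW.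
  by move=> i'; rewrite IH ?(ltnW hj) //; apply: (h2 _ hj).2.
split; first by apply: val_inj; rewrite h.
move=> j hj; apply/negP=> /glue_treeP[i']; rewrite h ?(ltnW hj) // => e.
by have := (h2 _ hj).2 i'; rewrite e eqxx.
Qed.

Let n0 : 0 < n.*2. Proof. by rewrite double_gt0; apply: ltnW. Qed.

Lemma gside_tree i : gside i \in glue_tree t n.
Proof.
apply/glue_treeP; exists (Ordinal (ltn_pmod i n0)) => /=.
rewrite {1}(divn_eq i n.*2) addnC; elim: (i %/ n.*2) => [|k IH]; first by rewrite mul0n addn0.
by rewrite mulSn (addnC n.*2) addnA sideE (odart_period ht) -sideE.
Qed.

Lemma card_glue_dart : #|D| = #|{: glue_dart t}| + n.*2.
Proof.
have -> : #|{: glue_dart t}| = #|[predC outer t]| by rewrite card_sig; apply: eq_card.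
by case: ht => _ _ <- _ _; rewrite addnC cardC.
Qed.

End GlueMap.

Section GlueInjective.
Variables (D D' : finType) (t : rmap D) (t' : rmap D') (n : nat) (pi pi' : {perm 'I_n.*2}).
Hypothesis hn : 1 < n.
Hypothesis ht : outerplanar t n.*2.
Hypothesis ht' : outerplanar t' n.*2.
Variables (f : glue_dart t -> glue_dart t') (r : glue_dart t) (r' : glue_dart t').
Hypothesis fB : bijective f.
Hypothesis fo : {morph f : d / opp (glue_map t pi) d >-> opp (glue_map t' pi') d}.
Hypothesis fn : {morph f : d / lnext (glue_map t pi) d >-> lnext (glue_map t' pi') d}.
Hypothesis hr : val r = root t.
Hypothesis hr' : val r' = root t'.
Hypothesis fr : f r = r'.
Hypothesis fT : forall d, (f d \in glue_tree t' n) = (d \in glue_tree t n).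

Let oK : involutive (opp t). Proof. by case: ht => -[]. Qed.
Let nI' : injective (lnext t'). Proof. by case: ht' => -[]. Qed.
Let oK' : involutive (opp t'). Proof. by case: ht' => -[]. Qed.
Let nI : injective (lnext t). Proof. by case: ht => -[]. Qed.

Let n0 : 0 < n.*2. Proof. by rewrite double_gt0; apply: ltnW. Qed.

(** The next side is the first tree dart met when rotating from [lnext] of the current one. This
    description is intrinsic, so an isomorphism that preserves root and tree also preserves the
    numbering of the sides. *)
Lemma glue_morph_side i : f (gside hn ht i) = gside hn ht' i.
Proof.
elim: i => [|i IH].
  have -> : gside hn ht 0 = r by apply: val_inj; rewrite hr; apply: oK.
  by rewrite fr; apply: val_inj; rewrite hr'; apply/esym/oK'.
have [k [h1 h2]] := next_gside pi hn ht i.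
have [k' [h1' h2']] := next_gside pi' hn ht' i.
have fv : {morph f : d / vrot (glue_map t pi) d >-> vrot (glue_map t' pi') d}.
  by move=> d; rewrite /vrot fn fo.
have fi j : f (iter j (vrot (glue_map t pi)) (lnext (glue_map t pi) (gside hn ht i))) =
    iter j (vrot (glue_map t' pi')) (lnext (glue_map t' pi') (gside hn ht' i)).
  elim: j => [|j IHj]; first exact: (etrans (fn _) (congr1 _ IH)).
  by rewrite !iterS fv IHj.
suff kk : k = k' by rewrite h1 h1' fi kk.
case: (ltngtP k k') => // h.
  by have := h2' _ h; rewrite -fi -h1 fT gside_tree.
by have := h2 _ h; rewrite -fT fi -h1' gside_tree.
Qed.

Let fI := bij_inj fB.

(** Extends [f] to the outer darts through their opposites, which are inner by [opp_outer]; the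
    default [root t'] is never reached. *)
Definition unglue_morph (d : D) : D' :=
  if insub d is Some u then val (f u)
  else if insub (opp t d) is Some u then opp t' (val (f u)) else root t'.

Lemma unglue_inner (u : glue_dart t) : unglue_morph (val u) = val (f u).
Proof. by rewrite /unglue_morph valK. Qed.

Lemma unglue_odart i : unglue_morph (odart t i) = odart t' i.
Proof.
rewrite /unglue_morph insubF; last by rewrite (odart_outer ht).
have -> : insub (opp t (odart t i)) = Some (gside hn ht i) by exact: (valK (gside hn ht i)).
by rewrite glue_morph_side /= (opp_side ht').
Qed.

Lemma unglue_side i : unglue_morph (side t i) = side t' i.
Proof. by rewrite -[side t i]/(val (gside hn ht i)) unglue_inner glue_morph_side. Qed.

Lemma glue_inj_perm : pi = pi'.
Proof.
apply/permP=> i.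
have e : f (opp (glue_map t pi) (gside hn ht i)) = f (gside hn ht (pi i)).
  by congr f; apply: val_inj; rewrite (glue_opp_side pi hn ht (i := i)).
rewrite fo !glue_morph_side in e.
have := congr1 val e; rewrite (glue_opp_side pi' hn ht' (i := i)) // => /esym.
by move/(side_inj ht' (ltn_ord _) (ltn_ord _))/val_inj.
Qed.

Theorem glue_inj : risomorphic t t'.
Proof.
have cases d : (exists u : glue_dart t, d = val u) \/ exists2 i, i < n.*2 & d = odart t i.
  case: (boolP (d \in outer t)) => h; first by right; apply: outer_odart.
  by left; exists (Sub d h).
have o0 : odart t n.*2 = odart t 0 by rewrite -(odart_period ht 0).
have o0' : odart t' n.*2 = odart t' 0 by rewrite -(odart_period ht' 0).
exists unglue_morph; split.
- apply: inj_card_bij.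
    move=> d e; case: (cases d) => [[u ->]|[i hi ->]]; case: (cases e) => [[v ->]|[j hj ->]].
    + by rewrite !unglue_inner => /val_inj/fI ->.
    + rewrite unglue_inner unglue_odart => E.
      by have := valP (f u); rewrite /= E (odart_outer ht').
    + rewrite unglue_inner unglue_odart => E.
      by have := valP (f v); rewrite /= -E (odart_outer ht').
    + by rewrite !unglue_odart => /(odart_inj ht' hi hj) ->.
  by rewrite (card_glue_dart ht) (card_glue_dart ht') (bij_eq_card fB).
- move=> d; case: (cases d) => [[u ->]|[i hi ->]]; last first.
    by rewrite unglue_odart -(opp_side ht i) oK unglue_side.
  case: (boolP (u \in glue_tree t n)) => [/glue_treeP[i e]|h].
    by rewrite e (opp_side ht) unglue_odart unglue_side (opp_side ht').
  have h1 (i : 'I_n.*2) : val u != side t i.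
    by apply/eqP=> e; case/glue_treeP: h; exists i.
  have h2 (i : 'I_n.*2) : val (f u) != side t' i.
    by apply/eqP=> e; move: h; rewrite -fT; case/glue_treeP; exists i.
  by rewrite -(glue_opp_inner pi ht h1) !unglue_inner fo (glue_opp_inner pi' ht' h2).
- move=> d; case: (cases d) => [[u ->]|[i hi ->]].
    by rewrite -(glue_lnext pi ht) !unglue_inner fn (glue_lnext pi' ht').
  case: i hi => [|i] hi; last by rewrite (lnext_odart ht) !unglue_odart (lnext_odart ht').
  have [k hk] : exists k, n.*2 = k.+1 by case: (n.*2) n0 => // k _; exists k.
  rewrite -o0 hk (lnext_odart ht) !unglue_odart.
  by rewrite -hk o0' -{1}o0' hk (lnext_odart ht').
- by rewrite -hr unglue_inner fr hr'.
Qed.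

End GlueInjective.

(** * Counting noncrossing pairings and bounding the number of loops *)

Section Pairings.
Variable n : nat.
Implicit Types pi : {perm 'I_n.*2}.

Definition openers pi : {set 'I_n.*2} := [set i : 'I_n.*2 | i < pi i].

(** Count openers and closers strictly between [a] and [pi a]. Since [pi] is noncrossing, it maps
    these openers to closers of the same interval. If [pi a < pi' a], then [pi'] maps these closers,
    and also [pi a], to openers of the interval, which would leave strictly more openers than
    closers. *)
Lemma openers_le pi pi' : noncrossing_pairing pi -> noncrossing_pairing pi' ->
  openers pi = openers pi' -> forall a : 'I_n.*2, a < pi a -> ~ pi a < pi' a.
Proof.
move=> [pK pN pC] [qK qN qC] eo a h1 h2.
pose A := [set i : 'I_n.*2 | (a < i) && (i < pi a)].
have lt_neq (i j : 'I_n.*2) : i != j -> (i < j) || (j < i) by rewrite -neq_ltn.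
have hle : #|A :&: openers pi| <= #|A :\: openers pi|.
  rewrite -(card_imset _ (@perm_inj _ pi)); apply: subset_leq_card.
  apply/subsetP=> c /imsetP[b]; rewrite !inE => /andP[/andP[b1 b2] b3] ->.
  rewrite pK -leqNgt (ltnW b3) (ltn_trans b1 b3) /=.
  have nb : pi b != pi a by rewrite (inj_eq perm_inj); apply/eqP=> e; move: b1; rewrite e ltnn.
  by case/orP: (lt_neq _ _ nb) => // h; case: (pC a b).
have hlt : #|pi a |: (A :\: openers pi)| <= #|A :&: openers pi|.
  rewrite -(card_imset _ (@perm_inj _ pi')); apply: subset_leq_card.
  apply/subsetP=> c' /imsetP[c hc ->].
  have [c1 c2 c3] : [/\ a < c, c <= pi a & pi' c < c].
    have nc : c \notin openers pi'.
      rewrite -eo; move: hc; rewrite !inE => /orP[/eqP->|/andP[]//].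
      by rewrite pK -leqNgt ltnW.
    have c3 : pi' c < c.
      by move: nc; rewrite inE -leqNgt leq_eqVlt => /orP[/eqP/val_inj e|//]; have := qN c; rewrite e eqxx.
    move: hc; rewrite !inE => /orP[/eqP e|/andP[_ /andP[h h']]]; last by rewrite h ltnW.
    by rewrite e in c3 *.
  have c4 : c < pi' a by apply: leq_ltn_trans h2.
  have nca : pi' c != a by apply/eqP=> e; move: c4; rewrite -e qK ltnn.
  have h : a < pi' c.
    case/orP: (lt_neq _ _ nca) => // h; case: (qC (pi' c) a); rewrite qK; by split.
  by rewrite eo !inE h qK c3 (leq_trans c3 c2).
move: hlt; rewrite cardsU1 !inE h1 ltnn pK /= -leqNgt (ltnW h1) andbF /= add1n.
by move=> hlt; have := leq_trans hlt hle; rewrite ltnn.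
Qed.

Lemma openers_inj pi pi' : noncrossing_pairing pi -> noncrossing_pairing pi' ->
  openers pi = openers pi' -> pi = pi'.
Proof.
move=> h h' e.
have hop (a : 'I_n.*2) : a < pi a -> pi a = pi' a.
  move=> l; have l' : a \in openers pi' by rewrite -e inE.
  rewrite inE in l'.
  have n1 := openers_le h h' e l; have n2 := openers_le h' h (esym e) l'.
  by case: (ltngtP (pi a) (pi' a)) => [/n1|/n2|/ord_inj].
case: (h) (h') => [pK pN _] [qK qN _].
apply/permP=> a; case: (ltngtP a (pi a)) => l; first exact: hop.
  have := hop (pi a); rewrite pK => /(_ l) e'.
  by rewrite {2}e' qK.
by have := pN a; rewrite -(val_inj l) eqxx.
Qed.

Lemma count_noncrossing (s : seq {perm 'I_n.*2}) : uniq s ->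
  (forall pi, pi \in s -> noncrossing_pairing pi) -> size s <= 4 ^ n.
Proof.
move=> us hs.
have : uniq (map openers s).
  rewrite map_inj_in_uniq // => p q /hs hp /hs hq; exact: openers_inj.
move/card_uniqP; rewrite size_map => <-.
apply: (leq_trans (max_card _)).
have -> : #|{set 'I_n.*2}| = 2 ^ n.*2 by rewrite -cardsT -powersetT card_powerset cardsT card_ord.
by rewrite -muln2 mulnC expnM.
Qed.

(** Each loop contains its root and the image of that root under [piA], which is not a root. Hence
    twice the number of loops is at most [2n]. *)
Lemma loops_le (piH piA : {perm 'I_n.*2}) : noncrossing_pairing piH -> noncrossing_pairing piA ->
  loops piH piA <= n.
Proof.
move=> [pK pN _] [qK qN _]; rewrite /loops; set e := [rel i j | _].
have sym : connect_sym e.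
  apply: sym_connect_sym => i j; rewrite /= ![j == _]eq_sym.
  by rewrite (can2_eq pK pK) (can2_eq qK qK).
rewrite /n_comp_mem; set S := predI _ _.
have h : #|[set x in S]| + #|piA @: [set x in S]| <= #|'I_n.*2|.
  rewrite -cardsUI (_ : _ :&: _ = set0) ?cards0 ?addn0 ?max_card //.
  apply/setP=> x; rewrite !inE; apply/negP=> /andP[/andP[/eqP rx _] /imsetP[y]].
  rewrite !inE => /andP[/eqP ry _] exy.
  have : fingraph.root e x = fingraph.root e y.
    apply/eqP; rewrite (root_connect sym) sym exy; apply: connect1.
    by rewrite /= eqxx orbT.
  by rewrite rx ry exy => E; have := qN y; rewrite E eqxx.
have hS : #|[set x in S]| = #|S| by apply: eq_card => x; rewrite inE.
rewrite (card_imset _ (@perm_inj _ piA)) card_ord hS addnn leq_double in h.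
exact: h.
Qed.

End Pairings.

(** * The number of meanders *)

(** Codes the map and its hierarchical pairing; the Apollonian pairing is counted separately. *)
Definition mrep (n : nat) (p : set numbered_rmap * {perm 'I_n.*2} * {perm 'I_n.*2}) (c : hcode) : Prop :=
  exists u : numbered_rmap, let t := projT2 u in
  [/\ p.1.1 = rclass u, outerplanar t n.*2
    & exists2 r : glue_dart t, val r = root t
      & hrep (RMap (glue_map t p.1.2) r) (glue_tree t n) c].

Lemma rclass_eq (u v : numbered_rmap) : risomorphic (projT2 u) (projT2 v) -> rclass u = rclass v.
Proof.
move=> h; apply/funext => w; apply/propext; split=> h'.
  exact: risomorphic_trans (risomorphic_sym h) h'.
exact: risomorphic_trans h h'.
Qed.

Lemma mrep_inj n p p' c : 1 < n -> @mrep n p c -> mrep p' c -> p.1 = p'.1.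
Proof.
case: p p' => [[C pi] si] [[C' pi'] si'] hn [u [/= -> ht [r hr hu]]] [u' [/= -> ht' [r' hr' hu']]].
have [f [fB fo fn fr fT]] := hrep_inj hu hu'.
have iso := glue_inj hn ht ht' fB fo fn hr hr' fr fT.
by rewrite (glue_inj_perm hn ht ht' fo fn hr hr' fr fT) (rclass_eq iso).
Qed.

Lemma meander_mrep n p : meander_set n p ->
  exists c, mrep p c /\ hcode_ok n c.
Proof.
case=> u [-> ht _ [r hr hH] _].
have [c h1 h2] := in_H_hrep hH.
by exists c; split=> //; exists u; split=> //; exists r.
Qed.

(** A meander is determined by its code and its Apollonian pairing, whence the product of
    [6 n 23 12^n] and [4^n]. *)
Lemma count_meanders n (s : seq (set numbered_rmap * {perm 'I_n.*2} * {perm 'I_n.*2})) :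
  1 < n -> uniq s -> (forall p, p \in s -> meander_set n p) ->
  size s <= 138 * n * 48 ^ n.
Proof.
move=> hn us hs.
(* Every meander in [s] has a code, so the default of [xget] is not taken there. *)
pose code (p : set numbered_rmap * {perm 'I_n.*2} * {perm 'I_n.*2}) : hcode := xget (dL true, dL true, dL true, 0) (fun c => mrep p c /\ hcode_ok n c).
have codeP p : p \in s -> mrep p (code p) /\ hcode_ok n (code p).
  move/hs/meander_mrep => h; exact: (xgetPex _ h).
pose A := undup (map code s); pose B := undup (map snd s).
have hA : size A <= 6 * n * (23 * 12 ^ n).
  apply: count_hcodes; first exact: undup_uniq.
  by move=> c; rewrite mem_undup => /mapP[p /codeP[_ h] ->].
have hB : size B <= 4 ^ n.
  apply: count_noncrossing; first exact: undup_uniq.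
  by move=> q; rewrite mem_undup => /mapP[p /hs[u [_ _ [_ h] _ _]] ->].
pose f (p : set numbered_rmap * {perm 'I_n.*2} * {perm 'I_n.*2}) := (code p, p.2).
have ui : uniq (map f s).
  rewrite map_inj_in_uniq // => p p' /codeP[h _] /codeP[h' _] [e1 e2].
  rewrite e1 in h; have := mrep_inj hn h h'.
  by case: p p' e2 {e1 h h'} => [q a] [q' a'] /= -> ->.
have sub : {subset map f s <= [seq (c, q) | c <- A, q <- B]}.
  move=> _ /mapP[p hp ->]; apply/allpairsP; exists (f p); split=> //=.
    by rewrite mem_undup map_f.
  by rewrite mem_undup map_f.
have := uniq_leq_size ui sub; rewrite size_map size_allpairs => h.
apply: (leq_trans h); apply: (leq_trans (leq_mul hA hB)).
have -> : 48 ^ n = 12 ^ n * 4 ^ n by rewrite -expnMn.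
by apply: eq_leq; ring.
Qed.

(** The bound on the size of finite subsets is uniform. Finiteness lets [meander_poly] be handled as
    an ordinary finite sum. *)
Lemma finite_meanders n : 1 < n -> finite_set (meander_set n).
Proof.
move=> hn; apply: contrapT => inf.
have [B hB] := @infinite_set_fset _ (meander_set n) (138 * n * 48 ^ n).+1 inf.
apply/negP; rewrite -leqNgt; apply: count_meanders => //; exact: finmap.fset_uniq.
Qed.

Section UpperBound.
Local Open Scope ring_scope.
Variables (R : realType) (x : R).
Hypothesis x0 : 0 < x.

Lemma meander_coef_ge0 n : 0 <= meander_coef x n.
Proof.
case: n => [|n] //=; rewrite /meander_poly.
apply: fsumr_ge0 => p _; exact: exprn_ge0 (ltW x0).
Qed.

(** Each term is at most [max(1, x)^n], as there are at most [n] loops. *)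
Lemma meander_coef_le n : (1 < n)%N ->
  meander_coef x n <= 138 * n%:R * (48 * Num.max 1 x) ^+ n.
Proof.
move=> hn; have -> : meander_coef x n = meander_poly n x by case: n hn.
rewrite /meander_poly fsbig_finite; last exact: finite_meanders.
set s := fset_set _.
have m1 : 1 <= Num.max 1 x by rewrite le_max lexx.
have hs p : p \in s -> meander_set n p by rewrite in_fset_set; [exact: set_mem|exact: finite_meanders].
apply: (@le_trans _ _ (\sum_(p <- s) (Num.max 1 x) ^+ n)).
  rewrite big_seq [leRHS]big_seq; apply: ler_sum => p /hs[u [_ _ [h1 h2] _ _]].
  apply: (@le_trans _ _ (Num.max 1 x ^+ loops p.1.2 p.2)).
    by rewrite lerXn2r ?nnegrE ?(ltW x0) ?(le_trans ler01 m1) // le_max lexx orbT.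
  by apply: ler_weXn2l => //; exact: loops_le.
rewrite big_const_seq count_predT iter_addr_0 exprMn mulrA -[leLHS]mulr_natl.
apply: ler_wpM2r; first by rewrite exprn_ge0 // (le_trans ler01 m1).
rewrite -natrX -!natrM ler_nat.
exact: (count_meanders hn (finmap.fset_uniq s)).
Qed.

End UpperBound.

(** * From the growth of coefficients to the radius of convergence *)

Section Radius.
Local Open Scope ring_scope.
Local Open Scope classical_set_scope.
Variable R : realType.
Implicit Types (a : R^nat) (K q : R).

(** Each of the [n] terms of [1 + q + ... + q^(n-1) = (1 - q^n) / (1 - q)] is at least [q^n]. *)
Lemma natr_mul_exp_le q n : 0 <= q -> q < 1 -> n%:R * q ^+ n <= (1 - q)^-1.
Proof.
move=> q0 q1; rewrite -[leRHS]mul1r ler_pdivlMr ?subr_gt0 //.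
have h : n%:R * q ^+ n * (1 - q) <= 1 - q ^+ n.
  elim: n => [|n IH]; first by rewrite mul0r mul0r expr0 subrr.
  have := ler_wpM2l q0 IH; have := exprn_ge0 n q0; rewrite exprS -natr1.
  have p1 : q ^+ n <= 1 by rewrite exprn_ile1 // ltW.
  set p := q ^+ n in p1 *; move=> p0 h.
  have : 0 <= (1 - q) * (1 - q * p).
    by rewrite mulr_ge0 ?subr_ge0 ?(ltW q1) // mulr_ile1 // ltW.
  nra.
by apply: (le_trans h); rewrite gerBl exprn_ge0.
Qed.

(** Writing [(K r)^n = s^n s^n], one factor absorbs [n] and the other one is summed. *)
Lemma cvg_series_growth a K C : 0 < K -> (forall n, 0 <= a n) ->
    (forall n, (1 < n)%N -> a n <= C * n%:R * K ^+ n) ->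
  forall r : R, 0 < r -> r < K^-1 -> cvgn (series (fun n => a n * r ^+ n)).
Proof.
move=> K0 a0 aC r r0 rK.
have q0 : 0 < K * r by rewrite mulr_gt0.
have q1 : K * r < 1 by rewrite mulrC -ltr_pdivlMr // mul1r.
pose s := Num.sqrt (K * r).
have s0 : 0 <= s by exact: sqrtr_ge0.
have ss : s ^+ 2 = K * r by rewrite sqr_sqrtr // ltW.
have s1 : s < 1 by rewrite -(sqrtr1 R) ltr_sqrt.
have sp : 0 < s by rewrite sqrtr_gt0.
(* The last two summands take care of the indices 0 and 1, for which no growth bound is assumed. *)
pose B := `|C| * (1 - s)^-1 + a 0%N + a 1%N * r / s.
have B0 : 0 <= B.
  by rewrite !addr_ge0 ?mulr_ge0 ?invr_ge0 ?subr_ge0 ?(ltW s1) ?(ltW r0) //.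
apply: (@series_le_cvg R _ (fun n => B * s ^+ n)).
- by move=> n; rewrite mulr_ge0 // exprn_ge0 // ltW.
- by move=> n; rewrite mulr_ge0 // exprn_ge0.
- move=> [|[|n]].
  + rewrite !expr0 !mulr1 /B addrAC lerDr addr_ge0 ?mulr_ge0 ?invr_ge0 ?subr_ge0 ?(ltW s1) ?(ltW r0) //.
  + rewrite !expr1 -ler_pdivrMr // /B lerDr addr_ge0 ?mulr_ge0 ?invr_ge0 ?subr_ge0 ?(ltW s1) //.
  + set m := n.+2; apply: (@le_trans _ _ (C * m%:R * K ^+ m * r ^+ m)).
      by apply: ler_wpM2r; [rewrite exprn_ge0 // ltW|exact: aC].
    rewrite -[leLHS]mulrA -exprMn -ss -exprM mul2n -addnn exprD mulrA.
    apply: ler_wpM2r; first exact: exprn_ge0.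
    apply: (@le_trans _ _ (`|C| * (1 - s)^-1)); last first.
      by rewrite /B -addrA lerDl addr_ge0 ?mulr_ge0 ?invr_ge0 ?(ltW r0).
    rewrite -mulrA; apply: (@le_trans _ _ (`|C| * (m%:R * s ^+ m))).
      by apply: ler_wpM2r; [rewrite mulr_ge0 // exprn_ge0|exact: ler_norm].
    by apply: ler_wpM2l => //; exact: natr_mul_exp_le.
- by apply: is_cvg_geometric_series; rewrite ger0_norm.
Qed.

Lemma radius_ge0 a : (0 <= radius_of_convergence a)%E.
Proof.
apply: ereal_sup_ubound; exists 0; first by rewrite normr0.
have -> : (fun n => a n * 0 ^+ n) = (fun n => a 0%N * 0 ^+ n).
  by apply/funext=> -[|n] //; rewrite exprS mul0r !mulr0.
by apply: is_cvg_geometric_series; rewrite normr0.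
Qed.

(** Were the radius smaller than [K^-1], the midpoint between them would be a point of convergence
    beyond the radius. *)
Lemma inv_radius_le a K C : 0 < K -> (forall n, 0 <= a n) ->
    (forall n, (1 < n)%N -> a n <= C * n%:R * K ^+ n) ->
  ((radius_of_convergence a)^-1 <= K%:E)%E.
Proof.
move=> K0 a0 aC.
have -> : K%:E = ((K^-1)%:E^-1)%E by rewrite inver invr_eq0 gt_eqF // invrK.
have Ki : 0 < K^-1 by rewrite invr_gt0.
rewrite lee_pV2 ?inE ?radius_ge0 ?lee_fin ?(ltW Ki) //.
rewrite leNgt; apply/negP; have := radius_ge0 a.
case E : (radius_of_convergence a) => [s| |] //; rewrite lee_fin lte_fin => s0 sK.
have r0 : 0 < (s + K^-1) / 2 by rewrite divr_gt0 // ltr_wpDl.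
have rK : (s + K^-1) / 2 < K^-1 by lra.
have : (((s + K^-1) / 2)%:E <= radius_of_convergence a)%E.
  apply: ereal_sup_ubound; exists ((s + K^-1) / 2); first by rewrite gtr0_norm.
  exact: (cvg_series_growth K0 a0 aC).
by rewrite E lee_fin; lra.
Qed.

Lemma inv_radius_ge a K : 0 < K ->
    (forall z, cvgn (series (fun n => a n * z ^+ n)) -> `|z| <= K^-1) ->
  (K%:E <= (radius_of_convergence a)^-1)%E.
Proof.
move=> K0 h.
have -> : K%:E = ((K^-1)%:E^-1)%E by rewrite inver invr_eq0 gt_eqF // invrK.
have Ki : 0 < K^-1 by rewrite invr_gt0.
rewrite lee_pV2 ?inE ?radius_ge0 ?lee_fin ?(ltW Ki) //.
by apply: ge_ereal_sup => _ [z -> /h]; rewrite lee_fin.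
Qed.

End Radius.

Lemma inv_radius_meander_le (R : realType) (x : R) : (0 < x)%R ->
  ((radius_of_convergence (meander_coef x))^-1 <= (48 * Num.max 1 x)%:E)%E.
Proof.
move=> x0; apply: (@inv_radius_le _ _ _ 138%:R).
- by rewrite mulr_gt0 // lt_max ltr01.
- exact: meander_coef_ge0.
- exact: meander_coef_le.
Qed.

(** * Growing a tree by leaves *)

Section VertexLabels.
Variables (D : finType) (M : cmap D) (L : eqType) (lab : D -> L).
Hypothesis vI : injective (vrot M).
Hypothesis labv : forall d, lab (vrot M d) = lab d.
Hypothesis labc : forall d e, lab d = lab e -> fconnect (vrot M) d e.

Lemma vertex_lab d e : (vertex M d == vertex M e) = (lab d == lab e).
Proof.
rewrite (orb_eq vI); apply/idP/eqP => [/connectP[p hp ->]|/labc//].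
by elim: p d hp => //= x p IH d /andP[/eqP <- /IH <-]; rewrite labv.
Qed.

End VertexLabels.

(** A cycle through [x] or its reverse would meet the vertex of [x] along two tree darts, but [x] is
    the only one there. *)
Lemma leaf_notin_cycle (D : finType) (M : cmap D) (T : {set D}) (x : D) (c : seq D) :
    involutive (opp M) -> (forall d, (opp M d \in T) = (d \in T)) ->
    (forall y, y \in T -> vertex M y = vertex M x -> y = x) ->
    is_cycle M c -> {subset c <= T} -> x \notin c /\ opp M x \notin c.
Proof.
move=> oK Tc hx /and4P[_ cc _ /allP co] cT.
have xc : x \notin c.
  apply/negP=> h; have := prev_cycle cc h => /= /eqP e.
  have hp : path.prev c x \in c by rewrite mem_prev.
  have := hx (opp M (path.prev c x)); rewrite Tc cT // => /(_ isT e) e'.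
  by have := co _ hp; rewrite e' h.
split=> //; apply/negP=> h; have := next_cycle cc h; rewrite /= oK => /eqP e.
have hn : path.next c (opp M x) \in c by rewrite mem_next.
by move: xc; rewrite -(hx _ (cT _ hn) (esym e)) hn.
Qed.

Section LeafExtension.
Variables (D E : finType) (M : cmap D) (M' : cmap (D + E)%type) (T : {set D}).
Variables (lab : E -> option {set D}) (l q : E).

(** Names the vertices of the extended map: the old ones, and [None] for the single new vertex. The
    pendant edge consists of [l], which leaves the new vertex, and its reverse [q]. *)
Definition ext_lab (u : D + E) : option {set D} :=
  match u with inl e => Some (vertex M e) | inr p => lab p end.

Definition ext_tree : {set D + E} := (inl @: T) :|: [set inr l; inr q].

Hypothesis vI : injective (vrot M).
Hypothesis oK : involutive (opp M).
Hypothesis vI' : injective (vrot M').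
Hypothesis oK' : involutive (opp M').
Hypothesis labv : forall u, ext_lab (vrot M' u) = ext_lab u.
Hypothesis labc : forall u v, ext_lab u = ext_lab v -> fconnect (vrot M') u v.
Hypothesis labE : forall p, lab p != None -> exists e, lab p = Some (vertex M e).
Hypothesis ll : lab l = None.
Hypothesis lq : lab q != None.
Hypothesis olq : opp M' (inr l) = inr q.
Hypothesis oT : forall e, e \in T -> opp M' (inl e) = inl (opp M e).

Lemma ext_vertex u v : (vertex M' u == vertex M' v) = (ext_lab u == ext_lab v).
Proof. exact: vertex_lab. Qed.

Lemma card_ext_vertices : #|vertices M'| = #|vertices M|.+1.
Proof.
rewrite /vertices (card_orb_label vI' labv labc).
have -> : ext_lab @: [set: D + E] = None |: (Some @: (vertex M @: [set: D])).
  apply/setP=> x; apply/imsetP/setU1P => [[[e|p] _ ->]|[->|/imsetP[X /imsetP[e _ ->] ->]]].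
  - by right; apply: imset_f; apply: imset_f.
  - case: (eqVneq (lab p) None) => [h|/labE[e h]]; rewrite /= h; first by left.
    by right; apply: imset_f; apply: imset_f.
  - by exists (inr l).
  - by exists (inl e).
rewrite cardsU1 card_imset; last by move=> ? ? [].
by rewrite (_ : None \notin _) //; apply/imsetP=> -[].
Qed.

Lemma ext_tree_inl e : (inl e \in ext_tree) = (e \in T).
Proof. by rewrite !inE !orbF mem_imset // => ? ? []. Qed.

Lemma ext_tree_inr p : (inr p \in ext_tree) = (p == l) || (p == q).
Proof.
rewrite !inE; case: imsetP => [[]//|_] /=; congr (_ || _).
Qed.

Lemma ext_tree_opp : (forall d, (opp M d \in T) = (d \in T)) ->
  forall u, (opp M' u \in ext_tree) = (u \in ext_tree).
Proof.
move=> Tc.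
have h u : u \in ext_tree -> opp M' u \in ext_tree.
  case: u => [e|p]; rewrite ?ext_tree_inl ?ext_tree_inr.
    by move=> eT; rewrite oT // ext_tree_inl Tc.
  by case/orP=> /eqP ->; [rewrite olq|rewrite -olq oK']; rewrite ext_tree_inr eqxx ?orbT.
by move=> u; apply/idP/idP => [/h|/h//]; rewrite oK'.
Qed.

(** The pendant edge connects the new vertex and lies on no cycle of the tree, by
    [leaf_notin_cycle], so a cycle in the new tree would already be a cycle in [T]. *)
Lemma ext_spanning : spanning_tree M T -> spanning_tree M' ext_tree.
Proof.
case=> Tc Tconn Ta; have T'c := ext_tree_opp Tc; split=> //.
- pose r := tree_rel M' ext_tree.
  have symr : connect_sym r by apply: tree_rel_sym.
  have h1 e e' : connect r (inl e) (inl e').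
    have /connectP[p] := Tconn e e'; elim: p e => [|x p IH] e /= => [_ ->|]; first exact: connect0.
    case/andP=> h hp he; apply: connect_trans (IH _ hp he); apply: connect1.
    apply/orP; case/orP: h => [h|/andP[eT /eqP ->]]; first by left; rewrite ext_vertex /= (inj_eq Some_inj).
    by right; rewrite ext_tree_inl eT oT // eqxx.
  have h2 p : lab p != None -> exists e, connect r (inr p) (inl e).
    move=> /labE[e he]; exists e; apply: connect1; apply/orP; left.
    by rewrite ext_vertex /= he.
  have h3 u : exists e, connect r u (inl e).
    case: u => [e|p]; first by exists e; exact: connect0.
    case: (eqVneq (lab p) None) => [h|]; last exact: h2.
    have [e he] := h2 _ lq; exists e; apply: connect_trans he.
    apply: (@connect_trans _ _ (inr l)); apply: connect1; apply/orP.
      by left; rewrite ext_vertex /= h ll.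
    by right; rewrite ext_tree_inr eqxx olq /=.
  move=> u v; have [e he] := h3 u; have [e' he'] := h3 v.
  apply: (connect_trans he); apply: (connect_trans (h1 e e')).
  by rewrite -/r -/(connect r _ _) symr.
- move=> c hc; apply/negP=> /allP cT'.
  have [] := @leaf_notin_cycle _ M' ext_tree (inr l) c oK' T'c _ hc cT'.
    move=> [e|p]; rewrite ?ext_tree_inl ?ext_tree_inr => h /eqP.
      by rewrite ext_vertex /= ll.
    by rewrite ext_vertex /= ll; case/orP: h => /eqP -> //; rewrite (negbTE lq).
  rewrite olq => lc qc.
  have [c0 ec] : exists c0, c = map inl c0.
    move: lc qc cT'; elim: (c) => [|[e|p] s IH]; first by exists [::].
      rewrite !inE /= => h1 h2 h3; have [||x hx|c0 ->] := IH => //.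
        by apply: h3; rewrite inE hx orbT.
      by exists (e :: c0).
    rewrite !inE !negb_or => /andP[h1 _] /andP[h2 _] h3.
    have : inr p \in ext_tree by apply: h3; rewrite inE eqxx.
    rewrite ext_tree_inr.
    have e1 : (inr l == inr p :> D + E) = (l == p) by [].
    have e2 : (inr q == inr p :> D + E) = (q == p) by [].
    by rewrite e1 eq_sym in h1; rewrite e2 eq_sym in h2; rewrite (negbTE h1) (negbTE h2).
  have c0T : {subset c0 <= T} by move=> e he; rewrite -ext_tree_inl; apply: cT'; rewrite ec map_f.
  have : is_cycle M c0.
    move: hc; rewrite ec => /and4P[h1 h2 h3 h4]; apply/and4P; split.
    - by case: (c0) h1.
    - move: h2; rewrite cycle_map; apply: (@sub_in_cycle _ (mem T)); last by apply/allP.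
      by move=> x y xT yT /=; rewrite oT // ext_vertex /= (inj_eq Some_inj).
    - apply: (@map_uniq _ _ (fun X : {set D} => Some X)).
      have e : [seq Some X | X <- [seq vertex M i | i <- c0]] = map ext_lab (map inl c0).
        by rewrite -!map_comp.
      rewrite e; move: h3; set s := map inl c0.
      elim: s => //= x s IH /andP[n /IH ->]; rewrite andbT.
      apply: contra n => /mapP[y ys hy]; apply/mapP; exists y => //.
      by apply/eqP; rewrite ext_vertex hy.
    - apply/allP=> e he; have := allP h4 (inl e); rewrite (mem_map (@inl_inj _ _)) he => /(_ isT).
      by rewrite oT ?(mem_map (@inl_inj _ _)) // c0T.
  by move/Ta; case/negP; apply/allP.
Qed.

End LeafExtension.

(** The invariant carried through the constructions. Planarity is derived from the two counts, by
    [tree_map_planar]. *)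
Definition tree_map (n : nat) (D : finType) (M : cmap D) (T : {set D}) : Prop :=
  [/\ involutive (opp M) /\ (forall d, opp M d != d),
      forall d, lnext M (lnext M (lnext M d)) = d, forall d, lnext M d != d,
      spanning_tree M T & #|vertices M| = n.+1 /\ #|D| + 6 = 6 * n].

Lemma card_face_tri (D : finType) (f : D -> D) (d : D) :
  f (f (f d)) = d -> f d != d -> #|orb f d| = 3.
Proof.
move=> f3 f1.
have f2 : f (f d) != d by apply/eqP=> e; have := f3; rewrite e => e'; move: f1; rewrite e' eqxx.
have f12 : f (f d) != f d by apply/eqP=> e; have := f3; rewrite !e => e'; move: f1; rewrite e' eqxx.
have -> : orb f d = [set d; f d; f (f d)].
  apply/setP=> x; rewrite !inE; apply/idP/idP => [/connectP[p]|]; last first.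
    case/orP=> [/orP[]|] /eqP ->; [exact: connect0|exact: fconnect1|exact: (fconnect_iter f 2 d)].
  have : forall y, y \in [set d; f d; f (f d)] -> fpath f y p -> x = last y p -> x \in [set d; f d; f (f d)].
    elim: p => [|z p IH] y hy /= => [_ ->//|/andP[/eqP<- hp] hx].
    apply: (IH (f y)) => //; move: hy; rewrite !inE.
    by case/orP=> [/orP[]|] /eqP ->; rewrite ?f3 eqxx ?orbT.
  by move=> /(_ d); rewrite !inE eqxx => h hp hx; exact: h.
by rewrite setUC cardsU1 cards2 !inE negb_or f2 f12 eq_sym f1.
Qed.

Lemma Z3_add111 (i : 'Z_3) : (i + 1 + 1 + 1 = i)%R.
Proof. by elim/Z3P: i; apply: val_inj. Qed.

Section TreeMaps.
Variables (n : nat) (D : finType) (M : cmap D) (T : {set D}).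
Hypothesis h : tree_map n M T.

Let oK : involutive (opp M). Proof. by case: h => -[]. Qed.
Let oN : forall d, opp M d != d. Proof. by case: h => -[]. Qed.
Let n3 : forall d, lnext M (lnext M (lnext M d)) = d. Proof. by case: h. Qed.
Let n1 : forall d, lnext M d != d. Proof. by case: h. Qed.

Lemma tree_map_lnext_inj : injective (lnext M).
Proof. by move=> d e E; rewrite -(n3 d) E n3. Qed.

(** Connectedness comes from the spanning tree. With [6n - 6] darts in triangles there are [3n - 3]
    edges and [2n - 2] faces, which together with [n + 1] vertices gives characteristic 2. *)
Lemma tree_map_planar : planar_triangulation M.
Proof.
have f3 d : #|face M d| = 3 by apply: card_face_tri.
split=> //; split=> //; first exact: tree_map_lnext_inj.
  case: h => _ _ _ [_ hc _] _ d e.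
  have /connectP[p] := hc d e; elim: p d => [|x p IH] d /= => [_ ->|]; first exact: connect0.
  case/andP=> hx hp he; apply: connect_trans (IH _ hp he).
  case/orP: hx => [|/andP[_ /eqP ->]]; last by apply: connect1; rewrite /= eqxx.
  rewrite eq_sym (orb_eq (vrot_inj oK tree_map_lnext_inj)).
  apply: connect_sub => u v /= /eqP <-.
  apply: (@connect_trans _ _ (opp M u)); apply: connect1; rewrite /= /vrot ?eqxx ?orbT //.
have h1 := card_edges oK oN.
have h2 : #|faces M| * 3 = #|D|.
  rewrite -(sum_card_orb tree_map_lnext_inj) -sum_nat_const.
  by apply: eq_bigr => X /imsetP[d _ ->]; rewrite -(f3 d).
case: h => _ _ _ _ [h3 h4]; lia.
Qed.

Lemma tree_map_in_S (r : D) : r \in T -> in_S n (RMap M r) T.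
Proof. by move=> rT; split=> //; [exact: tree_map_planar|case: h => _ _ _ _ []|case: h]. Qed.

Definition loopless := forall d, vertex M d != vertex M (opp M d).

(** For [S] the tree, this rules out tree edges on cycles of length 2; together with [loopless] it
    is stable under insertions. *)
Definition simple_on (S : {set D}) := forall t e, t \in S ->
  vertex M e = vertex M t -> vertex M (opp M e) = vertex M (opp M t) -> e = t.

End TreeMaps.

Lemma simple_in_H n (D : finType) (M : cmap D) (T : {set D}) (r : D) :
    tree_map n M T -> hierarchical M -> simple_on M T -> r \in T ->
  in_H n (RMap M r) T.
Proof.
move=> h hh hs rT; split=> //; first exact: tree_map_in_S.
have oK : involutive (opp M) by case: h => -[].
move=> [|x [|y [|z c]]] d //= /and4P[_ cc _ co] _.
move: cc co; rewrite /= !andbT => /andP[/eqP e1 /eqP e2] /andP[k1 k2].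
have hx : x \in T -> False.
  move=> xT; have := hs _ (opp M y) xT e2; rewrite oK -e1 => /(_ erefl) E.
  by rewrite E !inE eqxx in k2.
have hy : y \in T -> False.
  move=> yT; have := hs _ (opp M x) yT e1; rewrite oK -e2 => /(_ erefl) E.
  by rewrite E !inE eqxx orbT in k1.
by rewrite !inE => /orP[] /eqP ->; apply/negP.
Qed.

(** * Inserting a pair of triangles *)

Section InsertPair.
Variables (n : nat) (D : finType) (M : cmap D) (T : {set D}) (d : D) (s : bool).
Hypothesis h : tree_map n M T.
Hypothesis dT : d \notin T.

Let M' := insert_pair M d.

Let oK : involutive (opp M). Proof. by case: h => -[]. Qed.
Let oN : forall d, opp M d != d. Proof. by case: h => -[]. Qed.
Let n3 : forall d, lnext M (lnext M (lnext M d)) = d. Proof. by case: h. Qed.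
Let n1 : forall d, lnext M d != d. Proof. by case: h. Qed.
Let nI := tree_map_lnext_inj h.
Let odd' : (opp M d == d) = false. Proof. exact/negbTE. Qed.

(** Origins of the six new darts: the sides of index 0 join the ends of [d], and those of index 2
    leave the new vertex. *)
Definition insert_lab (p : bool * 'Z_3) : option {set D} :=
  let (b, i) := p in
  if i == 2%R then None
  else if (i == 0%R) (+) b then Some (vertex M (opp M d)) else Some (vertex M d).

(** The bit [s] selects which of the two edges at the new vertex joins the tree. *)
Definition insert_tree : {set D + bool * 'Z_3} := ext_tree T (s, 2%R) (~~ s, 1%R).

Lemma insert_oppK : involutive (opp M').
Proof.
case=> [e|[b i]] /=.
  case: (eqVneq e d) => [->//|ed]; case: (eqVneq e (opp M d)) => [->//|eod] /=.
  by rewrite (can2_eq oK oK) (negbTE eod) (inj_eq (can_inj oK)) (negbTE ed) oK.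
by elim/Z3P: i => /=; rewrite ?opprK ?negbK //; case: b; rewrite /= ?eqxx ?odd'.
Qed.

Lemma insert_oppN u : opp M' u != u.
Proof.
case: u => [e|[b i]] /=; last by elim/Z3P: i; case: b.
by case: ifP => // _; case: ifP => // _; rewrite inl_eq oN.
Qed.

Lemma insert_n3 u : lnext M' (lnext M' (lnext M' u)) = u.
Proof.
case: u => [e|[b i]] /=; first by rewrite n3.
by rewrite Z3_add111.
Qed.

Lemma insert_n1 u : lnext M' u != u.
Proof.
case: u => [e|[b i]] /=; first by rewrite inl_eq n1.
by elim/Z3P: i; case: b.
Qed.

Lemma insert_lnext_inj : injective (lnext M').
Proof. by move=> u v E; rewrite -(insert_n3 u) E insert_n3. Qed.

Let vI := vrot_inj oK nI.
Let vI' := vrot_inj insert_oppK insert_lnext_inj.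

Lemma insert_labv u : ext_lab M insert_lab (vrot M' u) = ext_lab M insert_lab u.
Proof.
have vv e : vertex M (lnext M (opp M e)) = vertex M e by exact: (vertex_vrot oK nI).
case: u => [e|[b i]]; rewrite /vrot /=.
  case: (eqVneq e d) => [->//|ed]; case: (eqVneq e (opp M d)) => [->//|eod] /=.
  by rewrite vv.
elim/Z3P: i => //=; case: b => //=; first by rewrite vv.
by rewrite -(vertex_opp_lnext oK nI).
Qed.

(** At each end of [d], two new darts are interposed in the rotation, so one old step becomes
    three. *)
Lemma insert_fconnect e e' : vertex M e = vertex M e' -> fconnect (vrot M') (inl e) (inl e').
Proof.
move/eqP; rewrite (orb_eq vI) => /connectP[p hp ->] {e'}.
elim: p e hp => [|x p IH] e /=; first by move=> _; exact: connect0.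
case/andP=> /eqP <- hp; apply: connect_trans (IH _ hp).
case: (eqVneq e d) => [->|ed].
  have e1 : vrot M' (inl d) = inr (false, 1%R) by rewrite /vrot /= ?odd' ?eqxx /=; congr (inr (_, _)); apply: val_inj.
  have e2 : vrot M' (inr (false, 1%R)) = inr (true, 0%R) by rewrite /vrot /= ?odd' ?eqxx /=; congr (inr (_, _)); apply: val_inj.
  have e3 : vrot M' (inr (true, 0%R)) = inl (vrot M d) by [].
  by rewrite -e3 -e2 -e1; exact: (fconnect_iter _ 3).
case: (eqVneq e (opp M d)) => [->|eod].
  have e1 : vrot M' (inl (opp M d)) = inr (true, 1%R) by rewrite /vrot /= ?odd' ?eqxx /=; congr (inr (_, _)); apply: val_inj.
  have e2 : vrot M' (inr (true, 1%R)) = inr (false, 0%R) by rewrite /vrot /= ?odd' ?eqxx /=; congr (inr (_, _)); apply: val_inj.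
  have e3 : vrot M' (inr (false, 0%R)) = inl (vrot M (opp M d)) by rewrite /vrot oK.
  by rewrite -e3 -e2 -e1; exact: (fconnect_iter _ 3).
have <- : vrot M' (inl e) = inl (vrot M e) by rewrite /vrot /= (negbTE ed) (negbTE eod).
exact: fconnect1.
Qed.

Lemma insert_labc u v : ext_lab M insert_lab u = ext_lab M insert_lab v -> fconnect (vrot M') u v.
Proof.
have sym := fconnect_sym vI'.
have e1 : vrot M' (inl d) = inr (false, 1%R) by rewrite /vrot /= ?odd' ?eqxx /=; congr (inr (_, _)); apply: val_inj.
have e2 : vrot M' (inr (false, 1%R)) = inr (true, 0%R) by rewrite /vrot /= ?odd' ?eqxx /=; congr (inr (_, _)); apply: val_inj.
have e4 : vrot M' (inl (opp M d)) = inr (true, 1%R) by rewrite /vrot /= ?odd' ?eqxx /=; congr (inr (_, _)); apply: val_inj.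
have e5 : vrot M' (inr (true, 1%R)) = inr (false, 0%R) by rewrite /vrot /= ?odd' ?eqxx /=; congr (inr (_, _)); apply: val_inj.
have e6 : vrot M' (inr (false, 2%R)) = inr (true, 2%R) by rewrite /vrot /= ?odd' ?eqxx /=; congr (inr (_, _)); apply: val_inj.
have key w : ext_lab M insert_lab w != None ->
    exists2 e, fconnect (vrot M') w (inl e) & ext_lab M insert_lab w = Some (vertex M e).
  case: w => [e|[b i]]; first by exists e => //; exact: connect0.
  elim/Z3P: i => //= _; case: b => /=.
  - exists d => //; rewrite sym -e2 -e1; exact: (fconnect_iter _ 2).
  - exists (opp M d) => //; rewrite sym -e5 -e4; exact: (fconnect_iter _ 2).
  - exists (opp M d) => //; rewrite sym -e4; exact: fconnect1.
  - exists d => //; rewrite sym -e1; exact: fconnect1.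
have keyN w : ext_lab M insert_lab w = None -> fconnect (vrot M') w (inr (true, 2%R)).
  case: w => // -[b i]; elim/Z3P: i => //=; try by case: b.
  case: b => _; first exact: connect0.
  by rewrite -e6; exact: fconnect1.
move=> E; case: (eqVneq (ext_lab M insert_lab u) None) => hu.
  apply: (connect_trans (keyN _ hu)); rewrite sym; apply: keyN; by rewrite -E.
have [e he1 he2] := key _ hu.
rewrite E in hu; have [e' he1' he2'] := key _ hu.
apply: (connect_trans he1); rewrite E he2' in he2; case: he2 => he2.
by rewrite sym; apply: (connect_trans he1'); exact: insert_fconnect.
Qed.

Lemma insert_labE p : insert_lab p != None -> exists e, insert_lab p = Some (vertex M e).
Proof.
by case: p => b i /=; case: ifP => // _; case: ifP => _ _; [exists (opp M d)|exists d].
Qed.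

Lemma insert_oT e : e \in T -> opp M' (inl e) = inl (opp M e).
Proof.
move=> eT; have Tc : forall d, (opp M d \in T) = (d \in T) by case: h => _ _ _ [].
rewrite /=; case: eqP => [E|_]; first by rewrite E (negbTE dT) in eT.
by case: eqP => [E|//]; rewrite E Tc (negbTE dT) in eT.
Qed.

Lemma insert_tree_map : tree_map n.+1 M' insert_tree.
Proof.
have lq : insert_lab (~~ s, 1%R) != None by case: s.
have ll : insert_lab (s, 2%R) = None by case: s.
have olq : opp M' (inr (s, 2%R)) = inr (~~ s, 1%R).
  by rewrite /=; congr (inr (_, _)); apply: val_inj.
case: (h) => _ _ _ hT [hV hD].
split; [split; [exact: insert_oppK|exact: insert_oppN]|exact: insert_n3|exact: insert_n1| |].
  exact: (ext_spanning vI' insert_oppK insert_labv insert_labc insert_labE ll lq olq insert_oT hT).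
split; first by rewrite (card_ext_vertices vI' insert_labv insert_labc insert_labE ll) hV.
rewrite card_sum card_pair_dart; lia.
Qed.

Hypothesis hl : loopless M.

Let vE u v : vertex M' u = vertex M' v <-> ext_lab M insert_lab u = ext_lab M insert_lab v.
Proof. by split=> /eqP E; apply/eqP; move: E; rewrite (vertex_lab vI' insert_labv insert_labc). Qed.

Lemma insert_loopless : loopless M'.
Proof.
move=> u; apply/eqP => /vE; case: u => [e|[b i]] /=.
  case: (eqVneq e d) => [->|ed] /=.
    by case=> /eqP; rewrite (negbTE (hl _)).
  case: (eqVneq e (opp M d)) => [->|eod] /=.
    by case=> /eqP; rewrite eq_sym (negbTE (hl _)).
  by case=> /eqP; rewrite (negbTE (hl _)).
elim/Z3P: i => //=; case: b => //= -[/eqP]; first by rewrite (negbTE (hl _)).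
by rewrite eq_sym (negbTE (hl _)).
Qed.

(** The edges joining old vertices are the old ones and a second copy of [d], and [d] is parallel to
    no tree edge as it is not in [T]. The two edges at the new vertex end at different vertices
    because there are no loops. *)
Lemma insert_simple : simple_on M T -> simple_on M' insert_tree.
Proof.
move=> hs t e tT /vE h1 /vE h2.
have Tc : forall d, (opp M d \in T) = (d \in T) by case: h => _ _ _ [].
have hlF : vertex M d = vertex M (opp M d) -> False by move=> E; have := hl d; rewrite E eqxx.
case: t tT h1 h2 => [t|[b i]].
  rewrite ext_tree_inl => tT; rewrite insert_oT //.
  have nd : vertex M d = vertex M t -> vertex M (opp M d) = vertex M (opp M t) -> False.
    by move=> v1 v2; move: dT; rewrite (hs _ _ tT v1 v2) tT.
  have nod : vertex M (opp M d) = vertex M t -> vertex M d = vertex M (opp M t) -> False.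
    move=> v1 v2; have := hs _ (opp M d) tT v1; rewrite oK => /(_ v2) E.
    by move: dT; rewrite -Tc E tT.
  case: e => [e|[b i]] /=.
    case: (eqVneq e d) => [->|ed] /=; first by move=> [v1] [v2]; case: (nd v1 v2).
    case: (eqVneq e (opp M d)) => [->|eod] /=; first by move=> [v1] [v2]; case: (nod v1 v2).
    by move=> [v1] [v2]; rewrite (hs _ _ tT v1 v2).
  elim/Z3P: i => //=; case: b => //= -[v1] [v2]; first by case: (nd v1 v2).
  by case: (nod v1 v2).
rewrite ext_tree_inr => /orP[] /eqP -> {b i}.
  case: e => [e|[b i]] //=; elim/Z3P: i => //=; try by case: b.
  by case: b; case: s => //= _ [E]; case: hlF; rewrite E.
case: e => [e|[b i]] //=.
  by case: (eqVneq e d) => _ //=; case: (eqVneq e (opp M d)) => _ //=.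
elim/Z3P: i => //=; try by case: b; case: s.
by case: b; case: s => //= -[E]; case: hlF; rewrite E.
Qed.

End InsertPair.

(** * Subdividing a triangle *)

Section Subdivide.
Variables (n : nat) (D : finType) (M : cmap D) (T : {set D}) (d : D) (j : 'Z_3).
Hypothesis h : tree_map n M T.

Let M' := subdivide M d.

Let oK : involutive (opp M). Proof. by case: h => -[]. Qed.
Let oN : forall d, opp M d != d. Proof. by case: h => -[]. Qed.
Let n3 : forall d, lnext M (lnext M (lnext M d)) = d. Proof. by case: h. Qed.
Let n1 : forall d, lnext M d != d. Proof. by case: h. Qed.
Let nI := tree_map_lnext_inj h.

Definition tri_dart (i : 'Z_3) : D := iter i (lnext M) d.

Definition subdivide_lab (p : bool * 'Z_3) : option {set D} :=
  if p.1 then Some (vertex M (tri_dart p.2)) else None.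

Definition subdivide_tree : {set D + bool * 'Z_3} := ext_tree T (false, j) (true, j).

Lemma tri_dart_next i : lnext M (tri_dart i) = tri_dart (i + 1)%R.
Proof. by elim/Z3P: i; rewrite /tri_dart //= n3. Qed.

Lemma tri_dart_inj : injective tri_dart.
Proof.
have a := n1 d; have b := n1 (lnext M d); have c := n1 (lnext M (lnext M d)).
rewrite n3 in c.
move=> i k; elim/Z3P: i; elim/Z3P: k; rewrite /tri_dart //= => /eqP;
  first [by rewrite (negbTE a)|by rewrite (negbTE b)|by rewrite (negbTE c)
        |by rewrite eq_sym (negbTE a)|by rewrite eq_sym (negbTE b)|by rewrite eq_sym (negbTE c)].
Qed.

Lemma subdivide_lnext_tri i : lnext M' (inl (tri_dart i)) = inr (true, (i + 1)%R).
Proof.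
have a := inj_eq tri_dart_inj.
have e0 : (tri_dart i == d) = (i == 0%R) by rewrite -(a i 0%R).
have e1 : (tri_dart i == lnext M d) = (i == 1%R) by rewrite -(a i 1%R).
have e2 : (tri_dart i == lnext M (lnext M d)) = (i == 2%R) by rewrite -(a i 2%R).
rewrite /= e0 e1 e2 {e0 e1 e2}.
by elim/Z3P: i => /=; congr (inr (_, _)); apply: val_inj.
Qed.

Lemma subdivide_lnext_out e : (forall i, e != tri_dart i) -> lnext M' (inl e) = inl (lnext M e).
Proof.
move=> H; rewrite /=.
by rewrite (negbTE (H 0%R)) (negbTE (H 1%R)) (negbTE (H 2%R)).
Qed.

Lemma tri_dartP e : (exists i, e = tri_dart i) \/ (forall i, e != tri_dart i).
Proof.
case: (boolP [exists i, e == tri_dart i]) => [/existsP[i /eqP]|]; first by left; exists i.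
by rewrite negb_exists => /forallP; right.
Qed.

Lemma subdivide_oppK : involutive (opp M').
Proof. by case=> [e|[b i]] /=; rewrite ?oK ?negbK. Qed.

Lemma subdivide_oppN u : opp M' u != u.
Proof. by case: u => [e|[b i]] /=; [rewrite inl_eq oN|case: b]. Qed.

Lemma subdivide_lnext_new i : lnext M' (inr (true, i)) = inr (false, (i - 1)%R).
Proof. by []. Qed.

Lemma subdivide_lnext_back i : lnext M' (inr (false, i)) = inl (tri_dart i).
Proof. by []. Qed.

Lemma subdivide_n3 u : lnext M' (lnext M' (lnext M' u)) = u.
Proof.
case: u => [e|[b i]].
  case: (tri_dartP e) => [[i ->]|H].
    by rewrite subdivide_lnext_tri subdivide_lnext_new subdivide_lnext_back addrK.
  have H1 i : lnext M e != tri_dart i.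
    apply/eqP=> E; have := H (i + 1 + 1)%R; rewrite -!tri_dart_next -E n3 eqxx //.
  have H2 i : lnext M (lnext M e) != tri_dart i.
    by apply/eqP=> E; have := H (i + 1)%R; rewrite -!tri_dart_next -E n3 eqxx.
  by rewrite !subdivide_lnext_out ?n3.
case: b.
  by rewrite subdivide_lnext_new subdivide_lnext_back subdivide_lnext_tri subrK.
by rewrite subdivide_lnext_back subdivide_lnext_tri subdivide_lnext_new addrK.
Qed.

Lemma subdivide_n1 u : lnext M' u != u.
Proof.
case: u => [e|[[] i]] //.
case: (tri_dartP e) => [[i ->]|H]; first by rewrite subdivide_lnext_tri.
by rewrite subdivide_lnext_out // inl_eq n1.
Qed.

Lemma subdivide_lnext_inj : injective (lnext M').
Proof. by move=> u v E; rewrite -(subdivide_n3 u) E subdivide_n3. Qed.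

Let vI := vrot_inj oK nI.
Let vI' := vrot_inj subdivide_oppK subdivide_lnext_inj.

Lemma subdivide_labv u : ext_lab M subdivide_lab (vrot M' u) = ext_lab M subdivide_lab u.
Proof.
case: u => [e|[[] i]]; rewrite /vrot.
- rewrite [opp M' _]/=; case: (tri_dartP (opp M e)) => [[i E]|H].
    rewrite E subdivide_lnext_tri /= /subdivide_lab /= -tri_dart_next -E.
    by rewrite -(vertex_opp_lnext oK nI) oK.
  by rewrite subdivide_lnext_out //= -(vertex_opp_lnext oK nI) oK.
- by [].
- by [].
Qed.

(** One spoke is interposed in the rotation at each corner of the subdivided triangle. *)
Lemma subdivide_fconnect e e' : vertex M e = vertex M e' -> fconnect (vrot M') (inl e) (inl e').
Proof.
move/eqP; rewrite (orb_eq vI) => /connectP[p hp ->] {e'}.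
elim: p e hp => [|x p IH] e /=; first by move=> _; exact: connect0.
case/andP=> /eqP <- hp; apply: connect_trans (IH _ hp).
case: (tri_dartP (opp M e)) => [[i E]|H].
  have e1 : vrot M' (inl e) = inr (true, (i + 1)%R).
    by rewrite /vrot [opp M' _]/= E subdivide_lnext_tri.
  have e2 : vrot M' (inr (true, (i + 1)%R)) = inl (vrot M e).
    by rewrite /vrot E tri_dart_next.
  by rewrite -e2 -e1; exact: (fconnect_iter _ 2).
have <- : vrot M' (inl e) = inl (vrot M e) by rewrite /vrot [opp M' _]/= subdivide_lnext_out.
exact: fconnect1.
Qed.

Lemma subdivide_labc u v : ext_lab M subdivide_lab u = ext_lab M subdivide_lab v -> fconnect (vrot M') u v.
Proof.
have sym := fconnect_sym vI'.
have key w : ext_lab M subdivide_lab w != None ->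
    exists2 e, fconnect (vrot M') w (inl e) & ext_lab M subdivide_lab w = Some (vertex M e).
  case: w => [e|[[] i]] //; first by exists e => //; exact: connect0.
  move=> _; exists (tri_dart i) => //.
  have <- : vrot M' (inr (true, i)) = inl (tri_dart i) by [].
  exact: fconnect1.
have keyN w : ext_lab M subdivide_lab w = None -> fconnect (vrot M') w (inr (false, 2%R)).
  case: w => // -[[] i] // _.
  have e1 k : vrot M' (inr (false, k)) = inr (false, (k - 1)%R) by [].
  elim/Z3P: i; last exact: connect0.
    have -> : inr (false, 2%R) = vrot M' (inr (false, 0%R)) :> D + bool * 'Z_3.
      by rewrite e1; congr (inr (_, _)); apply: val_inj.
    exact: fconnect1.
  have -> : inr (false, 2%R) = vrot M' (vrot M' (inr (false, 1%R))) :> D + bool * 'Z_3.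
    by rewrite !e1; congr (inr (_, _)); apply: val_inj.
  exact: (fconnect_iter _ 2).
move=> E; case: (eqVneq (ext_lab M subdivide_lab u) None) => hu.
  apply: (connect_trans (keyN _ hu)); rewrite sym; apply: keyN; by rewrite -E.
have [e he1 he2] := key _ hu.
rewrite E in hu; have [e' he1' he2'] := key _ hu.
apply: (connect_trans he1); rewrite E he2' in he2; case: he2 => he2.
by rewrite sym; apply: (connect_trans he1'); exact: subdivide_fconnect.
Qed.

Lemma subdivide_labE p : subdivide_lab p != None -> exists e, subdivide_lab p = Some (vertex M e).
Proof. by case: p => -[] i //= _; exists (tri_dart i). Qed.

Lemma subdivide_tree_map : tree_map n.+1 M' subdivide_tree.
Proof.
have lq : subdivide_lab (true, j) != None by [].
have ll : subdivide_lab (false, j) = None by [].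
have olq : opp M' (inr (false, j)) = inr (true, j) by [].
have oT e : e \in T -> opp M' (inl e) = inl (opp M e) by [].
case: (h) => _ _ _ hT [hV hD].
split; [split; [exact: subdivide_oppK|exact: subdivide_oppN]|exact: subdivide_n3|exact: subdivide_n1| |].
  exact: (ext_spanning vI' subdivide_oppK subdivide_labv subdivide_labc subdivide_labE ll lq olq oT hT).
split; first by rewrite (card_ext_vertices vI' subdivide_labv subdivide_labc subdivide_labE ll) hV.
rewrite card_sum card_pair_dart; lia.
Qed.

End Subdivide.

(** * The triangulation with two triangles *)

(** The path formed by the edges 0 and 2, whose middle vertex is 0. *)
Definition two_tree : {set bool * 'Z_3} := [set u : bool * 'Z_3 | u.2 != 1%R].

Section TwoTriangles.

Let lab (u : bool * 'Z_3) : 'Z_3 := if u.1 then (u.2 + 1)%R else u.2.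

Let oK : involutive (opp two_triangles).
Proof. by case=> b i; rewrite /= negbK. Qed.

Let n3 u : lnext two_triangles (lnext two_triangles (lnext two_triangles u)) = u.
Proof. by case: u => [[] i] /=; congr (_, _); elim/Z3P: i; apply: val_inj. Qed.

Let nI : injective (lnext two_triangles).
Proof. by move=> u v E; rewrite -(n3 u) E n3. Qed.

Let vI := vrot_inj oK nI.

Lemma two_vertex u v : (vertex two_triangles u == vertex two_triangles v) = (lab u == lab v).
Proof.
apply: vertex_lab => //.
  by case=> [[] i]; rewrite /vrot /lab /=; elim/Z3P: i; apply: val_inj.
have h i : vrot two_triangles (true, i) = (false, (i + 1)%R) by [].
case=> [[] i] [[] k]; rewrite /lab /= => E.
- have -> : i = k by move: E => /addIr.
  exact: connect0.
- by rewrite -E -h; exact: fconnect1.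
- by rewrite E -h (fconnect_sym vI); exact: fconnect1.
- by rewrite E; exact: connect0.
Qed.

Lemma two_triangles_loopless : loopless two_triangles.
Proof. by move=> [[] i]; rewrite two_vertex /lab /=; elim/Z3P: i. Qed.

Lemma two_triangles_simple : simple_on two_triangles two_tree.
Proof.
move=> [b i] [b' i'] _ /eqP; rewrite two_vertex => /eqP E1 /eqP; rewrite two_vertex => /eqP.
move: E1; rewrite /lab /=.
by case: b; case: b'; elim/Z3P: i; elim/Z3P: i' => //= /eqP + /eqP.
Qed.

Lemma two_triangles_tree_map : tree_map 2 two_triangles two_tree.
Proof.
split.
- by split=> //; case=> [[] i].
- exact: n3.
- by case=> [[] i] /=; elim/Z3P: i.
- have Tc d : (opp two_triangles d \in two_tree) = (d \in two_tree) by rewrite !inE.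
  split=> //.
  + have sym : connect_sym (tree_rel two_triangles two_tree) by exact: tree_rel_sym.
    have key u : connect (tree_rel two_triangles two_tree) u (false, 0%R).
      have v0 w : lab w = 0%R -> connect (tree_rel two_triangles two_tree) w (false, 0%R).
        by move=> E; apply: connect1; apply/orP; left; rewrite two_vertex E.
      have v1 w : lab w = 1%R -> connect (tree_rel two_triangles two_tree) w (false, 0%R).
        move=> E; apply: (@connect_trans _ _ (true, 0%R)); apply: connect1; apply/orP.
          by left; rewrite two_vertex E.
        by right; rewrite inE.
      have v2 w : lab w = 2%R -> connect (tree_rel two_triangles two_tree) w (false, 0%R).
        move=> E; apply: (@connect_trans _ _ (false, 2%R)).
          by apply: connect1; apply/orP; left; rewrite two_vertex E.
        apply: (@connect_trans _ _ (true, 2%R)); apply: connect1; apply/orP; first by right; rewrite inE.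
        by left; rewrite two_vertex.
      move: (erefl (lab u)); move: {2}(lab u) => k; elim/Z3P: k; [exact: v0|exact: v1|exact: v2].
    by move=> d e; apply: (connect_trans (key d)); rewrite -/(connect _ _ _) sym; exact: key.
  (* The vertices 1 and 2 are leaves, so neither of the two tree edges lies on a cycle. *)
  + move=> c hc; apply/negP=> /allP cT.
    have [] := leaf_notin_cycle (x := (true, 0%R)) oK Tc _ hc cT.
      move=> [b i] hT /eqP; rewrite two_vertex /lab; move: hT; rewrite inE /=.
      by case: b; elim/Z3P: i.
    have [] := leaf_notin_cycle (x := (false, 2%R)) oK Tc _ hc cT.
      move=> [b i] hT /eqP; rewrite two_vertex /lab; move: hT; rewrite inE /=.
      by case: b; elim/Z3P: i.
    move=> /= a1 a2 a3 a4.
    case: c hc cT a1 a2 a3 a4 => // u c _ cT.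
    have : u \in two_tree by apply: cT; rewrite inE eqxx.
    rewrite !inE !negb_or => hu /andP[+ _] /andP[+ _] /andP[+ _] /andP[+ _].
    by move: hu; case: u {cT} => -[] i; elim/Z3P: i.
- split; last by rewrite card_pair_dart.
  rewrite /vertices (card_orb_label (L := 'Z_3) (lab := lab) vI); last 2 first.
  + by case=> [[] i]; rewrite /vrot /lab /=; elim/Z3P: i; apply: val_inj.
  + by move=> u v /eqP; rewrite -two_vertex (orb_eq vI).
  rewrite -[RHS](card_ord 3); apply: eq_card => k; apply/imsetP.
  by exists (false, k).
Qed.

End TwoTriangles.

(** * Strips of triangles *)

Section Strip.
Variables (D : finType) (M : cmap D).

(* An entry [(x, d, k)] is a triangle with left dart [d], whose third side has  *)
(* label [k] and lies on the top boundary of the strip if [x], on the bottom    *)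
(* boundary otherwise.                                                          *)
Definition entry := (bool * D * nat)%type.

Definition rdart (e : entry) : D :=
  if e.1.1 then lnext M e.1.2 else lnext M (lnext M e.1.2).

Definition sidedart (e : entry) : D :=
  if e.1.1 then lnext M (lnext M e.1.2) else lnext M e.1.2.

Definition tri3 (d : D) : seq D := [:: d; lnext M d; lnext M (lnext M d)].

Definition sdarts (es : seq entry) : seq D := flatten [seq tri3 e.1.2 | e <- es].

Fixpoint chain (z : D) (es : seq entry) (z' : D) : Prop :=
  if es is e :: es' then e.1.2 = z /\ chain (opp M (rdart e)) es' z' else z = z'.

Definition ssides (z0 : D) (l0 : nat) (es : seq entry) (z1 : D) (l1 : nat) : seq (D * nat) :=
  (z0, l0) :: rcons [seq (sidedart e, e.2) | e <- es] (z1, l1).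

(** A triangulation cut along its tree into a polygon whose triangles form a strip. The sides of the
    polygon, including its two ends, are the tree darts, and equally labelled sides are glued. The
    number of darts forces the triangles to be disjoint, by [uniq_sdarts]. *)
Definition strip (T : {set D}) (es : seq entry) (z0 : D) (l0 : nat) (z1 : D) (l1 : nat) : Prop :=
  [/\ chain z0 es (opp M z1), forall d, d \in sdarts es, #|D| = 3 * size es,
      (forall p q, p \in ssides z0 l0 es z1 l1 -> q \in ssides z0 l0 es z1 l1 ->
         p.2 = q.2 -> q.1 = p.1 \/ q.1 = opp M p.1)
    & forall d, (d \in T) = (d \in map fst (ssides z0 l0 es z1 l1))].

Lemma chain_cat z u v z' : chain z (u ++ v) z' <-> exists2 m, chain z u m & chain m v z'.
Proof.
elim: u z => [|e u IH] z /=; first by split=> [h|[m ->]] //; exists z.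
split=> [[h /IH[m h1 h2]]|[m [h h1] h2]]; first by exists m.
by split=> //; apply/IH; exists m.
Qed.

Lemma sdarts_cat u v : sdarts (u ++ v) = sdarts u ++ sdarts v.
Proof. by rewrite /sdarts map_cat flatten_cat. Qed.

Lemma size_sdarts es : size (sdarts es) = 3 * size es.
Proof. by elim: es => //= e es IH; rewrite /sdarts /= -/(sdarts es) IH mulnS. Qed.

Lemma sdartsP x es : reflect (exists2 e, e \in es & x \in tri3 e.1.2) (x \in sdarts es).
Proof.
apply: (iffP flattenP) => [[s /mapP[e he ->] hx]|[e he hx]]; first by exists e.
by exists (tri3 e.1.2) => //; apply/mapP; exists e.
Qed.

Section Uniq.
Hypothesis n3 : forall d, lnext M (lnext M (lnext M d)) = d.
Hypothesis n1 : forall d, lnext M d != d.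
Hypothesis oK : involutive (opp M).

Lemma n2 d : lnext M (lnext M d) != d.
Proof. by apply/eqP=> e; have := n3 d; rewrite e => e'; have := n1 d; rewrite e' eqxx. Qed.

Variables (es : seq entry).
Hypothesis cover : forall d, d \in sdarts es.
Hypothesis card : #|D| = 3 * size es.

Lemma uniq_sdarts : uniq (sdarts es).
Proof.
apply: (@leq_size_uniq _ (enum D)); first exact: enum_uniq.
  by move=> x _; exact: cover.
by rewrite size_sdarts -card cardE.
Qed.

Lemma uniq_entries : uniq es.
Proof.
have := uniq_sdarts; elim: (es) => //= e s IH.
rewrite /sdarts /= => /and4P[h _ _ /IH ->]; rewrite andbT.
apply: contra h => he; rewrite !inE; apply/orP; right; apply/orP; right.
by apply/sdartsP; exists e => //; rewrite inE eqxx.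
Qed.

Lemma tri3_inj a b x : a \in es -> b \in es -> x \in tri3 a.1.2 -> x \in tri3 b.1.2 -> a = b.
Proof.
have := uniq_sdarts; elim: (es) => // e s IH.
rewrite -cat1s sdarts_cat cat_uniq => /and3P[_ /hasPn h us].
have hh c : c \in s -> x \in tri3 c.1.2 -> x \in tri3 e.1.2 -> False.
  move=> cs xc xe; have : x \notin sdarts [:: e] by apply: h; apply/sdartsP; exists c.
  by case/negP; apply/sdartsP; exists e => //; rewrite inE eqxx.
rewrite ![_ \in e :: s]in_cons => /orP[/eqP->|ha] /orP[/eqP->|hb] // xa xb.
- by case: (hh _ hb xb xa).
- by case: (hh _ ha xa xb).
- exact: IH.
Qed.

Lemma mem_rdart e : rdart e \in tri3 e.1.2.
Proof. by rewrite /rdart !inE; case: ifP => _; rewrite eqxx ?orbT. Qed.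

Lemma mem_sidedart e : sidedart e \in tri3 e.1.2.
Proof. by rewrite /sidedart !inE; case: ifP => _; rewrite eqxx ?orbT. Qed.

Lemma mem_ldart (e : entry) : e.1.2 \in tri3 e.1.2.
Proof. by rewrite !inE eqxx. Qed.

Lemma rdart_sidedart a b : a \in es -> b \in es -> rdart a <> sidedart b.
Proof.
move=> ha hb E; have ab : a = b.
  by apply: (tri3_inj ha hb (mem_rdart a)); rewrite E mem_sidedart.
move: E; rewrite ab /rdart /sidedart; case: ifP => _ /eqP; last by rewrite (negbTE (n1 _)).
by rewrite eq_sym (negbTE (n1 _)).
Qed.

Lemma rdart_ldart a b : a \in es -> b \in es -> rdart a <> b.1.2.
Proof.
move=> ha hb E; have ab : a = b.
  by apply: (tri3_inj ha hb (mem_rdart a)); rewrite E mem_ldart.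
move: E; rewrite ab /rdart; case: ifP => _ /eqP; first by rewrite (negbTE (n1 _)).
by rewrite (negbTE (n2 _)).
Qed.

Lemma sidedart_ldart a b : a \in es -> b \in es -> sidedart a <> b.1.2.
Proof.
move=> ha hb E; have ab : a = b.
  by apply: (tri3_inj ha hb (mem_sidedart a)); rewrite E mem_ldart.
move: E; rewrite ab /sidedart; case: ifP => _ /eqP; last by rewrite (negbTE (n1 _)).
by rewrite (negbTE (n2 _)).
Qed.

Lemma rdart_inj a b : a \in es -> b \in es -> rdart a = rdart b -> a = b.
Proof. by move=> ha hb E; apply: (tri3_inj ha hb (mem_rdart a)); rewrite E mem_rdart. Qed.

Lemma sidedart_inj a b : a \in es -> b \in es -> sidedart a = sidedart b -> a = b.
Proof. by move=> ha hb E; apply: (tri3_inj ha hb (mem_sidedart a)); rewrite E mem_sidedart. Qed.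

Lemma ldart_inj (a b : entry) : a \in es -> b \in es -> a.1.2 = b.1.2 -> a = b.
Proof. by move=> ha hb E; apply: (tri3_inj ha hb (mem_ldart a)); rewrite E mem_ldart. Qed.

Lemma chain_last e s z z1 : chain z (e :: s) (opp M z1) -> z1 = rdart (last e s).
Proof.
elim: s e z => [|e' s IH] e z /= [_]; first by move/(can_inj oK).
exact: IH.
Qed.

End Uniq.

End Strip.

(** * A hierarchical insertion, seen on a strip *)

Section StripInsert.
Variables (n : nat) (D : finType) (M : cmap D) (T : {set D}).
Variables (u v : seq (entry D)) (e e' : entry D) (z0 z1 : D) (l0 l1 l : nat) (x : bool).
Hypothesis h : tree_map n M T.
Let es := u ++ e :: e' :: v.
Hypothesis hs : strip M T es z0 l0 z1 l1.
Hypothesis fresh : l \notin l0 :: rcons (map snd es) l1.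

Let oK : involutive (opp M). Proof. by case: h => -[]. Qed.
Let oN : forall d, opp M d != d. Proof. by case: h => -[]. Qed.
Let n3 : forall d, lnext M (lnext M (lnext M d)) = d. Proof. by case: h. Qed.
Let n1 : forall d, lnext M d != d. Proof. by case: h. Qed.
Let cover : forall d, d \in sdarts M es. Proof. by case: hs. Qed.
Let card : #|D| = 3 * size es. Proof. by case: hs. Qed.

Let d := rdart M e.
Let M' := insert_pair M d.

Definition lift_entry (D E : finType) (a : entry D) : entry (D + E)%type := (a.1.1, inl a.1.2, a.2).

Let I := @lift_entry D (bool * 'Z_3)%type.

(** The strip enters the first new triangle through its side facing [d] and leaves the second one
    through its side facing [opp M d]. Of their two common edges, one is crossed and the other is
    cut, its two copies lying on the boundary [x] with label [l]. *)
Definition insert_entries : seq (entry (D + bool * 'Z_3)%type) :=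
  [:: (x, inr (false, 0%R), l); (x, inr (true, if x then 2%R else 1%R), l)].

Let es' := map I u ++ I e :: insert_entries ++ I e' :: map I v.

Let ee : e \in es. Proof. by rewrite mem_cat inE eqxx orbT. Qed.
Let ee' : e' \in es. Proof. by rewrite mem_cat !inE eqxx !orbT. Qed.

Let chain_mid : exists2 p, chain M z0 u p &
  [/\ e.1.2 = p, e'.1.2 = opp M d & chain M (opp M (rdart M e')) v (opp M z1)].
Proof.
case: hs => + _ _ _ _; rewrite /es => /chain_cat[p h1 /= [h2 [h3 h4]]].
by exists p.
Qed.

Let ued : uniq es. Proof. exact: uniq_entries cover card. Qed.

Let opp_lift a : a != d -> a != opp M d -> opp M' (inl a) = inl (opp M a).
Proof. by move=> h1 h2; rewrite /= (negbTE h1) (negbTE h2). Qed.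

(** The edge between [e] and [e'] consists of a right dart and a left dart, whereas the boundary
    contains only third sides, the first left dart and the last right dart. *)
Let side_neq a k : (a, k) \in ssides M z0 l0 es z1 l1 -> a != d /\ a != opp M d.
Proof.
have [p h1 [h2 h3 h4]] := chain_mid.
have hz0 : exists2 b, b \in u ++ [:: e] & z0 = b.1.2.
  case: (u) h1 => [|b s] /=; first by move=> ->; exists e => //; rewrite inE.
  by case=> <- _; exists b => //; rewrite inE eqxx.
have hz1 : exists2 b, b \in e' :: v & z1 = rdart M b.
  exists (last e' v); first exact: mem_last.
  by apply: (chain_last oK (z := e'.1.2)) => /=.
have sub1 b : b \in u ++ [:: e] -> b \in es.
  by rewrite !mem_cat !inE => /orP[->//|->]; rewrite orbT.
have sub2 b : b \in e' :: v -> b \in es.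
  by rewrite !mem_cat !inE => ->; rewrite !orbT.
have dis b : b \in u ++ [:: e] -> b \in e' :: v -> False.
  move=> b1 b2; have := ued; rewrite /es -cat1s catA cat_uniq => /and3P[_ /hasPn/(_ _ b2) + _].
  by rewrite b1.
rewrite inE mem_rcons inE => /or3P[/eqP[-> _]|/eqP[-> _]|/mapP[b hb [-> _]]].
- have [b hb ->] := hz0; split; apply/eqP.
    by move/esym; apply: (rdart_ldart n3 n1 cover card) => //; exact: sub1.
  rewrite -h3 => /(ldart_inj cover card (sub1 _ hb) ee') E.
  by apply: (dis b hb); rewrite E inE eqxx.
- have [b hb ->] := hz1; split; apply/eqP.
    move=> /(rdart_inj cover card (sub2 _ hb) ee) E.
    by apply: (dis b _ hb); rewrite E mem_cat inE eqxx orbT.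
  by rewrite -h3; apply: (rdart_ldart n3 n1 cover card) => //; exact: sub2.
- split; apply/eqP; first by move/esym; apply: (rdart_sidedart n1 cover card).
  by rewrite -h3; apply: (sidedart_ldart n3 n1 cover card).
Qed.

Lemma insert_not_side : d \notin T.
Proof.
case: hs => _ _ _ _ ->; apply/negP=> /mapP[[a k] hk /= E].
by have [] := side_neq hk; rewrite E eqxx.
Qed.

Let chain_lift w z p : {subset w <= es} -> e \notin w -> chain M z w p ->
  chain M' (inl z) (map I w) (inl p).
Proof.
elim: w z => [|a w IH] z hw hew /=; first by move=> ->.
case=> -> hc; split=> //.
have haw : a \in es by apply: hw; rewrite inE eqxx.
move: hew; rewrite inE negb_or => /andP[ea ew].
have -> : rdart M' (I a) = inl (rdart M a) by rewrite /rdart /=; case: ifP.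
have [p' h1 [h2 h3 h4]] := chain_mid.
rewrite -[X in chain _ X _ _]/(opp M' (inl (rdart M a))) opp_lift; first by apply: IH => // b hb; apply: hw; rewrite inE hb orbT.
  by apply/eqP=> /(rdart_inj cover card haw ee) E; move: ea; rewrite E eqxx.
by rewrite -h3; apply/eqP; apply: (rdart_ldart n3 n1 cover card).
Qed.

(** The opened edge separates two consecutive triangles, and the new pair fits between them. The
    freshness of [l] keeps the gluing of the old sides unchanged. *)
Lemma strip_insert : strip M' (insert_tree T (~~ x)) es' (inl z0) l0 (inl z1) l1.
Proof.
have [p h1 [h2 h3 h4]] := chain_mid.
case: (hs) => _ _ _ hm hT.
have hz1 : z1 != d /\ z1 != opp M d.
  by apply: (side_neq (k := l1)); rewrite inE mem_rcons inE eqxx orbT.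
have hu : {subset u <= es} by move=> b hb; rewrite mem_cat hb.
have hv : {subset v <= es} by move=> b hb; rewrite mem_cat !inE hb !orbT.
have [eu ev e'u] : [/\ e \notin u, e \notin v & e != e'].
  by move: ued; rewrite /es uniq_catC /= in_cons mem_cat !negb_or => /andP[/and3P[g1 g2 g3] _].
have side_lift a : sidedart M' (I a) = inl (sidedart M a) by rewrite /sidedart /=; case: ifP.
have nsides : map (fun a => (sidedart M' a, a.2)) insert_entries =
    [:: (inr (false, if x then 2%R else 1%R), l); (inr (true, if x then 1%R else 2%R), l)].
  rewrite /insert_entries /sidedart /=; case: (x) => /=;
    by congr [:: (inr (_, _), _); (inr (_, _), _)]; apply: val_inj.
have memS q : q \in ssides M' (inl z0) l0 es' (inl z1) l1 ->
    (exists2 a, (a, q.2) \in ssides M z0 l0 es z1 l1 & q.1 = inl a) \/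
    (q = (inr (false, if x then 2%R else 1%R), l) \/ q = (inr (true, if x then 1%R else 2%R), l)).
  rewrite /ssides /es' map_cat map_cons map_cat nsides /=.
  rewrite inE mem_rcons inE mem_cat !inE.
  case/or3P=> [/eqP->|/eqP->|/or3P[]].
  - by left; exists z0; rewrite ?inE ?eqxx.
  - by left; exists z1; rewrite ?inE ?mem_rcons ?inE ?eqxx ?orbT.
  - case/mapP=> b /mapP[a ha ->] ->; left; exists (sidedart M a) => //=.
    rewrite inE mem_rcons inE; apply/orP; right; apply/orP; right.
    by apply/mapP; exists a => //; exact: hu.
  - move/eqP=> ->; left; exists (sidedart M e) => //=.
    rewrite inE mem_rcons inE; apply/orP; right; apply/orP; right.
    by apply/mapP; exists e.
  - case/orP=> [/eqP->|/orP[/eqP->|/orP[/eqP->|]]]; [by right; left|by right; right| |].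
      left; exists (sidedart M e') => //=.
      rewrite inE mem_rcons inE; apply/orP; right; apply/orP; right.
      by apply/mapP; exists e'.
    case/mapP=> b /mapP[a ha ->] ->; left; exists (sidedart M a) => //=.
    rewrite inE mem_rcons inE; apply/orP; right; apply/orP; right.
    by apply/mapP; exists a => //; exact: hv.
have memS' a k : (a, k) \in ssides M z0 l0 es z1 l1 -> (inl a, k) \in ssides M' (inl z0) l0 es' (inl z1) l1.
  rewrite /ssides /es' !inE !mem_rcons !inE => /or3P[/eqP[-> ->]|/eqP[-> ->]|/mapP[b hb [-> ->]]].
  - by rewrite eqxx.
  - by rewrite eqxx !orbT.
  - apply/orP; right; apply/orP; right; apply/mapP; exists (I b); last by rewrite side_lift.
    move: hb; rewrite /es !mem_cat !inE.
    case/or3P=> [hb|/eqP->|/orP[/eqP->|hb]]; rewrite ?eqxx ?orbT ?(map_f I hb) ?orbT //.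
have memN p' : p' \in map (fun a => (sidedart M' a, a.2)) insert_entries -> p' \in ssides M' (inl z0) l0 es' (inl z1) l1.
  move=> hp'; rewrite /ssides /es' map_cat map_cons map_cat inE mem_rcons inE !mem_cat inE mem_cat hp'.
  by rewrite !orbT.
have fr a k : (a, k) \in ssides M z0 l0 es z1 l1 -> k != l.
  move=> hk; apply: contraNneq fresh => <-; move: hk.
  rewrite /ssides !inE !mem_rcons !inE => /or3P[/eqP[_ ->]|/eqP[_ ->]|/mapP[b hb [_ ->]]]; rewrite ?eqxx ?orbT //.
  by rewrite map_f ?orbT.
have no : opp M' (inr (false, if x then 2%R else 1%R)) = inr (true, if x then 1%R else 2%R).
  by case: (x); rewrite /=; congr (inr (_, _)); apply: val_inj.
have no' : opp M' (inr (true, if x then 1%R else 2%R)) = inr (false, if x then 2%R else 1%R).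
  by case: (x); rewrite /=; congr (inr (_, _)); apply: val_inj.
split.
- rewrite (_ : opp M' (inl z1) = inl (opp M z1)); last by apply: opp_lift; case: hz1.
  apply/chain_cat; exists (inl p); first exact: chain_lift.
  have -> : I e :: insert_entries ++ I e' :: map I v = [:: I e] ++ insert_entries ++ map I (e' :: v) by [].
  apply/chain_cat; exists (inr (false, 0%R)).
    split; first by rewrite /= h2.
    have -> : rdart M' (I e) = inl d by rewrite /d /rdart /=; case: ifP.
    by rewrite /= eqxx.
  apply/chain_cat; exists (inl (opp M d)).
    rewrite /insert_entries /=; split=> //; rewrite /rdart /=.
    case: (x) => /=; split; try (by congr (inr (_, _)); apply: val_inj); by [].
  apply: chain_lift => //; last by rewrite inE negb_or e'u.
  by move=> b; rewrite inE => /orP[/eqP->|/hv].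
- have hI a : a \in es -> forall b, b \in tri3 M a.1.2 -> inl b \in sdarts M' es'.
    move=> ha b hb; apply/sdartsP; exists (I a); last first.
      by move: hb; rewrite !inE.
    move: ha; rewrite /es /es' !mem_cat !inE => /or3P[ha|/eqP->|/orP[/eqP->|ha]]; rewrite ?eqxx ?orbT ?(map_f I ha) ?orbT //.
  case=> [a|[b i]]; first by have /sdartsP[c hc hac] := cover a; exact: hI hac.
  apply/sdartsP; exists (nth (x, inr (false, 0%R), l) insert_entries b).
    rewrite /es' mem_cat inE mem_cat; case: b => /=; rewrite !inE eqxx ?orbT //.
  rewrite !inE; case: b => /=; elim/Z3P: i; case: (x) => //=.
- rewrite card_sum card_pair_dart card /es /es' /insert_entries !size_cat /= !size_map; lia.
- move=> p1 q1 /memS[[a ha ea]|hp] /memS[[b hb eb]|hq] E.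
  + have := hm _ _ ha hb E; rewrite ea eb /= => -[->|->]; first by left.
    have [g1 g2] := side_neq ha.
    by right; rewrite (negbTE g1) (negbTE g2).
  + have := fr _ _ ha; rewrite E; case: hq => ->; by rewrite eqxx.
  + have := fr _ _ hb; rewrite -E; case: hp => ->; by rewrite eqxx.
  + case: hp => ->; case: hq => ->; rewrite [X in X.1]/=; [by left|right|right|by left].
      by rewrite no.
    by rewrite no'.
- move=> a; apply/idP/mapP.
    case: a => [a|q].
      rewrite ext_tree_inl hT => /mapP[[a' k] hk /= ->].
      by exists (inl a', k) => //; exact: memS'.
    rewrite ext_tree_inr; case/orP=> /eqP ->.
      exists (inr (~~ x, 2%R), l) => //; apply: memN; rewrite nsides.
      by case: (x); rewrite !inE eqxx ?orbT.
    exists (inr (~~ ~~ x, 1%R), l) => //; apply: memN; rewrite nsides.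
    by case: (x); rewrite !inE eqxx ?orbT.
  case=> q /memS[[b hb ->] ->|hq ->].
    by rewrite ext_tree_inl hT; apply/mapP; exists (b, q.2).
  by case: hq => ->; rewrite ext_tree_inr; case: (x).
Qed.

End StripInsert.

Lemma ssidesP (D : finType) (M : cmap D) z0 l0 es z1 l1 p : p \in ssides M z0 l0 es z1 l1 ->
  [\/ p = (z0, l0), p = (z1, l1) | exists2 b, b \in es & p = (sidedart M b, b.2)].
Proof.
rewrite inE mem_rcons inE => /or3P[/eqP->|/eqP->|/mapP[b hb ->]].
- by constructor 1.
- by constructor 2.
- by constructor 3; exists b.
Qed.

(** * A subdivision, seen on a strip *)

Section StripSubdivide.
Variables (n : nat) (D : finType) (M : cmap D) (T : {set D}).
Variables (u v : seq (entry D)) (e : entry D) (z0 z1 : D) (l0 l1 l : nat).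
Hypothesis h : tree_map n M T.
Let es := u ++ e :: v.
Hypothesis hs : strip M T es z0 l0 z1 l1.
Hypothesis fresh : l \notin l0 :: rcons (map snd es) l1.

Let oK : involutive (opp M). Proof. by case: h => -[]. Qed.
Let n3 : forall d, lnext M (lnext M (lnext M d)) = d. Proof. by case: h. Qed.
Let n1 : forall d, lnext M d != d. Proof. by case: h. Qed.
Let cover : forall d, d \in sdarts M es. Proof. by case: hs. Qed.
Let card : #|D| = 3 * size es. Proof. by case: hs. Qed.

Let d := e.1.2.
Let y := e.1.1.
Let M' := subdivide M d.
Let I := @lift_entry D (bool * 'Z_3)%type.

(** The three triangles around the new vertex, in the order in which the strip crosses them. The
    spoke towards the boundary opposite to the side of [e] is cut, and its two copies get the label
    [l]. *)
Definition subdivide_entries : seq (entry (D + bool * 'Z_3)%type) :=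
  if e.1.1 then [:: (false, inl e.1.2, l); (true, inr (true, 0%R), e.2); (false, inr (true, 2%R), l)]
  else [:: (true, inl e.1.2, l); (false, inr (false, 1%R), e.2); (true, inr (false, 2%R), l)].

(** The corner of the triangle opposite to its boundary side. *)
Definition subdivide_index : 'Z_3 := if e.1.1 then 1%R else 0%R.

Let es' := map I u ++ subdivide_entries ++ map I v.

Let ee : e \in es. Proof. by rewrite mem_cat inE eqxx orbT. Qed.
Let ued : uniq es. Proof. exact: uniq_entries cover card. Qed.

Let t i := tri_dart M d i.

Let a0 : lnext M' (inl (t 0%R)) = inr (true, 1%R).
Proof. by rewrite (subdivide_lnext_tri d h); congr (inr (_, _)); apply: val_inj. Qed.
Let a1 : lnext M' (inl (t 1%R)) = inr (true, 2%R).
Proof. by rewrite (subdivide_lnext_tri d h); congr (inr (_, _)); apply: val_inj. Qed.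
Let a2 : lnext M' (inl (t 2%R)) = inr (true, 0%R).
Proof. by rewrite (subdivide_lnext_tri d h); congr (inr (_, _)); apply: val_inj. Qed.
Let b0 : lnext M' (inr (true, 0%R)) = inr (false, 2%R).
Proof. by congr (inr (_, _)); apply: val_inj. Qed.
Let b1 : lnext M' (inr (true, 1%R)) = inr (false, 0%R).
Proof. by congr (inr (_, _)); apply: val_inj. Qed.
Let b2 : lnext M' (inr (true, 2%R)) = inr (false, 1%R).
Proof. by congr (inr (_, _)); apply: val_inj. Qed.
Let c012 i : lnext M' (inr (false, i)) = inl (t i).
Proof. by []. Qed.
Let k1 i : opp M' (inr (true, i)) = inr (false, i).
Proof. by []. Qed.
Let k2 i : opp M' (inr (false, i)) = inr (true, i).
Proof. by []. Qed.
Let oi a : opp M' (inl a) = inl (opp M a).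
Proof. by []. Qed.

Let t_tri i : t i \in tri3 M d.
Proof. by elim/Z3P: i; rewrite !inE /t /tri_dart /= eqxx ?orbT. Qed.

Let out b c i : b \in es -> b <> e -> c \in tri3 M b.1.2 -> c != tri_dart M d i.
Proof.
move=> hb be hc; apply/eqP=> E; apply: be.
by apply: (tri3_inj cover card hb ee hc); rewrite E t_tri.
Qed.

Let lnext_out b c : b \in es -> b <> e -> c \in tri3 M b.1.2 -> lnext M' (inl c) = inl (lnext M c).
Proof. by move=> hb be hc; apply: (subdivide_lnext_out) => i; apply: out hc. Qed.

Let lift_tri b : b \in es -> b <> e ->
  lnext M' (inl b.1.2) = inl (lnext M b.1.2) /\
  lnext M' (lnext M' (inl b.1.2)) = inl (lnext M (lnext M b.1.2)).
Proof.
move=> hb be.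
rewrite (lnext_out hb be); last by rewrite !inE eqxx.
by rewrite (lnext_out hb be) //; rewrite !inE eqxx orbT.
Qed.

Let rlift b : b \in es -> b <> e -> rdart M' (I b) = inl (rdart M b).
Proof. by move=> hb be; have [E1 E2] := lift_tri hb be; rewrite /rdart /=; case: ifP. Qed.

Let slift b : b \in es -> b <> e -> sidedart M' (I b) = inl (sidedart M b).
Proof. by move=> hb be; have [E1 E2] := lift_tri hb be; rewrite /sidedart /=; case: ifP. Qed.

Let chain_lift w z p : {subset w <= es} -> e \notin w -> chain M z w p ->
  chain M' (inl z) (map I w) (inl p).
Proof.
elim: w z => [|a w IH] z hw hew /=; first by move=> ->.
case=> -> hc; split=> //.
have haw : a \in es by apply: hw; rewrite inE eqxx.
move: hew; rewrite inE negb_or => /andP[/eqP ea ew].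
rewrite rlift //; last by move/esym.
by apply: IH => // b hb; apply: hw; rewrite inE hb orbT.
Qed.

Let hu : {subset u <= es}. Proof. by move=> b hb; rewrite mem_cat hb. Qed.
Let hv : {subset v <= es}. Proof. by move=> b hb; rewrite mem_cat !inE hb !orbT. Qed.
Let euv : e \notin u /\ e \notin v.
Proof.
by move: ued; rewrite /es uniq_catC /= mem_cat !negb_or => /andP[/andP[g1 g2] _].
Qed.

Let chain_mid : exists2 p, chain M z0 u p & e.1.2 = p /\ chain M (opp M (rdart M e)) v (opp M z1).
Proof. by case: hs => + _ _ _ _; rewrite /es => /chain_cat[p h1 /= [h2 h3]]; exists p. Qed.

Let tE : [/\ t 0%R = e.1.2, t 1%R = lnext M e.1.2 & t 2%R = lnext M (lnext M e.1.2)].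
Proof. by []. Qed.

Let chain_new : chain M' (inl e.1.2) subdivide_entries (inl (opp M (rdart M e))).
Proof.
have rT q k : rdart M' (true, q, k) = lnext M' q by [].
have rF q k : rdart M' (false, q, k) = lnext M' (lnext M' q) by [].
rewrite /subdivide_entries /rdart -/y; case: tE => <- <- <-.
case: y.
  split=> //; split; first by rewrite rF a0 b1.
  split; first by rewrite rT b0.
  change (opp M' (rdart M' (false, inr (true, 2%R), l)) = inl (opp M (t 1%R))).
  by rewrite rF b2.
split=> //; split; first by rewrite rT a0.
split; first by rewrite rF c012 a1.
change (opp M' (rdart M' (true, inr (false, 2%R), l)) = inl (opp M (t 2%R))).
by rewrite rT.
Qed.

Let nsides : map (fun a => (sidedart M' a, a.2)) subdivide_entries =
  [:: (inr (y, subdivide_index), l); (inl (sidedart M e), e.2); (inr (~~ y, subdivide_index), l)].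
Proof.
have sT q k : sidedart M' (true, q, k) = lnext M' (lnext M' q) by [].
have sF q k : sidedart M' (false, q, k) = lnext M' q by [].
rewrite /subdivide_entries /subdivide_index {2}/sidedart -/y; case: tE => <- <- <-.
by case: y; rewrite !map_cons ?sT ?sF ?a0 ?b1 ?b0 ?b2 ?c012 ?a1 ?a2.
Qed.

Let ntri : flatten [seq tri3 M' e0.1.2 | e0 <- subdivide_entries] =
  if y then [:: inl (t 0%R); inr (true, 1%R); inr (false, 0%R); inr (true, 0%R); inr (false, 2%R);
                inl (t 2%R); inr (true, 2%R); inr (false, 1%R); inl (t 1%R)]
  else [:: inl (t 0%R); inr (true, 1%R); inr (false, 0%R); inr (false, 1%R); inl (t 1%R);
           inr (true, 2%R); inr (false, 2%R); inl (t 2%R); inr (true, 0%R)].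
Proof.
have f3 b q k : tri3 M' (b, q, k).1.2 = [:: q; lnext M' q; lnext M' (lnext M' q)] by [].
rewrite /subdivide_entries -/y; case: tE => <- _ _.
by case: y; rewrite !map_cons !f3 ?a0 ?b0 ?b1 ?b2 ?c012 ?a1 ?a2 ?b0 ?b1 ?b2.
Qed.

Lemma strip_subdivide :
  strip M' (subdivide_tree T subdivide_index) es' (inl z0) l0 (inl z1) l1.
Proof.
have [p h1 [h2 h3]] := chain_mid; have [eu ev] := euv.
case: (hs) => _ _ _ hm hT.
have neu b : b \in u -> b <> e by move=> hb E; rewrite -E hb in eu.
have nev b : b \in v -> b <> e by move=> hb E; rewrite -E hb in ev.
have inside b : b \in es -> (sidedart M b, b.2) \in ssides M z0 l0 es z1 l1.
  by move=> hb; rewrite inE mem_rcons inE; apply/orP; right; apply/orP; right; apply/mapP; exists b.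
have memS q : q \in ssides M' (inl z0) l0 es' (inl z1) l1 ->
    (exists2 a, (a, q.2) \in ssides M z0 l0 es z1 l1 & q.1 = inl a) \/
    (q = (inr (y, subdivide_index), l) \/ q = (inr (~~ y, subdivide_index), l)).
  rewrite {1}/ssides /es' !map_cat nsides inE mem_rcons inE mem_cat.
  case/or3P=> [/eqP->|/eqP->|/orP[]].
  - by left; exists z0; rewrite ?inE ?eqxx.
  - by left; exists z1; rewrite ?inE ?mem_rcons ?inE ?eqxx ?orbT.
  - case/mapP=> b /mapP[a ha ->] ->; left; exists (sidedart M a); first by have := inside a (hu ha).
    by apply: slift; [exact: hu|exact: neu].
  - rewrite mem_cat !inE => /orP[/or3P[]/eqP->|].
    + by right; left.
    + by left; exists (sidedart M e) => //; exact: inside.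
    + by right; right.
    case/mapP=> b /mapP[a ha ->] ->; left; exists (sidedart M a); first by have := inside a (hv ha).
    by apply: slift; [exact: hv|exact: nev].
have memN p' : p' \in map (fun a => (sidedart M' a, a.2)) subdivide_entries -> p' \in ssides M' (inl z0) l0 es' (inl z1) l1.
  move=> hp'; rewrite /ssides /es' !map_cat inE mem_rcons inE !mem_cat hp'.
  by rewrite !orbT.
have memS' a k : (a, k) \in ssides M z0 l0 es z1 l1 -> (inl a, k) \in ssides M' (inl z0) l0 es' (inl z1) l1.
  case/ssidesP=> [[-> ->]|[-> ->]|[b hb [-> ->]]].
  - by rewrite inE eqxx.
  - by rewrite inE mem_rcons inE eqxx !orbT.
  - have hw w : b \in w -> {subset map I w <= es'} -> b <> e ->
       (inl (sidedart M b), b.2) \in ssides M' (inl z0) l0 es' (inl z1) l1.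
      move=> hbw hw hbe; rewrite inE mem_rcons inE; apply/orP; right; apply/orP; right.
      by apply/mapP; exists (I b); [apply: hw; exact: map_f|rewrite slift].
    move: (hb); rewrite {1}/es mem_cat inE; case/or3P=> [hbu|/eqP->|hbv].
    + by apply: (hw u) => //; [move=> c hc; rewrite mem_cat hc|exact: neu].
    + by apply: memN; rewrite nsides !inE eqxx orbT.
    + by apply: (hw v) => //; [move=> c hc; rewrite !mem_cat hc !orbT|exact: nev].
have fr a k : (a, k) \in ssides M z0 l0 es z1 l1 -> k != l.
  move=> hk; apply: contraNneq fresh => <-; move: hk.
  rewrite /ssides !inE !mem_rcons !inE => /or3P[/eqP[_ ->]|/eqP[_ ->]|/mapP[b hb [_ ->]]]; rewrite ?eqxx ?orbT //.
  by rewrite map_f ?orbT.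
split.
- rewrite oi; apply/chain_cat; exists (inl p); first exact: chain_lift.
  apply/chain_cat; exists (inl (opp M (rdart M e))); last exact: chain_lift.
  by rewrite -h2; exact: chain_new.
- have hw w a : a \in w -> {subset w <= es} -> {subset map I w <= es'} -> a <> e ->
      forall b, b \in tri3 M a.1.2 -> inl b \in sdarts M' es'.
    move=> haw hwe hw ae b hb; apply/sdartsP; exists (I a); first by apply: hw; exact: map_f.
    have [E1 E2] := lift_tri (hwe _ haw) ae.
    by move: hb; rewrite /tri3 [(I a).1.2]/= E2 E1 !inE.
  have hN f : f \in flatten [seq tri3 M' e.1.2 | e <- subdivide_entries] -> f \in sdarts M' es'.
    by move=> hf; rewrite !sdarts_cat !mem_cat hf orbT.
  case=> [a|q].
    have /sdartsP[b hb hab] := cover a.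
    move: (hb); rewrite {1}/es mem_cat inE; case/or3P=> [hbu|/eqP E|hbv].
    + by apply: (hw u b hbu hu) => //; [move=> c hc; rewrite mem_cat hc|exact: neu].
    + apply: hN; move: hab; rewrite E ntri /tri3; case: tE => <- <- <-.
      by case: y; rewrite !inE !inl_eq => /or3P[] /eqP ->; rewrite eqxx ?orbT.
    + by apply: (hw v b hbv hv) => //; [move=> c hc; rewrite !mem_cat hc !orbT|exact: nev].
  by apply: hN; rewrite ntri; case: q => -[] i; elim/Z3P: i; case: y.
- rewrite card_sum card_pair_dart card /es /es' !size_cat !size_map /= /subdivide_entries.
  by case: ifP => _ /=; lia.
- move=> p1 q1 /memS[[a ha ea]|hp] /memS[[b hb eb]|hq] E.
  + have := hm _ _ ha hb E; rewrite ea eb /= => -[->|->]; [by left|by right].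
  + have := fr _ _ ha; rewrite E; case: hq => ->; by rewrite eqxx.
  + have := fr _ _ hb; rewrite -E; case: hp => ->; by rewrite eqxx.
  + case: hp => ->; case: hq => -> /=; rewrite ?negbK; [by left|by right|by right|by left].
- move=> a; apply/idP/mapP.
    case: a => [a|q].
      rewrite ext_tree_inl hT => /mapP[[a' k] hk /= ->].
      by exists (inl a', k) => //; exact: memS'.
    rewrite ext_tree_inr; case/orP=> /eqP ->.
      exists (inr (false, subdivide_index), l) => //; apply: memN; rewrite nsides.
      by case: y; rewrite !inE eqxx ?orbT.
    exists (inr (true, subdivide_index), l) => //; apply: memN; rewrite nsides.
    by case: y; rewrite !inE eqxx ?orbT.
  case=> q /memS[[b hb ->] ->|hq ->].
    by rewrite ext_tree_inl hT; apply/mapP; exists (b, q.2).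
  by case: hq => ->; rewrite ext_tree_inr; case: y; rewrite eqxx ?orbT.
Qed.

End StripSubdivide.

(** * A strip is determined by its labelled word *)

Definition eword (D : finType) (es : seq (entry D)) : seq (bool * nat) :=
  [seq (e.1.1, e.2) | e <- es].

Definition paired (L : seq nat) : Prop :=
  forall i, i < size L -> exists j, [/\ j < size L, j != i & nth 0 L i = nth 0 L j].

Lemma nth_sdarts (D : finType) (M : cmap D) (e0 : entry D) x (s : seq (entry D)) i k : i < size s -> k < 3 ->
  nth x (sdarts M s) (3 * i + k) = nth x (tri3 M (nth e0 s i).1.2) k.
Proof.
elim: s i => // e s IH [|i] hi hk.
  by rewrite muln0 add0n -cat1s sdarts_cat nth_cat size_sdarts muln1 hk /sdarts; move: hk {IH}; case: k => [|[|[|]]].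
rewrite -cat1s sdarts_cat nth_cat size_sdarts muln1 ifN; last by rewrite -leqNgt; lia.
have -> : 3 * i.+1 + k - 3 = 3 * i + k by lia.
exact: IH.
Qed.

Section StripFacts.
Variables (D : finType) (M : cmap D) (T : {set D}) (es : seq (entry D)) (z0 z1 : D) (l0 l1 : nat).
Hypothesis oK : involutive (opp M).
Hypothesis n3 : forall d, lnext M (lnext M (lnext M d)) = d.
Hypothesis n1 : forall d, lnext M d != d.
Hypothesis hs : strip M T es z0 l0 z1 l1.
Hypothesis ne : 0 < size es.
Variable e0 : entry D.

Let cover : forall d, d \in sdarts M es. Proof. by case: hs. Qed.
Let card : #|D| = 3 * size es. Proof. by case: hs. Qed.

Lemma strip_z0 : z0 = (nth e0 es 0).1.2.
Proof. by case: hs => + _ _ _ _; case: (es) ne => // e s _ /= [-> _]. Qed.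

Lemma strip_z1 : z1 = rdart M (nth e0 es (size es).-1).
Proof.
case: hs => + _ _ _ _; case: (es) ne => // e s _ /(chain_last oK) ->.
by rewrite nth_last.
Qed.

Lemma chain_nth z (s : seq (entry D)) z' i : chain M z s z' -> i.+1 < size s ->
  (nth e0 s i.+1).1.2 = opp M (rdart M (nth e0 s i)).
Proof.
elim: s z i => // e s IH z [|i] /= [_ h] hi; last exact: IH h hi.
by case: s h hi {IH} => // e' s /= [].
Qed.

Lemma uniq_ssides : uniq (map fst (ssides M z0 l0 es z1 l1)).
Proof.
have h0 : nth e0 es 0 \in es by apply: mem_nth.
have h1 : nth e0 es (size es).-1 \in es by apply: mem_nth; rewrite prednK.
have e : map fst (ssides M z0 l0 es z1 l1) = z0 :: rcons (map (sidedart M) es) z1.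
  by rewrite /ssides map_cons map_rcons -map_comp.
rewrite e /= rcons_uniq mem_rcons inE strip_z0 strip_z1; apply/and3P; split.
- rewrite negb_or; apply/andP; split.
    by apply/eqP=> /esym; exact: (rdart_ldart n3 n1 cover card).
  by apply/mapP=> -[b hb] /esym; exact: (sidedart_ldart n3 n1 cover card).
- by apply/mapP=> -[b hb]; exact: (rdart_sidedart n1 cover card).
- rewrite map_inj_in_uniq; first exact: uniq_entries cover card.
  by move=> a b; exact: (sidedart_inj cover card).
Qed.

Lemma side_partner i j : i < size (ssides M z0 l0 es z1 l1) -> j < size (ssides M z0 l0 es z1 l1) ->
  j != i -> (nth (z0, 0) (ssides M z0 l0 es z1 l1) i).2 = (nth (z0, 0) (ssides M z0 l0 es z1 l1) j).2 ->
  (nth (z0, 0) (ssides M z0 l0 es z1 l1) j).1 = opp M (nth (z0, 0) (ssides M z0 l0 es z1 l1) i).1.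
Proof.
move=> hi hj ij E; case: hs => _ _ _ + _ => /(_ _ _ (mem_nth _ hi) (mem_nth _ hj) E) [] //.
rewrite -!(nth_map _ z0 fst) // => /eqP; rewrite nth_uniq ?size_map ?uniq_ssides //.
by rewrite (negbTE ij).
Qed.

Lemma size_ssides : size (ssides M z0 l0 es z1 l1) = (size es).+2.
Proof. by rewrite /= size_rcons size_map. Qed.

Lemma nth_ssides i : nth (z0, 0) (ssides M z0 l0 es z1 l1) i =
  if i is j.+1 then if j < size es then (sidedart M (nth e0 es j), (nth e0 es j).2)
    else if j == size es then (z1, l1) else (z0, 0) else (z0, l0).
Proof. by case: i => //= j; rewrite nth_rcons size_map; case: ltnP => h //; rewrite (nth_map e0). Qed.

Lemma map_snd_ssides : map snd (ssides M z0 l0 es z1 l1) = l0 :: rcons (map snd es) l1.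
Proof. by rewrite /ssides map_cons map_rcons -map_comp. Qed.

End StripFacts.

Section StripIso.
Variables (D D' : finType) (M : cmap D) (M' : cmap D') (T : {set D}) (T' : {set D'}).
Variables (es : seq (entry D)) (es' : seq (entry D')).
Variables (z0 z1 : D) (z0' z1' : D') (l0 l1 : nat).
Hypothesis oK : involutive (opp M).
Hypothesis n3 : forall d, lnext M (lnext M (lnext M d)) = d.
Hypothesis n1 : forall d, lnext M d != d.
Hypothesis hs : strip M T es z0 l0 z1 l1.
Hypothesis oK' : involutive (opp M').
Hypothesis n3' : forall d, lnext M' (lnext M' (lnext M' d)) = d.
Hypothesis n1' : forall d, lnext M' d != d.
Hypothesis hs' : strip M' T' es' z0' l0 z1' l1.
Hypothesis hw : eword es = eword es'.
Hypothesis ne : 0 < size es.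
Hypothesis hp : paired (l0 :: rcons (map snd es) l1).

Let cover : forall d, d \in sdarts M es. Proof. by case: hs. Qed.
Let card : #|D| = 3 * size es. Proof. by case: hs. Qed.
Let cover' : forall d, d \in sdarts M' es'. Proof. by case: hs'. Qed.
Let card' : #|D'| = 3 * size es'. Proof. by case: hs'. Qed.

Let sz : size es = size es'.
Proof. by rewrite -(size_map (fun e => (e.1.1, e.2)) es) -/(eword es) hw size_map. Qed.

Let ne' : 0 < size es'. Proof. by rewrite -sz. Qed.

Let e0 : entry D := (true, z0, 0).
Let e0' : entry D' := (true, z0', 0).

(** Matches darts by their positions in the two strips. *)
Definition strip_fun (d : D) : D' := nth z0' (sdarts M' es') (index d (sdarts M es)).
Let f := strip_fun.

Let f_tri i k : i < size es -> k < 3 ->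
  f (nth z0 (tri3 M (nth e0 es i).1.2) k) = nth z0' (tri3 M' (nth e0' es' i).1.2) k.
Proof.
move=> hi hk; rewrite -(nth_sdarts _ e0) // /f /strip_fun index_uniq.
- by rewrite (nth_sdarts _ e0') // -sz.
- rewrite size_sdarts; lia.
- exact: uniq_sdarts cover card.
Qed.

Let letter i : i < size es -> (nth e0 es i).1.1 = (nth e0' es' i).1.1 /\ (nth e0 es i).2 = (nth e0' es' i).2.
Proof.
move=> hi; have := congr1 (fun s => nth (true, 0) s i) hw.
rewrite /eword (nth_map e0) // (nth_map e0') -?sz //.
by case.
Qed.

Let f_l i : i < size es -> f (nth e0 es i).1.2 = (nth e0' es' i).1.2.
Proof. by move=> hi; have := f_tri hi (k := 0) isT. Qed.

Let f_n1 i : i < size es -> f (lnext M (nth e0 es i).1.2) = lnext M' (nth e0' es' i).1.2.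
Proof. by move=> hi; have := f_tri hi (k := 1) isT. Qed.

Let f_n2 i : i < size es -> f (lnext M (lnext M (nth e0 es i).1.2)) = lnext M' (lnext M' (nth e0' es' i).1.2).
Proof. by move=> hi; have := f_tri hi (k := 2) isT. Qed.

Let f_r i : i < size es -> f (rdart M (nth e0 es i)) = rdart M' (nth e0' es' i).
Proof.
move=> hi; have [E _] := letter hi; rewrite /rdart E.
by case: ifP => _; [exact: f_n1|exact: f_n2].
Qed.

Let f_s i : i < size es -> f (sidedart M (nth e0 es i)) = sidedart M' (nth e0' es' i).
Proof.
move=> hi; have [E _] := letter hi; rewrite /sidedart E.
by case: ifP => _; [exact: f_n2|exact: f_n1].
Qed.

Let fI : injective f.
Proof.
move=> d e E.
have hd : index d (sdarts M es) < size (sdarts M' es') by rewrite size_sdarts -sz -(size_sdarts M) index_mem.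
have he : index e (sdarts M es) < size (sdarts M' es') by rewrite size_sdarts -sz -(size_sdarts M) index_mem.
move/eqP: E; rewrite /f /strip_fun nth_uniq //; last exact: uniq_sdarts cover' card'.
by move/eqP=> E; rewrite -(nth_index z0 (cover d)) E nth_index.
Qed.

Let fn : {morph f : d / lnext M d >-> lnext M' d}.
Proof.
move=> d; have /sdartsP[e he] := cover d.
have hi : index e es < size es by rewrite index_mem.
rewrite -(nth_index e0 he) !inE => /or3P[] /eqP ->.
- by rewrite f_n1 ?f_l.
- by rewrite f_n2 ?f_n1.
- by rewrite n3 f_l // f_n2 // n3'.
Qed.

Let L := ssides M z0 l0 es z1 l1.
Let L' := ssides M' z0' l0 es' z1' l1.

Let f_side i : i < size L -> f (nth (z0, 0) L i).1 = (nth (z0', 0) L' i).1 /\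
   (nth (z0, 0) L i).2 = (nth (z0', 0) L' i).2.
Proof.
rewrite size_ssides (nth_ssides _ _ _ _ _ _ e0) (nth_ssides _ _ _ _ _ _ e0') -sz.
case: i => [|i] hi /=.
  by split=> //; rewrite (strip_z0 hs ne e0) (strip_z0 hs' ne' e0') f_l.
case: ltnP => h; first by have [_ ->] := letter h; rewrite f_s.
have -> : i == size es by rewrite eqn_leq h andbT -ltnS.
split=> //=; rewrite (strip_z1 oK hs ne e0) (strip_z1 oK' hs' ne' e0') f_r ?sz //.
by rewrite prednK.
Qed.

Let fo_side i : i < size L -> f (opp M (nth (z0, 0) L i).1) = opp M' (nth (z0', 0) L' i).1.
Proof.
move=> hi.
have e1 : size L = size (l0 :: rcons (map snd es) l1) by rewrite size_ssides /= size_rcons size_map.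
have := hp (i := i); rewrite -e1 => /(_ hi)[j [hj ji E]].
have e2 k : k < size L -> (nth (z0, 0) L k).2 = nth 0 (l0 :: rcons (map snd es) l1) k.
  by move=> hk; rewrite -(map_snd_ssides M es z0 z1 l0 l1) (nth_map (z0, 0)).
have hL : size L' = size L by rewrite !size_ssides sz.
have E' : (nth (z0, 0) L i).2 = (nth (z0, 0) L j).2 by rewrite !e2.
rewrite -(side_partner oK n3 n1 hs ne e0 hi hj ji E').
have [-> f2] := f_side hj; have [_ f4] := f_side hi.
by apply: (side_partner oK' n3' n1' hs' ne' e0'); rewrite -/L' ?hL // -f2 -f4.
Qed.

Let fo : {morph f : d / opp M d >-> opp M' d}.
Proof.
have c1 : chain M z0 es (opp M z1) by case: hs.
have c1' : chain M' z0' es' (opp M' z1') by case: hs'.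
have r_opp i : i < size es -> f (opp M (rdart M (nth e0 es i))) = opp M' (rdart M' (nth e0' es' i)).
  move=> hi; case: (ltnP i.+1 (size es)) => hi'.
    rewrite -(chain_nth e0 c1 hi') f_l // (chain_nth e0' c1') // -sz //.
  have -> : i = (size es).-1 by lia.
  rewrite {2}sz -(strip_z1 oK hs ne e0) -(strip_z1 oK' hs' ne' e0').
  have := fo_side (i := (size es).+1); rewrite size_ssides (nth_ssides _ _ _ _ _ _ e0) (nth_ssides _ _ _ _ _ _ e0') -sz ltnn eqxx /=.
  by apply.
have l_opp i : i < size es -> f (opp M (nth e0 es i).1.2) = opp M' (nth e0' es' i).1.2.
  case: i => [|i] hi.
    rewrite -(strip_z0 hs ne e0) -(strip_z0 hs' ne' e0').
    by have := fo_side (i := 0); rewrite size_ssides; apply.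
  rewrite (chain_nth e0 c1 hi) (chain_nth e0' c1') -?sz // oK oK' f_r //.
  exact: ltnW.
have s_opp i : i < size es -> f (opp M (sidedart M (nth e0 es i))) = opp M' (sidedart M' (nth e0' es' i)).
  move=> hi; have := fo_side (i := i.+1).
  rewrite size_ssides (nth_ssides _ _ _ _ _ _ e0) (nth_ssides _ _ _ _ _ _ e0') -sz hi /=.
  by apply; rewrite ltnS ltnW.
move=> d; have /sdartsP[e he] := cover d.
have hi : index e es < size es by rewrite index_mem.
have hd : d \in tri3 M e.1.2 -> [\/ d = e.1.2, d = rdart M e | d = sidedart M e].
  rewrite !inE /rdart /sidedart; case: ifP => _ /or3P[] /eqP ->;
  by [constructor 1|constructor 2|constructor 3].
move/hd; rewrite -(nth_index e0 he) => -[] ->.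
- by rewrite l_opp // f_l.
- by rewrite r_opp // f_r.
- by rewrite s_opp // f_s.
Qed.

(** The sequence of triangles determines [lnext] and the opposites of the darts crossed by the
    strip. The opposite of a boundary side is the other side with its label, which exists because
    labels are [paired]. *)
Theorem strip_iso : exists g : D -> D', [/\ bijective g, {morph g : d / opp M d >-> opp M' d},
  {morph g : d / lnext M d >-> lnext M' d}, g z0 = z0' & forall d, (g d \in T') = (d \in T)].
Proof.
exists f; split=> //.
- by apply: inj_card_bij => //; rewrite card card' sz.
- by rewrite (strip_z0 hs ne e0) (strip_z0 hs' ne' e0') f_l.
- move=> d; case: hs => _ _ _ _ ->; case: hs' => _ _ _ _ ->.
  rewrite -/L -/L'.
  have -> : map fst L' = map f (map fst L).
    have hL : size L' = size L by rewrite !size_ssides sz.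
    apply: (@eq_from_nth _ z0'); first by rewrite !size_map.
    move=> i; rewrite size_map hL => hi.
    rewrite (nth_map (z0', 0)) ?hL // (nth_map z0) ?size_map // (nth_map (z0, 0)) //.
    by have [-> _] := f_side hi.
  by rewrite mem_map.
Qed.

End StripIso.

(** * Words realised by decorated triangulations *)

Definition Hgood (n : nat) (w : seq (bool * nat)) (l0 l1 : nat) : Prop :=
  exists (D : finType) (M : cmap D) (T : {set D}) (es : seq (entry D)) (z0 z1 : D),
  [/\ tree_map n M T, hierarchical M, loopless M /\ simple_on M T,
      strip M T es z0 l0 z1 l1 & eword es = w].

Definition Agood (n : nat) (w : seq (bool * nat)) (l0 l1 : nat) : Prop :=
  exists (D : finType) (M : cmap D) (T : {set D}) (es : seq (entry D)) (z0 z1 : D),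
  [/\ tree_map n M T, apollonian M, strip M T es z0 l0 z1 l1 & eword es = w].

Lemma two_strip l0 l1 : l0 != l1 ->
  strip two_triangles two_tree [:: (true, (false, 0%R), l1); (false, (true, 1%R), l0)]
    (false, 0%R) l0 (true, 2%R) l1.
Proof.
move=> ne.
have e : ssides two_triangles (false, 0%R) l0 [:: (true, (false, 0%R), l1); (false, (true, 1%R), l0)] (true, 2%R) l1 =
   [:: ((false, 0%R), l0); ((false, 2%R), l1); ((true, 0%R), l0); ((true, 2%R), l1)].
  by rewrite /ssides /sidedart /=; congr [:: _; ((_, _), _); ((_, _), _); _]; apply: val_inj.
split.
- by rewrite /= /rdart /=; split=> //; split; congr (_, _); apply: val_inj.
- by case=> b i; case: b; elim/Z3P: i.
- by rewrite card_pair_dart.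
- move=> p q; rewrite e !inE => /or4P[]/eqP-> /or4P[]/eqP-> //= E; try (by left); try (by right);
  by rewrite E eqxx in ne.
- by move=> d; rewrite e; case: d => -[] i; elim/Z3P: i; rewrite !inE.
Qed.

Lemma Hgood_base l0 l1 : l0 != l1 -> Hgood 2 [:: (true, l1); (false, l0)] l0 l1.
Proof.
move=> ne; exists (bool * 'Z_3)%type, two_triangles, two_tree.
exists [:: (true, (false, 0%R), l1); (false, (true, 1%R), l0)], (false, 0%R), (true, 2%R); split=> //.
- exact: two_triangles_tree_map.
- exact: hierarchical_base.
- by split; [exact: two_triangles_loopless|exact: two_triangles_simple].
- exact: (two_strip ne).
Qed.

Lemma Agood_base l0 l1 : l0 != l1 -> Agood 2 [:: (true, l1); (false, l0)] l0 l1.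
Proof.
move=> ne; exists (bool * 'Z_3)%type, two_triangles, two_tree.
exists [:: (true, (false, 0%R), l1); (false, (true, 1%R), l0)], (false, 0%R), (true, 2%R); split=> //.
- exact: two_triangles_tree_map.
- exact: apollonian_base.
- exact: (two_strip ne).
Qed.

Lemma eword_cat (D : finType) (es : seq (entry D)) u v : eword es = u ++ v ->
  exists es1 es2, [/\ es = es1 ++ es2, eword es1 = u & eword es2 = v].
Proof.
move=> E; exists (take (size u) es), (drop (size u) es); split; first by rewrite cat_take_drop.
  by rewrite /eword map_take -/(eword es) E take_size_cat.
by rewrite /eword map_drop -/(eword es) E drop_size_cat.
Qed.

Lemma eword_snd (D : finType) (es : seq (entry D)) : map snd (eword es) = map snd es.
Proof. by rewrite /eword -map_comp. Qed.

Lemma eword_lift (D E : finType) (es : seq (entry D)) : eword (map (@lift_entry D E) es) = eword es.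
Proof. by rewrite /eword -map_comp. Qed.

Lemma Hgood_insert n u a b v l0 l1 x l : Hgood n (u ++ a :: b :: v) l0 l1 ->
  l \notin l0 :: rcons (map snd (u ++ a :: b :: v)) l1 ->
  Hgood n.+1 (u ++ a :: (x, l) :: (x, l) :: b :: v) l0 l1.
Proof.
case=> D [M [T [es [z0 [z1 [h1 h2 [h3 h3'] h4 h5]]]]]] fr.
have [es1 [[|e [|e' es2]] [E1 E2]]] := eword_cat h5; rewrite /eword //=; rewrite -/(eword es2) => -[E3 E4 E5].
subst es.
have fr' : l \notin l0 :: rcons (map snd (es1 ++ e :: e' :: es2)) l1.
  by rewrite -eword_snd h5.
have dT := insert_not_side h1 h4.
exists (D + bool * 'Z_3)%type, (insert_pair M (rdart M e)), (insert_tree T (~~ x)).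
do 3!eexists; split.
- exact: (insert_tree_map (~~ x) h1 dT).
- exact: hierarchical_insert h2.
- by split; [exact: insert_loopless h1 h3|exact: insert_simple h1 dT h3 h3'].
- exact: (strip_insert x h1 h4 fr').
- rewrite /eword map_cat -/(eword _) eword_lift E2 /= -/(eword _) eword_lift E5.
  by rewrite /lift_entry /= E3 E4; case: a b {E3 E4 h5 fr} => [? ?] [? ?].
Qed.

Lemma Agood_insert n u y k v l0 l1 l : Agood n (u ++ (y, k) :: v) l0 l1 ->
  l \notin l0 :: rcons (map snd (u ++ (y, k) :: v)) l1 ->
  Agood n.+1 (u ++ (~~ y, l) :: (y, k) :: (~~ y, l) :: v) l0 l1.
Proof.
case=> D [M [T [es [z0 [z1 [h1 h2 h4 h5]]]]]] fr.
have [es1 [[|e es2] [E1 E2]]] := eword_cat h5; rewrite /eword //=; rewrite -/(eword es2) => -[E3 E3' E4].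
subst es.
have fr' : l \notin l0 :: rcons (map snd (es1 ++ e :: es2)) l1.
  by rewrite -eword_snd h5.
exists (D + bool * 'Z_3)%type, (subdivide M e.1.2), (subdivide_tree T (subdivide_index e)).
do 3!eexists; split.
- exact: (subdivide_tree_map _ _ h1).
- exact: apollonian_subdivide h2.
- exact: (strip_subdivide h1 h4 fr').
- rewrite /eword !map_cat -!/(eword _) !eword_lift E2 E4 /subdivide_entries E3.
  by case: y {E3 h5 fr}; rewrite /= E3'.
Qed.

(** * Ears: outerplanar maps of strips *)

Section Ear.
Variables (D : finType) (M : cmap D) (z : D).

(* A triangle [inl z], [inr (false, false)], [inr (false, true)] is attached    *)
(* outside the dart [z]; [inr (true, i)] is the reverse of [inr (false, i)].    *)
Definition ear : cmap (D + bool * bool)%type :=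
  CMap (fun u : D + bool * bool => match u with
        | inl e => inl (opp M e)
        | inr (c, i) => inr (~~ c, i)
        end)
       (fun u : D + bool * bool => match u with
        | inl e => if e == z then inr (false, false)
                   else if lnext M e == z then inr (true, true) else inl (lnext M e)
        | inr (false, i) => if i then inl z else inr (false, true)
        | inr (true, i) => if i then inr (true, false) else inl (lnext M z)
        end).

Hypothesis oK : involutive (opp M).
Hypothesis oN : forall d, opp M d != d.
Hypothesis nI : injective (lnext M).
Hypothesis zn : lnext M z != z.

Lemma ear_oppK : involutive (opp ear).
Proof. by case=> [e|[c i]] /=; rewrite ?oK ?negbK. Qed.

Lemma ear_opp_neq u : opp ear u != u.
Proof.
case: u => [e|[c i]]; apply/eqP => -[] E; first by have := oN e; rewrite E eqxx.
by case: c E.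
Qed.

Lemma ear_lnext_inj : injective (lnext ear).
Proof.
have h e : lnext M e == lnext M z -> e == z by move/eqP/nI/eqP.
have h2 e e' : lnext M e == z -> lnext M e' == z -> e = e' by move=> /eqP<- /eqP/nI.
have key e : [\/ e = z /\ lnext ear (inl e) = inr (false, false),
    [/\ e != z, lnext M e = z & lnext ear (inl e) = inr (true, true)] |
    [/\ e != z, lnext M e != z & lnext ear (inl e) = inl (lnext M e)]].
  rewrite /=; case: (eqVneq e z) => [->|ez]; first by constructor 1.
  by case: (eqVneq (lnext M e) z) => e2; [constructor 2|constructor 3].
move=> [e|[[] []]] [e'|[[] []]].
all: try (case: (key e) => [[ez ->]|[ez e2 ->]|[ez e2 ->]]);
     try (case: (key e') => [[ez' ->]|[ez' e2' ->]|[ez' e2' ->]]) => //=.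
all: try by rewrite ?ez ?ez'.
- by move=> _; rewrite (h2 e e') ?e2 ?e2'.
- by case=> /nI ->.
all: try by case=> /nI E; rewrite E eqxx in ez.
all: try by case=> /nI E; rewrite E eqxx in ez'.
all: try by case=> E; rewrite E eqxx in e2.
all: try by case=> E; rewrite -E eqxx in e2'.
all: by case=> E; case/eqP: zn.
Qed.

(** The tip of the attached triangle is the only new vertex. *)
Definition ear_lab (p : bool * bool) : option {set D} :=
  if p.1 == p.2 then Some (vertex M (if p.1 then z else opp M z)) else None.

Let vI := vrot_inj oK nI.
Let vI' := vrot_inj ear_oppK ear_lnext_inj.

Lemma ear_labv u : ext_lab M ear_lab (vrot ear u) = ext_lab M ear_lab u.
Proof.
have v1 e : vertex M (lnext M (opp M e)) = vertex M e by rewrite -/(vrot M e) (vertex_vrot oK nI).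
case: u => [e|[[] []]] //=; rewrite /vrot /ear_lab /=; last by rewrite -[in LHS](oK z) v1.
case: eqVneq => [E|_] /=; first by rewrite -E oK.
by case: eqVneq => [E|_] /=; [rewrite -E v1|rewrite v1].
Qed.

Let vconn e : fconnect (vrot ear) (inl e) (inl (vrot M e)).
Proof.
have step u v : vrot ear u = v -> fconnect (vrot ear) u v by move=> <-; exact: fconnect1.
case: (eqVneq (opp M e) z) => [E|h1].
  apply: (connect_trans (step _ (inr (false, false)) _)); first by rewrite /vrot /= E eqxx.
  by apply: step; rewrite /vrot /= -E.
case: (eqVneq (vrot M e) z) => [E|h2].
  apply: (connect_trans (step _ (inr (true, true)) _)).
    by rewrite /vrot /= (negbTE h1) -/(vrot M e) E eqxx.
  by apply: step; rewrite E.
by apply: step; rewrite /vrot /= (negbTE h1) -/(vrot M e) (negbTE h2).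
Qed.

Lemma ear_labc u v : ext_lab M ear_lab u = ext_lab M ear_lab v -> fconnect (vrot ear) u v.
Proof.
have vsym := fconnect_sym vI'.
have h1 e e' : vertex M e = vertex M e' -> fconnect (vrot ear) (inl e) (inl e').
  move/eqP; rewrite (orb_eq vI) => /connectP[p]; elim: p e => [|x p IH] e /=.
    by move=> _ ->; exact: connect0.
  by case/andP=> /eqP <- hp /(IH _ hp); apply: connect_trans; exact: vconn.
have pc i : fconnect (vrot ear) (inr (i, i)) (inl (if i then z else opp M z)).
  case: i; first exact: fconnect1.
  by rewrite vsym; have := fconnect1 (vrot ear) (inl (opp M z)); rewrite /vrot /= oK eqxx.
have nc : fconnect (vrot ear) (inr (false, true)) (inr (true, false)) by exact: fconnect1.
have h2 u' : (exists2 e, ext_lab M ear_lab u' = Some (vertex M e) & fconnect (vrot ear) u' (inl e)) \/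
    (ext_lab M ear_lab u' = None /\ fconnect (vrot ear) u' (inr (false, true))).
  case: u' => [e|[[] []]].
  - by left; exists e => //; exact: connect0.
  - by left; exists z => //; exact: (pc true).
  - by right; split=> //; rewrite vsym.
  - by right; split=> //; exact: connect0.
  - by left; exists (opp M z) => //; exact: (pc false).
case: (h2 u) => [[e -> he]|[-> hu]]; case: (h2 v) => [[e' -> he']|[-> hv]] //.
  case=> /h1 h; apply: (connect_trans he); apply: (connect_trans h); by rewrite vsym.
by move=> _; apply: (connect_trans hu); rewrite vsym.
Qed.

Lemma ear_vertex u v : (vertex ear u == vertex ear v) = (ext_lab M ear_lab u == ext_lab M ear_lab v).
Proof. exact: (ext_vertex vI' ear_labv ear_labc). Qed.

Lemma card_ear_vertices : #|vertices ear| = #|vertices M|.+1.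
Proof.
apply: (card_ext_vertices (l := (false, true)) vI' ear_labv ear_labc) => //.
case=> -[] [] //= _; by [exists z|exists (opp M z)].
Qed.

Lemma ear_connected :
  (forall d e, connect [rel u v | (v == opp M u) || (v == lnext M u)] d e) ->
  forall d e, connect [rel u v | (v == opp ear u) || (v == lnext ear u)] d e.
Proof.
move=> hc.
set r := [rel u v | (v == opp ear u) || (v == lnext ear u)].
have rn u : connect r u (lnext ear u) by apply: connect1; rewrite /= eqxx orbT.
have ro u : connect r u (opp ear u) by apply: connect1; rewrite /= eqxx.
have rv u : connect r u (vrot ear u) by exact: connect_trans (ro _) (rn _).
have rc u v : fconnect (vrot ear) u v -> connect r u v.
  case/connectP=> p; elim: p u => [|x p IH] u /= => [_ ->|]; first exact: connect0.
  case/andP=> /eqP <- hp /(IH _ hp); exact: connect_trans.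
have h1 e e' : connect r (inl e) (inl e').
  have /connectP[p] := hc e e'; elim: p e => [|x p IH] e /= => [_ ->|]; first exact: connect0.
  case/andP=> h hp he; apply: connect_trans (IH _ hp he).
  case/orP: h => /eqP ->; first exact: (ro (inl e)).
  have := rc _ _ (vconn (opp M e)); rewrite /vrot oK; apply: connect_trans.
  exact: (ro (inl e)).
have h2 p : (exists e, connect r (inr p) (inl e)) /\ exists e, connect r (inl e) (inr p).
  have t1 : connect r (inl z) (inr (false, false)) by have := rn (inl z); rewrite /= eqxx.
  have t2 : connect r (inr (false, false)) (inr (false, true)) by exact: (rn (inr (false, false))).
  have t3 : connect r (inr (false, true)) (inl z) by exact: (rn (inr (false, true))).
  have o c i : connect r (inr (c, i)) (inr (~~ c, i)) by exact: (ro (inr (c, i))).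
  have t23 := connect_trans t2 t3; have t12 := connect_trans t1 t2.
  case: p => -[] []; split; exists z => //.
  - by apply: (connect_trans t12); exact: (o false true).
  - by apply: connect_trans t23; exact: (o true false).
  - by apply: (connect_trans t1); exact: (o false false).
move=> [d|p] [e|q].
- exact: h1.
- by have [_ [e he]] := h2 q; apply: connect_trans he.
- by have [[d hd] _] := h2 p; apply: (connect_trans hd).
- have [[d hd] _] := h2 p; have [_ [e he]] := h2 q.
  by apply: (connect_trans hd); apply: connect_trans he.
Qed.

(** In the outer cycle, [z] gives way to the reverses of the two free sides of the triangle. *)
Lemma ear_cycle c1 c2 : c2 ++ c1 != [::] -> uniq (c1 ++ z :: c2) -> fcycle (lnext M) (c1 ++ z :: c2) ->
  fcycle (lnext ear) (map inl c1 ++ inr (true, true) :: inr (true, false) :: map inl c2).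
Proof.
move=> ne u.
have rc (A : eqType) (e : rel A) s1 s2 : path.cycle e (s1 ++ s2) = path.cycle e (s2 ++ s1).
  by rewrite -(rot_cycle (size s1)) rot_size_cat.
rewrite (rc _ _ c1) (rc _ _ (map inl c1)).
have -> : (inr (true, true) :: inr (true, false) :: map inl c2) ++ map (@inl D (bool * bool)) c1 =
  inr (true, true) :: inr (true, false) :: map inl (c2 ++ c1) by rewrite map_cat.
have zn' : z \notin c2 ++ c1.
  by move: u; rewrite -(rot_uniq (size c1)) rot_size_cat /= => /andP[].
rewrite cat_cons; case: (c2 ++ c1) ne zn' => // x s _ zn' /= /andP[/eqP e0 h].
apply/andP; split; first by rewrite e0.
elim: s {e0} x zn' h => [|y s IH] x.
  by rewrite inE /= => h; rewrite [x == z]eq_sym (negbTE h) => /andP[/eqP -> _]; rewrite !eqxx.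
rewrite inE negb_or => /andP[h1 h2] /=; rewrite [x == z]eq_sym (negbTE h1) => /andP[/eqP e h3].
have yz : y != z by move: h2; rewrite inE negb_or eq_sym => /andP[].
by rewrite e (negbTE yz) eqxx /=; exact: IH.
Qed.

End Ear.

(** * Outerplanar triangulations in the form of strips *)

Section OuterStrip.
Variables (D : finType) (M : cmap D).

Definition tops (es : seq (entry D)) := [seq sidedart M e | e <- es & e.1.1].
Definition bots (es : seq (entry D)) := [seq sidedart M e | e <- es & ~~ e.1.1].

(* The outer face of the strip, from the left end through the top to the right *)
(* end [z] and back through the bottom.                                         *)
Definition ocycle (r : D) (es : seq (entry D)) (z : D) : seq D :=
  opp M r :: map (opp M) (tops es) ++ z :: rev (map (opp M) (bots es)).

(** Here [r] is the left end of the strip and serves as root, and [z] is the outer dart at its right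
    end. The numbers of darts and vertices belong to the invariant because they yield planarity. *)
Definition ostrip (r : D) (es : seq (entry D)) (z : D) : Prop :=
  [/\ [/\ involutive (opp M), forall d, opp M d != d, injective (lnext M),
          forall d e, connect [rel u v | (v == opp M u) || (v == lnext M u)] d e
        & #|D| = 4 * size es + 2],
      [/\ forall d, d \in sdarts M es ++ ocycle r es z,
          {in sdarts M es, forall d, lnext M (lnext M (lnext M d)) = d},
          fcycle (lnext M) (ocycle r es z), chain M r es z
        & #|vertices M| = size es + 2]
    & forall d, exists2 o, o \in ocycle r es z & vertex M d = vertex M o].

Lemma size_ocycle r es z : size (ocycle r es z) = size es + 2.
Proof.
rewrite /ocycle /= size_cat /= size_rev !size_map !size_filter.
by rewrite -[in RHS](count_predC (fun e : entry D => e.1.1)) addnS addn2.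
Qed.

Section Facts.
Variables (r z : D) (es : seq (entry D)).
Hypothesis h : ostrip r es z.

Lemma uniq_ostrip : uniq (sdarts M es ++ ocycle r es z).
Proof.
case: h => -[_ _ _ _ hc] [cover _ _ _ _] _.
apply: (@leq_size_uniq _ (enum D)); first exact: enum_uniq.
  by move=> x _; exact: cover.
by rewrite size_cat size_sdarts size_ocycle -cardE hc; lia.
Qed.

Lemma uniq_ocycle : uniq (ocycle r es z).
Proof. by have := uniq_ostrip; rewrite cat_uniq => /and3P[]. Qed.

Lemma sdarts_ocycle d : (d \in sdarts M es) = (d \notin ocycle r es z).
Proof.
have := uniq_ostrip; rewrite cat_uniq => /and3P[_ /hasPn h1 _].
case: h => _ [cover _ _ _ _] _.
apply/idP/idP => [hd|]; first by apply/negP=> /h1; rewrite hd.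
by have := cover d; rewrite mem_cat => /orP[->|->].
Qed.

Lemma sdarts_lnext d : d \in sdarts M es -> lnext M d \in sdarts M es.
Proof.
case: h => _ [_ n3 _ _ _] _ hd; have := n3 d hd.
case/sdartsP: hd n3 => e he; rewrite !inE => hd n3 n3d.
have hl : e.1.2 \in sdarts M es by apply/sdartsP; exists e => //; rewrite inE eqxx.
case/or3P: hd n3d => /eqP -> _; last by rewrite n3.
- by apply/sdartsP; exists e => //; rewrite !inE eqxx orbT.
- by apply/sdartsP; exists e => //; rewrite !inE eqxx !orbT.
Qed.

Lemma z_ocycle : z \in ocycle r es z.
Proof. by rewrite inE mem_cat inE eqxx !orbT. Qed.

Lemma outer_ocycle d : (d \in outer (RMap M r)) = (d \in ocycle r es z).
Proof.
case: h => _ [_ _ hc _ _] _; rewrite inE.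
by rewrite (fconnect_cycle hc) ?inE ?eqxx.
Qed.

Lemma lnext_z : lnext M z != z.
Proof.
have u := uniq_ocycle; case: h => _ [_ _ hc _ _] _.
move: u hc; rewrite /ocycle -cat_cons; set c1 := _ :: _; set c2 := rev _ => u.
rewrite -(rot_cycle (size c1)) rot_size_cat cat_cons.
have e : c2 ++ c1 != [::] by case: c2 {u}.
move: u; rewrite -(rot_uniq (size c1)) rot_size_cat cat_cons /=.
case: (c2 ++ c1) e => // x s _ /andP[+ _] /= /andP[/eqP -> _].
by rewrite inE negb_or eq_sym => /andP[].
Qed.

Let oK : involutive (opp M). Proof. by case: h => -[]. Qed.
Let oN : forall d, opp M d != d. Proof. by case: h => -[]. Qed.
Let nI : injective (lnext M). Proof. by case: h => -[]. Qed.

Lemma card_outer_strip : #|outer (RMap M r)| = size es + 2.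
Proof.
rewrite -(size_ocycle r es z) -(card_uniqP uniq_ocycle); apply: eq_card => d.
exact: outer_ocycle.
Qed.

Lemma face_inner d : d \notin outer (RMap M r) -> #|face M d| = 3.
Proof.
rewrite outer_ocycle -sdarts_ocycle => /sdartsP[e he hd].
have u : uniq (tri3 M e.1.2).
  have : uniq (sdarts M es) by have := uniq_ostrip; rewrite cat_uniq => /and3P[].
  case/splitPr: he => s1 s2; rewrite sdarts_cat cat_uniq => /and3P[_ _].
  by rewrite -cat1s sdarts_cat cat_uniq => /and3P[].
have hc : fcycle (lnext M) (tri3 M e.1.2).
  case: h => _ [_ n3 _ _ _] _; rewrite /= !eqxx n3 ?eqxx //.
  by apply/sdartsP; exists e => //; rewrite inE eqxx.
rewrite -[RHS](order_cycle hc u hd) /order; apply: eq_card => x.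
by rewrite !inE.
Qed.

(** With [k = size es], the [4k + 2] darts are shared by one face of degree [k + 2] and by
    triangles. *)
Lemma card_ostrip_faces : #|faces M| = (size es).+1.
Proof.
have hs := sum_card_orb nI; rewrite -/(faces M) in hs.
have ho : outer (RMap M r) \in faces M by apply/imsetP; exists (opp M r).
rewrite (bigD1 _ ho) /= card_outer_strip (eq_bigr (fun=> 3)) in hs; last first.
  move=> X /andP[/imsetP[d _ ->] ne]; apply: face_inner.
  apply: contra ne; rewrite inE => hd; apply/eqP/setP=> x.
  by rewrite !inE; apply/esym/(same_connect (fconnect_sym nI) hd).
rewrite sum_nat_const in hs.
case: h => -[_ _ _ _ hD] _ _; rewrite hD in hs.
rewrite (cardsD1 (outer (RMap M r))) ho; set k := #|_|.
set a := (X in (_ + X * 3 = _)%N) in hs.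
have E : a = k by apply: eq_card => X; rewrite !inE andbC.
by move: hs; rewrite E; lia.
Qed.

Lemma ostrip_outerplanar : outerplanar (RMap M r) (size es + 2).
Proof.
have F := card_ostrip_faces; have O := card_outer_strip.
case: (h) => -[_ _ _ conn hD] [_ _ _ _ hV] hvo.
have E := card_edges oK oN.
split=> //.
- split=> //; change (#|vertices M| + #|faces M| = #|edges M| + 2); rewrite hV F.
  by move: E; rewrite hD; set k := #|edges M|; lia.
- rewrite -hV; apply: eq_card => X; apply/imsetP/imsetP => -[d hd ->]; first by exists d.
  by have [v hv ->] := hvo d; exists v => //; rewrite outer_ocycle.
- exact: face_inner.
Qed.

(** The boundary in clockwise order from the root: along the bottom, through the right end and back
    along the top. *)
Definition qdarts : seq D := r :: bots es ++ opp M z :: rev (tops es).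

(** Numbering the sides clockwise runs through the outer face backwards, so [qdarts] is the reversal
    of [ocycle] up to opposites and the choice of the starting point. *)
Lemma side_nth i : i < size es + 2 -> side (RMap M r) i = nth r qdarts i.
Proof.
pose C := behead (ocycle r es z).
have eC : ocycle r es z = opp M r :: C by [].
have sC : size C = (size es).+1 by have := size_ocycle r es z; rewrite eC /=; lia.
have eq : qdarts = map (opp M) (opp M r :: rev C).
  rewrite /qdarts /C /= oK rev_cat rev_cons revK map_cat map_rcons map_rev.
  by rewrite (mapK oK) cat_rcons (mapK oK).
have key j : j < size es + 2 -> iter j (finv (lnext M)) (opp M r) = nth r (opp M r :: rev C) j.
  elim: j => // j IH hj; rewrite iterS IH; last by lia.
  have -> : nth r (opp M r :: rev C) j = lnext M (nth r (opp M r :: rev C) j.+1); last by rewrite finv_f.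
  case: h => _ [_ _ hc _ _] _; move: hc; rewrite eC /= => /(pathP r) hp.
  have h1 : size C - j.+1 < size C by lia.
  have h2 : size C - j < size (rcons C (opp M r)) by rewrite size_rcons; lia.
  have := hp _ h2; have {1}-> : size C - j = (size C - j.+1).+1 by lia.
  have h3 : j < size C by lia.
  rewrite /= !nth_rcons h1 (nth_rev _ h3) => /eqP ->.
  case: j {IH h1 h2 h3} hj => [|j] hj; first by rewrite subn0 ltnn eqxx.
  rewrite ifT; last by lia.
  by rewrite /= nth_rev; [congr nth; lia|lia].
move=> hi; rewrite eq (nth_map r); first by rewrite -key.
by rewrite /= size_rev; move: sC; set k := size C; lia.
Qed.

End Facts.
End OuterStrip.

(** The empty strip is a single edge, whose two darts form the only face. *)
Lemma ostrip_base : ostrip (CMap negb negb) true [::] true.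
Proof.
have nb : involutive negb by exact: negbK.
split; first split=> //.
- by case.
- by move=> [] [].
- by move=> x y; case: (eqVneq x y) => [->|ne]; [exact: connect0|apply: connect1; case: x y ne => [] []].
- by rewrite card_bool.
- split=> //; first by case.
  have vI := vrot_inj nb (M := CMap negb negb) (can_inj nb).
  rewrite /vertices (@card_orb_label _ _ vI _ id) => [|d|d e ->]; last exact: connect0.
    by rewrite imset_id cardsT card_bool.
  by rewrite /vrot /= negbK.
- by move=> d; exists d => //; case: d.
Qed.

Section EarStrip.
Variables (D : finType) (M : cmap D) (r z : D) (es : seq (entry D)) (x : bool) (k : nat).
Hypothesis h : ostrip M r es z.

Let I := @lift_entry D (bool * bool)%type.
Let M' := ear M z.
Let es' := rcons (map I es) (x, inl z, k).

Let oK : involutive (opp M). Proof. by case: h => -[]. Qed.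
Let oN : forall d, opp M d != d. Proof. by case: h => -[]. Qed.
Let nI : injective (lnext M). Proof. by case: h => -[]. Qed.

Let ear_inner d : d \in sdarts M es -> lnext M' (inl d) = inl (lnext M d).
Proof.
move=> hd; have hd' := sdarts_lnext h hd.
have hz := z_ocycle M r z es.
rewrite /M' /=; case: eqVneq => [E|_]; first by move: hd; rewrite E (sdarts_ocycle h) hz.
by case: eqVneq => [E|_] //; move: hd'; rewrite E (sdarts_ocycle h) hz.
Qed.

Let mem_l e : e \in es -> e.1.2 \in sdarts M es.
Proof. by move=> he; apply/sdartsP; exists e => //; rewrite inE eqxx. Qed.

Let ear_r e : e \in es -> rdart M' (I e) = inl (rdart M e).
Proof.
move=> he; have hl := mem_l he; rewrite /rdart.
change ((if e.1.1 then lnext M' (inl e.1.2) else lnext M' (lnext M' (inl e.1.2))) =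
  inl (if e.1.1 then lnext M e.1.2 else lnext M (lnext M e.1.2))).
by case: e.1.1; rewrite !ear_inner //; exact: (sdarts_lnext h).
Qed.

Let ear_s e : e \in es -> sidedart M' (I e) = inl (sidedart M e).
Proof.
move=> he; have hl := mem_l he; rewrite /sidedart.
change ((if e.1.1 then lnext M' (lnext M' (inl e.1.2)) else lnext M' (inl e.1.2)) =
  inl (if e.1.1 then lnext M (lnext M e.1.2) else lnext M e.1.2)).
by case: e.1.1; rewrite !ear_inner //; exact: (sdarts_lnext h).
Qed.

Let l1 : lnext M' (inl z) = inr (false, false). Proof. by rewrite /= eqxx. Qed.

Let ear_filter (p : pred bool) s : {subset s <= es} ->
  [seq sidedart M' e | e <- map I s & p e.1.1] = map inl [seq sidedart M e | e <- s & p e.1.1].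
Proof.
elim: s => //= e s IH hs; case: ifP => _ /=; rewrite IH //; try by move=> y hy; apply: hs; rewrite inE hy orbT.
by rewrite ear_s // hs // inE eqxx.
Qed.

Let z' : D + bool * bool := inr (true, ~~ x).
Let c1 := opp M r :: map (opp M) (tops M es).
Let c2 := rev (map (opp M) (bots M es)).

Let ear_ocycle : ocycle M' (inl r) es' z' =
  map inl c1 ++ inr (true, true) :: inr (true, false) :: map inl c2.
Proof.
have f1 : tops M' (map I es) = map inl (tops M es) := @ear_filter id es (fun e he => he).
have f2 : bots M' (map I es) = map inl (bots M es) := @ear_filter negb es (fun e he => he).
have mo s : map (opp M') (map inl s) = map inl (map (opp M) s) by rewrite -!map_comp.
have t' : tops M' es' = if x then rcons (map inl (tops M es)) (inr (false, true)) else map inl (tops M es).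
  rewrite -f1 /tops /es' filter_rcons -[X in if X then _ else _]/x.
  by case: (x) => //; rewrite map_rcons -[sidedart M' (true, _, _)]/(lnext M' (lnext M' (inl z))) l1.
have b' : bots M' es' = if x then map inl (bots M es) else rcons (map inl (bots M es)) (inr (false, false)).
  rewrite -f2 /bots /es' filter_rcons -[X in if X then _ else _]/(~~ x).
  by case: (x) => //; rewrite map_rcons -[sidedart M' (false, _, _)]/(lnext M' (inl z)) l1.
rewrite /ocycle t' b' /z' /c1 /c2 map_cons map_rev -!mo.
by case: (x) => /=; rewrite map_rcons ?cat_rcons ?rev_rcons.
Qed.

Let ear_sdarts : sdarts M' es' = map inl (sdarts M es) ++ [:: inl z; inr (false, false); inr (false, true)].
Proof.
rewrite /es' -cats1 sdarts_cat {2}/sdarts /= eqxx; congr (_ ++ _).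
have : {subset es <= es} by [].
elim: {1 3 4}es => // e s IH hs.
have he : e \in es by apply: hs; rewrite inE eqxx.
have hl := mem_l he; have hl' := sdarts_lnext h hl.
have E : sdarts M' [:: I e] = map inl (sdarts M [:: e]).
  rewrite -[LHS]/[:: inl e.1.2; lnext M' (inl e.1.2); lnext M' (lnext M' (inl e.1.2))].
  by rewrite !ear_inner.
rewrite map_cons -cat1s sdarts_cat E IH; last by move=> y hy; apply: hs; rewrite inE hy orbT.
by rewrite -map_cat -sdarts_cat.
Qed.

Let chain_lift w p q : {subset w <= es} -> chain M p w q -> chain M' (inl p) (map I w) (inl q).
Proof.
elim: w p => [|e w IH] p hw /=; first by move=> ->.
case=> <- hc; split=> //.
have := ear_r (hw e (mem_head _ _)); rewrite /rdart /I /= => ->.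
by apply: IH => // y hy; apply: hw; rewrite inE hy orbT.
Qed.

(** A letter is appended by attaching an ear at the right end; [x] decides which of its free sides
    becomes a boundary side and which one the new right end. *)
Lemma ostrip_ear : ostrip M' (inl r) es' z'.
Proof.
have zn := lnext_z h; have u := uniq_ocycle h.
case: (h) => -[_ _ _ conn hD] [cover n3 hc hch hV] hvo.
have sz : size es' = (size es).+1 by rewrite size_rcons size_map.
split; first split.
- exact: ear_oppK.
- exact: ear_opp_neq.
- exact: ear_lnext_inj.
- exact: ear_connected.
- by rewrite card_sum card_prod card_bool hD sz; lia.
- split.
  + move=> d; rewrite ear_sdarts ear_ocycle.
    case: d => [d|[c i]]; last by case: c i => -[]; rewrite !mem_cat !inE eqxx ?orbT.
    rewrite mem_cat [_ \in _ ++ [:: _; _; _]]mem_cat [_ \in map inl c1 ++ _]mem_cat.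
    rewrite [_ \in [:: _; _; _]]inE [_ \in inr _ :: _]inE [_ \in inr _ :: map _ _]inE.
    have := cover d; rewrite mem_cat /ocycle -cat_cons -/c1 -/c2 mem_cat [_ \in z :: _]inE.
    rewrite !(mem_map (@inl_inj _ _)) => /orP[->//|/or3P[->|/eqP ->|->]]; by rewrite ?eqxx ?orbT.
  + move=> d; rewrite ear_sdarts mem_cat => /orP[/mapP[e he ->]|].
      by rewrite !ear_inner ?n3 //; do ?apply: (sdarts_lnext h).
    rewrite !inE => /or3P[] /eqP ->; by rewrite ?l1 //= eqxx.
  + by rewrite ear_ocycle; apply: ear_cycle => //; rewrite /c1; case: (c2).
  + rewrite /es' -cats1; apply/chain_cat; exists (inl z); first exact: chain_lift.
    by rewrite /= /rdart /z' l1; case: (x).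
  + by rewrite (card_ear_vertices oK nI zn) hV sz.
- have vE p q : vertex M' p = vertex M' q <-> ext_lab M (ear_lab M z) p = ext_lab M (ear_lab M z) q.
    by split=> /eqP E; apply/eqP; move: E; rewrite (ear_vertex oK nI zn).
  have main e : exists2 w, w \in ocycle M' (inl r) es' z' & vertex M' (inl e) = vertex M' w.
    have [w hw E] := hvo e; rewrite ear_ocycle.
    have e1 : vertex M' (inl e) = vertex M' (inl w) by apply/vE; rewrite /= E.
    move: hw; rewrite /ocycle -cat_cons -/c1 -/c2 mem_cat [_ \in z :: _]inE => /or3P[hw|/eqP wz|hw].
    - by exists (inl w) => //; rewrite mem_cat mem_map ?hw //; exact: inl_inj.
    - exists (inr (true, true)); first by rewrite mem_cat mem_head orbT.
      by rewrite e1 wz; apply/vE.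
    - exists (inl w) => //; rewrite mem_cat; apply/orP; right.
      by do 2 rewrite [_ \in inr _ :: _]inE; rewrite mem_map ?hw ?orbT //; exact: inl_inj.
  have new : exists2 w, w \in ocycle M' (inl r) es' z' & vertex M' (inr (true, false)) = vertex M' w.
    by exists (inr (true, false)) => //; rewrite ear_ocycle mem_cat [_ \in inr _ :: _]inE mem_head !orbT.
  case=> [e|[[] []]] //.
  - have [w hw E] := main z; exists w => //; rewrite -E; exact/vE.
  - have [w hw E] := new; exists w => //; rewrite -E; exact/vE.
  - have [w hw E] := main (opp M z); exists w => //; rewrite -E; exact/vE.
Qed.

End EarStrip.

Section OstripMorphism.
Variables (D D' : finType) (M : cmap D) (M' : cmap D') (f : D -> D').
Hypothesis fB : bijective f.
Hypothesis fo : {morph f : d / opp M d >-> opp M' d}.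
Hypothesis fn : {morph f : d / lnext M d >-> lnext M' d}.

Definition map_entry (e : entry D) : entry D' := (e.1.1, f e.1.2, e.2).

Let fI := bij_inj fB.

Lemma map_rdart e : rdart M' (map_entry e) = f (rdart M e).
Proof. by rewrite /rdart /=; case: ifP => _; rewrite !fn. Qed.

Lemma map_sdart e : sidedart M' (map_entry e) = f (sidedart M e).
Proof. by rewrite /sidedart /=; case: ifP => _; rewrite !fn. Qed.

Lemma map_sdarts es : sdarts M' (map map_entry es) = map f (sdarts M es).
Proof.
by elim: es => // e es IH; rewrite map_cons -cat1s sdarts_cat -(cat1s e es) sdarts_cat map_cat -IH /sdarts /tri3 /= !fn.
Qed.

Lemma map_chain r es z : chain M r es z -> chain M' (f r) (map map_entry es) (f z).
Proof. by elim: es r => [|e es IH] r /= => [->|[-> /IH]] //; rewrite map_rdart fo. Qed.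

Lemma map_sides (p : pred bool) es :
  [seq sidedart M' e | e <- map map_entry es & p e.1.1] = map f [seq sidedart M e | e <- es & p e.1.1].
Proof. by elim: es => //= e es IH; case: ifP => _ //=; rewrite IH map_sdart. Qed.

Lemma map_ocycle r es z : ocycle M' (f r) (map map_entry es) (f z) = map f (ocycle M r es z).
Proof.
have mo s : map (opp M') (map f s) = map f (map (opp M) s).
  by rewrite -!map_comp; apply: eq_map => x /=; rewrite fo.
rewrite /ocycle /tops /bots (map_sides id) (map_sides negb) /= map_cat map_cons map_rev.
by rewrite !mo fo.
Qed.

Lemma ostrip_morph r es z : ostrip M r es z -> ostrip M' (f r) (map map_entry es) (f z).
Proof.
have := fB => -[g gK fK] [[h1 h2 h3 h4 h5] [c1 c2 c3 c4 c5] h6].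
split; first split.
- by move=> d; rewrite -(fK d) -!fo h1.
- by move=> d; rewrite -(fK d) -fo (inj_eq fI).
- by move=> d e; rewrite -(fK d) -(fK e) -!fn => /fI/h3 ->.
- move=> d e; rewrite -(fK d) -(fK e) (@connect_morph _ _ _ fB [rel u v | (v == opp M u) || (v == lnext M u)]) //.
  by move=> x y /=; rewrite -fo -fn !(inj_eq fI).
- by rewrite size_map -h5 (bij_eq_card fB).
- split.
  + by move=> d; rewrite map_sdarts map_ocycle -map_cat -(fK d) mem_map.
  + by move=> d; rewrite map_sdarts => /mapP[x hx ->]; rewrite -!fn c2.
  + rewrite map_ocycle cycle_map; move: c3; apply: sub_cycle => x y /= /eqP <-.
    by rewrite fn.
  + exact: map_chain.
  + by rewrite (card_vertices_morph fB fo fn) size_map.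
- move=> d; have [w hw E] := h6 (g d); exists (f w); first by rewrite map_ocycle mem_map.
  by rewrite -{1}(fK d) !(vertex_morph fB fo fn) E.
Qed.

End OstripMorphism.

Lemma ostrip_numbered (D : finType) (M : cmap D) r es z : ostrip M r es z ->
  exists (k : nat) (M' : cmap 'I_k) r' es' z', ostrip M' r' es' z' /\ eword es' = eword es.
Proof.
move=> h; exists #|D|.
pose M' := CMap (fun i => enum_rank (opp M (enum_val i))) (fun i => enum_rank (lnext M (enum_val i))).
exists M', (enum_rank r), (map (map_entry enum_rank) es), (enum_rank z); split.
  apply: ostrip_morph h.
  - exact: enum_rank_bij.
  - by move=> d /=; rewrite enum_rankK.
  - by move=> d /=; rewrite enum_rankK.
by rewrite /eword -map_comp.
Qed.

Lemma ostrip_exists (W : seq (bool * nat)) :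
  exists (k : nat) (M : cmap 'I_k) r es z, ostrip M r es z /\ eword es = W.
Proof.
suff [D [M [r [es [z [h <-]]]]]] : exists (D : finType) (M : cmap D) r es z, ostrip M r es z /\ eword es = W.
  exact: ostrip_numbered h.
elim/last_ind: W => [|W [x k] [D [M [r [es [z [h E]]]]]]].
  by exists bool; do 4!eexists; split; first exact: ostrip_base.
exists (D + bool * bool)%type; do 4!eexists; split; first exact: (ostrip_ear x k h).
by rewrite /eword map_rcons -/(eword _) eword_lift E.
Qed.

(** * Changing labels, and reading the letters back from the map *)

Lemma relabel (D : finType) (es : seq (entry D)) (W : seq (bool * nat)) :
    map fst (eword es) = map fst W ->
  exists es', map fst es' = map fst es /\ eword es' = W.
Proof.
elim: es W => [|e es IH] [|[x k] W] //=; first by exists [::].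
case=> ex /IH[es' [h1 h2]]; exists ((e.1, k) :: es') => /=.
by rewrite h1 h2 ex.
Qed.

(** An unglued strip ignores its labels, so one map serves both words of a meander. *)
Lemma ostrip_relabel (D : finType) (M : cmap D) r es es' z :
  map fst es' = map fst es -> ostrip M r es z -> ostrip M r es' z.
Proof.
move=> E; have sz : size es' = size es by rewrite -(size_map fst) E size_map.
have e1 : sdarts M es' = sdarts M es.
  rewrite /sdarts; congr flatten; have hm s : [seq tri3 M e.1.2 | e <- s] = [seq tri3 M p.2 | p <- map fst s].
    by rewrite -map_comp.
  by rewrite !hm E.
have e2 (p : pred bool) : [seq sidedart M e | e <- es' & p e.1.1] = [seq sidedart M e | e <- es & p e.1.1].
  elim: es es' E {sz e1} => [|e es IH] [|e' es'] //= [E /IH {}IH].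
  have Es : sidedart M e' = sidedart M e by rewrite /sidedart E.
  by rewrite E; case: ifP => _ //=; rewrite IH Es.
have e3 : ocycle M r es' z = ocycle M r es z by rewrite /ocycle /tops /bots (e2 id) (e2 negb).
have e4 q : chain M q es z -> chain M q es' z.
  elim: es es' q E {sz e1 e2 e3} => [|e es IH] [|e' es'] q //= [E /IH {}IH].
  by rewrite /rdart E => -[-> /IH].
by case=> [h [c1 c2 c3 c4 c5] h6]; split; rewrite ?sz ?e1 ?e3 //; split=> //; rewrite ?sz ?e1 ?e3 //; exact: e4.
Qed.

(* A triangle that is not the last one has only its side on the outer face, so *)
(* the letters can be read off one after the other from the root.               *)
Lemma ostrip_word (D D' : finType) (M : cmap D) (M' : cmap D') r es z r' es' z' :
    ostrip M r es z -> ostrip M' r' es' z' -> risomorphic (RMap M r) (RMap M' r') ->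
  size es = size es' /\ forall i, i.+1 < size es ->
    nth false [seq e.1.1 | e <- es] i = nth false [seq e.1.1 | e <- es'] i.
Proof.
move=> h h' [f [fB fo fn fr]].
have sz : size es = size es'.
  have := bij_eq_card fB; case: (h) => -[_ _ _ _ ->] _ _; case: (h') => -[_ _ _ _ ->] _ _; lia.
have fout d : (f d \in outer (RMap M' r')) = (d \in outer (RMap M r)).
  by rewrite !inE -fr -[opp (RMap M' r') _]fo (fconnect_morph fB fn).
have fo' d : f (opp M d) = opp M' (f d) by exact: fo.
have fn' d : f (lnext M d) = lnext M' (f d) by exact: fn.
split=> // i hi.
have rec (E : finType) (m : cmap E) q s y : ostrip m q s y -> forall e0 k, k.+1 < size s ->
    [/\ (nth e0 s k.+1).1.2 = opp m (rdart m (nth e0 s k)),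
       opp m (rdart m (nth e0 s k)) \notin outer (RMap m q) & opp m (sidedart m (nth e0 s k)) \in outer (RMap m q)].
  move=> hs e0 k hk; have hc : chain m q s y by case: hs => _ [].
  have E1 := chain_nth e0 hc hk.
  have hk' : k < size s by apply: ltnW.
  split=> //.
    rewrite -E1 (outer_ocycle hs) -(sdarts_ocycle hs); apply/sdartsP.
    by exists (nth e0 s k.+1); [exact: mem_nth|rewrite inE eqxx].
  rewrite (outer_ocycle hs) /ocycle inE mem_cat inE mem_rev.
  have hm : nth e0 s k \in s by exact: mem_nth.
  apply/orP; right; case: (boolP (nth e0 s k).1.1) => hx.
    by rewrite map_f //; apply: map_f; rewrite mem_filter hx hm.
  by rewrite [X in [|| _, _ | X]]map_f ?orbT //; apply: map_f; rewrite mem_filter hx hm.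
have [e0 _] : exists e0 : entry D, true by exists (true, r, 0).
have [e0' _] : exists e0' : entry D', true by exists (true, r', 0).
have letters k : k.+1 < size es -> f (nth e0 es k).1.2 = (nth e0' es' k).1.2 ->
    (nth e0 es k).1.1 = (nth e0' es' k).1.1 /\ f (nth e0 es k.+1).1.2 = (nth e0' es' k.+1).1.2.
  move=> hk E; have [a1 a2 a3] := rec _ _ _ _ _ h e0 k hk.
  have hk' : k.+1 < size es' by rewrite -sz.
  have [b1 b2 b3] := rec _ _ _ _ _ h' e0' k hk'.
  have E' : (nth e0 es k).1.1 = (nth e0' es' k).1.1.
    have g1 := fout (opp M (lnext M (nth e0 es k).1.2)).
    have g2 := fout (opp M (lnext M (lnext M (nth e0 es k).1.2))).
    rewrite !fo' !fn' in g1 g2.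
    move: a2 a3 b2 b3 g1 g2; rewrite /rdart /sidedart /= E; do 2 case: ifP => _ //.
      by move=> /negbTE-> _ _ /= -> .
    by move=> _ -> /negbTE /= -> _.
  by split=> //; rewrite a1 b1 /rdart E' -E; case: ifP => _; rewrite fo' !fn'.
have base k : k < size es -> f (nth e0 es k).1.2 = (nth e0' es' k).1.2.
  elim: k => [|k IH] hk; last by have [] := letters k hk (IH (ltnW hk)).
  case: h => _ [_ _ _ + _] _; case: h' => _ [_ _ _ + _] _; move: hk sz.
  by case: (es) => // a s _; case: (es') => // b s' _ /= [-> _] [-> _].
have [E _] := letters i hi (base i (ltnW hi)).
by rewrite (nth_map e0) ?(ltnW hi) // (nth_map e0') // -sz ltnW.
Qed.

(** * Gluing a strip *)

(** The labels in the order of [qdarts], that is, of the numbering of the sides. *)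
Definition qlab (W : seq (bool * nat)) (l0 l1 : nat) : seq nat :=
  l0 :: [seq p.2 | p <- W & ~~ p.1] ++ l1 :: rev [seq p.2 | p <- W & p.1].

Lemma size_qlab W l0 l1 : size (qlab W l0 l1) = size W + 2.
Proof.
rewrite /qlab /= size_cat /= size_rev !size_map !size_filter addnS addn2; do 2 congr _.+1.
by rewrite -[in RHS](count_predC (fun p : bool * nat => p.1)) addnC.
Qed.

Definition pairing_of (m : nat) (L : seq nat) (pi : {perm 'I_m}) : Prop :=
  forall i j : 'I_m, (nth 0 L i == nth 0 L j) = (j == i) || (j == pi i).

Section GlueStrip.
Variables (D : finType) (M : cmap D) (r z : D) (es : seq (entry D)) (l0 l1 n : nat).
Variable pi : {perm 'I_n.*2}.
Hypothesis h : ostrip M r es z.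
Hypothesis hn : 1 < n.
Hypothesis sz : size es + 2 = n.*2.
Hypothesis hpi : pairing_of (qlab (eword es) l0 l1) pi.

Let t := RMap M r.
Let ht : outerplanar t n.*2. Proof. by rewrite -sz; exact: ostrip_outerplanar h. Qed.
Let G := glue_map t pi.
Let r0 : glue_dart t := gside hn ht 0.
(** Transfers inner darts to the glued map; outer darts go to the default [r0]. *)
Let K (d : D) : glue_dart t := insubd r0 d.

Let oK : involutive (opp M). Proof. by case: h => -[]. Qed.

Let val_K d : d \notin outer t -> val (K d) = d.
Proof. by move=> hd; rewrite /K insubdK. Qed.

Let K_val u : K (val u) = u.
Proof. exact: valKd. Qed.

Let innerE d : (d \notin outer t) = (d \in sdarts M es).
Proof. by rewrite (outer_ocycle h) -(sdarts_ocycle h). Qed.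

Let K_lnext d : d \notin outer t -> lnext G (K d) = K (lnext M d).
Proof.
move=> hd; apply: val_inj; rewrite (glue_lnext pi ht) !val_K //.
by rewrite innerE; apply: (sdarts_lnext h); rewrite -innerE.
Qed.

Let K_opp d : d \notin outer t -> opp M d \notin outer t -> opp G (K d) = K (opp M d).
Proof.
move=> h1 h2; apply: val_inj; rewrite (glue_opp_inner pi ht) ?val_K //.
by move=> i; apply/eqP=> E; move: h2; rewrite E (opp_side ht i : opp M (side t i) = _) (odart_outer ht).
Qed.

Let I (e : entry D) : entry (glue_dart t) := (e.1.1, K e.1.2, e.2).

Let left_in e : e \in es -> e.1.2 \notin outer t.
Proof. by move=> he; rewrite innerE; apply/sdartsP; exists e => //; rewrite inE eqxx. Qed.

Let lnext_in d : d \notin outer t -> lnext M d \notin outer t.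
Proof. by rewrite !innerE; exact: (sdarts_lnext h). Qed.

Let K_r e : e \in es -> rdart G (I e) = K (rdart M e).
Proof.
move=> he; have hl := left_in he; rewrite /rdart -[(I e).1.1]/(e.1.1) -[(I e).1.2]/(K e.1.2).
by case: ifP => _; rewrite !K_lnext // lnext_in.
Qed.

Let K_s e : e \in es -> sidedart G (I e) = K (sidedart M e).
Proof.
move=> he; have hl := left_in he; rewrite /sidedart -[(I e).1.1]/(e.1.1) -[(I e).1.2]/(K e.1.2).
by case: ifP => _; rewrite !K_lnext // lnext_in.
Qed.

Let qz : seq (D * nat) := (r, l0) :: [seq (sidedart M e, e.2) | e <- es & ~~ e.1.1] ++
  (opp M z, l1) :: rev [seq (sidedart M e, e.2) | e <- es & e.1.1].

Let qz_fst : map fst qz = qdarts M r z es.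
Proof. by rewrite /qz /qdarts /= map_cat /= map_rev -!map_comp. Qed.

Let qz_snd : map snd qz = qlab (eword es) l0 l1.
Proof. by rewrite /qz /qlab /= map_cat /= map_rev /eword !filter_map -!map_comp. Qed.

Let size_qz : size qz = n.*2.
Proof. by rewrite -(size_map snd) qz_snd size_qlab size_map. Qed.

Let qzP p : p \in qz -> exists i : 'I_n.*2, p.1 = side t i /\ p.2 = nth 0 (qlab (eword es) l0 l1) i.
Proof.
move=> hp; have hi : index p qz < n.*2 by rewrite -size_qz index_mem.
exists (Ordinal hi); rewrite (side_nth h) ?sz // -qz_fst -qz_snd.
by rewrite !(nth_map (r, 0)) ?size_qz // nth_index.
Qed.

Let mem_sides p : p \in ssides G (K r) l0 (map I es) (K (opp M z)) l1 ->
  exists2 q, q \in qz & p = (K q.1, q.2).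
Proof.
rewrite inE mem_rcons inE => /or3P[/eqP->|/eqP->|].
- by exists (r, l0) => //; rewrite inE eqxx.
- by exists (opp M z, l1) => //; rewrite inE mem_cat inE eqxx !orbT.
rewrite -map_comp => /mapP[e he ->] /=; rewrite K_s //.
exists (sidedart M e, e.2) => //; rewrite inE mem_cat inE mem_rev.
case: (boolP e.1.1) => hx.
  by rewrite [X in [|| _, _, _ | X]](map_f (fun e => (sidedart M e, e.2))) ?orbT // mem_filter hx.
by rewrite [X in [|| _, X, _ | _]](map_f (fun e => (sidedart M e, e.2))) ?orbT // mem_filter hx.
Qed.

Let sides_mem q : q \in qz -> (K q.1, q.2) \in ssides G (K r) l0 (map I es) (K (opp M z)) l1.
Proof.
have he e : e \in es -> (K (sidedart M e), e.2) \in [seq (sidedart G e, e.2) | e <- map I es].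
  by move=> he; apply/mapP; exists (I e); rewrite ?map_f //= K_s.
rewrite !inE mem_cat inE mem_rev mem_rcons inE.
case/or4P=> [/eqP->|/mapP[e + ->]|/eqP->|/mapP[e + ->]]; rewrite ?eqxx ?orbT //.
  by rewrite mem_filter => /andP[_ /he /= ->]; rewrite !orbT.
by rewrite mem_filter => /andP[_ /he /= ->]; rewrite !orbT.
Qed.

(** Gluing alters only the opposites of the boundary sides, and [pi] exchanges sides with equal
    labels. *)
Lemma glue_strip : strip G (glue_tree t n) (map I es) (K r) l0 (K (opp M z)) l1.
Proof.
case: (h) => -[_ _ _ _ hD] [cover n3 hc hch _] _.
have nes : 0 < size es by lia.
split.
- have chainK s p : {subset s <= es} -> 0 < size s -> chain M p s z ->
      chain G (K p) (map I s) (opp G (K (opp M z))).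
    elim: s p => // e s IH p hs _ [<- hch']; split=> //.
    change (chain G (opp G (rdart G (I e))) (map I s) (opp G (K (opp M z)))).
    have hes : e \in es by apply: hs; rewrite inE eqxx.
    rewrite K_r //; case: s IH hs hch' => [|e' s] IH hs hch'.
      by change (opp G (K (rdart M e)) = opp G (K (opp M z))); rewrite -[z]hch' oK.
    have he' : opp M (rdart M e) \notin outer t.
      case: hch' => <- _; apply: left_in; apply: hs; rewrite !inE eqxx orbT //.
    rewrite K_opp //; first by apply: IH => // x hx; apply: hs; rewrite inE hx orbT.
    rewrite /rdart; have := left_in hes; case: ifP => _ hl; do ?apply: lnext_in; exact: hl.
  exact: chainK.
- have -> : sdarts G (map I es) = map K (sdarts M es).
    have : {subset es <= es} by [].
    elim: {1 3 4}es => // e s IH hs.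
    have hl : e.1.2 \notin outer t by apply: left_in; apply: hs; rewrite inE eqxx.
    rewrite map_cons -cat1s sdarts_cat -(cat1s e s) sdarts_cat map_cat IH; last first.
      by move=> y hy; apply: hs; rewrite inE hy orbT.
    congr (_ ++ _); rewrite -[LHS]/[:: K e.1.2; lnext G (K e.1.2); lnext G (lnext G (K e.1.2))].
    by rewrite !K_lnext ?lnext_in.
  move=> u; rewrite -(K_val u); apply: map_f; rewrite -innerE.
  exact: (valP u).
- have := card_glue_dart ht; rewrite -sz hD size_map; set k := #|_|; lia.
- move=> p q /mem_sides[p' hp ->] /mem_sides[q' hq ->] /= E.
  have [i [ei ei']] := qzP hp; have [j [ej ej']] := qzP hq.
  have := hpi i j; rewrite -ei' -ej' E eqxx => /esym/orP[/eqP ij|/eqP ij].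
    by left; rewrite ei ej ij.
  right; apply: val_inj; rewrite (glue_opp_side pi hn ht (i := i)).
    by rewrite val_K ej ?ij // (side_notin hn ht).
  by rewrite val_K ei // (side_notin hn ht).
- move=> u; apply/glue_treeP/idP => [[i hi]|/mapP[p /mem_sides[q hq ->] -> /=]].
    have hin : nth (r, 0) qz i \in qz by apply: mem_nth; rewrite size_qz.
    have -> : u = K (nth (r, 0) qz i).1.
      apply: val_inj; rewrite hi (side_nth h) ?sz //.
      rewrite -qz_fst (nth_map (r, 0)) ?size_qz // val_K //.
      have [j [-> _]] := qzP hin; exact: (side_notin hn ht).
    by have := map_f fst (sides_mem hin).
  have [i [ei _]] := qzP hq; exists i; rewrite ei val_K //; exact: (side_notin hn ht).
Qed.

Lemma val_glue_root : val (K r) = root t.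
Proof. by apply: val_K; have := side_notin hn ht 0; rewrite /side /= oK. Qed.

End GlueStrip.

Lemma pairing_invol m L (pi : {perm 'I_m}) : pairing_of L pi -> involutive pi.
Proof.
move=> hp i; have := hp i (pi i); rewrite eqxx orbT => /eqP E.
have := hp (pi i) i; rewrite E eqxx => /esym/orP[/eqP ei|/eqP //].
by rewrite -ei -ei.
Qed.

Section GlueGood.
Variables (D : finType) (M : cmap D) (r z : D) (es : seq (entry D)) (l0 l1 n : nat).
Variable pi : {perm 'I_n.*2}.
Hypothesis h : ostrip M r es z.
Hypothesis hn : 1 < n.
Hypothesis sz : size es + 2 = n.*2.
Hypothesis hpi : pairing_of (qlab (eword es) l0 l1) pi.
Hypothesis hp : paired (l0 :: rcons (map snd es) l1).

Let t := RMap M r.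
Let ht : outerplanar t n.*2. Proof. by rewrite -sz; exact: ostrip_outerplanar h. Qed.
Let G := glue_map t pi.
Let oK : involutive (opp M). Proof. by case: h => -[]. Qed.

Lemma glue_oppK : involutive (opp G).
Proof.
move=> u; apply: val_inj.
case: (boolP [exists i : 'I_n.*2, val u == side t i]) => [/existsP[i /eqP hi]|/existsPn hu].
  have h1 := glue_opp_side pi hn ht hi.
  by rewrite (glue_opp_side pi hn ht h1) (pairing_invol hpi) hi.
have h1 := glue_opp_inner pi ht (u := u) hu.
rewrite (glue_opp_inner pi ht) h1 ?oK // => i; apply/eqP=> E.
have := valP u; rewrite -(oK (val u)) -[opp M (val u)]h1 h1 E.
by rewrite (opp_side ht i : opp M (side t i) = _) (odart_outer ht).
Qed.

Lemma glue_lnext3 u : lnext G (lnext G (lnext G u)) = u.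
Proof.
apply: val_inj; rewrite !(glue_lnext pi ht).
case: (h) => _ [_ n3 _ _ _] _; apply: n3.
by rewrite (sdarts_ocycle h) -(outer_ocycle h); exact: (valP u).
Qed.

Lemma glue_lnext_neq u : lnext G u != u.
Proof.
apply/eqP=> /(congr1 val); rewrite (glue_lnext pi ht) => E.
have := face_inner h (valP u).
have -> : face M (val u) = [set val u].
  apply/setP=> x; rewrite !inE; apply/idP/eqP => [|->]; last exact: connect0.
  by case/connectP=> p; elim: p => [|y p IH] //= /andP[/eqP <-]; rewrite [lnext M _]E.
by rewrite cards1.
Qed.

(** The glued map and the realisation of the word are strips with the same letters and labels, hence
    isomorphic by [strip_iso], and membership in [H_n] is transported. *)
Lemma glue_in_Hgood : Hgood n (eword es) l0 l1 -> glue_in t pi (@in_H n).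
Proof.
case=> D' [M' [T' [es' [z0 [z1 [h1 h2 [h3 h3'] h4 h5]]]]]].
have hs := glue_strip h hn sz hpi; have hv := val_glue_root h hn sz.
set K := insubd _ in hs hv; set I := (X in map X es) in hs.
have oK' : involutive (opp M') by case: h1 => -[].
have n3' : forall d, lnext M' (lnext M' (lnext M' d)) = d by case: h1.
have n1' : forall d, lnext M' d != d by case: h1.
have hw : eword es' = eword (map I es) by rewrite h5 /eword -map_comp.
have ne : 0 < size es' by rewrite -(size_map (fun e => (e.1.1, e.2))) -/(eword es') h5 size_map -(ltn_add2r 2) sz; lia.
have hp' : paired (l0 :: rcons (map snd es') l1) by rewrite -eword_snd h5 eword_snd.
have [f [fB fo fn fr fT]] := strip_iso oK' n3' n1' h4 glue_oppK glue_lnext3 glue_lnext_neq hs hw ne hp'.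
exists (K r); first exact: hv.
have z0T : z0 \in T' by case: h4 => _ _ _ _ ->; rewrite inE eqxx.
have := in_H_morph (s := RMap M' z0) (s' := RMap G (K r)) fB fo fn fr (simple_in_H h1 h2 h3' z0T).
suff -> : f @: T' = glue_tree t n by [].
apply/setP=> u; have [g gK fK] := fB; rewrite -(fK u) fT.
by rewrite mem_imset //; exact: bij_inj.
Qed.

Lemma glue_in_Agood : Agood n (eword es) l0 l1 -> glue_in t pi (@in_A n).
Proof.
case=> D' [M' [T' [es' [z0 [z1 [h1 h2 h4 h5]]]]]].
have hs := glue_strip h hn sz hpi; have hv := val_glue_root h hn sz.
set K := insubd _ in hs hv; set I := (X in map X es) in hs.
have oK' : involutive (opp M') by case: h1 => -[].
have n3' : forall d, lnext M' (lnext M' (lnext M' d)) = d by case: h1.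
have n1' : forall d, lnext M' d != d by case: h1.
have hw : eword es' = eword (map I es) by rewrite h5 /eword -map_comp.
have ne : 0 < size es' by rewrite -(size_map (fun e => (e.1.1, e.2))) -/(eword es') h5 size_map -(ltn_add2r 2) sz; lia.
have hp' : paired (l0 :: rcons (map snd es') l1) by rewrite -eword_snd h5 eword_snd.
have [f [fB fo fn fr fT]] := strip_iso oK' n3' n1' h4 glue_oppK glue_lnext3 glue_lnext_neq hs hw ne hp'.
exists (K r); first exact: hv.
have z0T : z0 \in T' by case: h4 => _ _ _ _ ->; rewrite inE eqxx.
have hA : in_A n (RMap M' z0) T' by split; [exact (tree_map_in_S h1 z0T)|].
have := in_A_morph (s := RMap M' z0) (s' := RMap G (K r)) fB fo fn fr hA.
suff -> : f @: T' = glue_tree t n by [].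
apply/setP=> u; have [g gK fK] := fB; rewrite -(fK u) fT.
by rewrite mem_imset //; exact: bij_inj.
Qed.

End GlueGood.

(** * Noncrossing label lists *)

(** Both moves insert two equal labels that are adjacent along the boundary, and such insertions
    preserve the absence of crossings. *)
Inductive nclist : seq nat -> Prop :=
| nclist_nil : nclist [::]
| nclist_insert L1 L2 x : x \notin L1 ++ L2 -> nclist (L1 ++ L2) -> nclist (L1 ++ x :: x :: L2).

Lemma nclist_count L x : nclist L -> x \in L -> count_mem x L = 2.
Proof.
move=> hL; elim: hL x => // L1 L2 y hy _ IH x.
have := IH x; move: hy => /count_memPn; rewrite -!has_pred1 !has_count !count_cat /=.
by case: (eqVneq x y) => [->|nxy]; rewrite ?eqxx; lia.
Qed.

Lemma paired_count L : (forall x, x \in L -> 1 < count_mem x L) -> paired L.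
Proof.
move=> h i hi; have := h _ (mem_nth 0 hi); set x := nth 0 L i.
rewrite -{1}(cat_take_drop i L) (drop_nth 0 hi) count_cat /= eqxx => hc.
case: (boolP (x \in take i L)) => [hx|/count_memPn h0].
  have hj : index x (take i L) < i by have := hx; rewrite -index_mem size_take hi.
  have hk : nth 0 L (index x (take i L)) = x by rewrite -(nth_take _ hj) nth_index.
  by move: hj hk; set k := index _ _ => hj hk; exists k; split=> //; lia.
have hx : x \in drop i.+1 L by move: hc; rewrite h0 add0n add1n ltnS -has_count has_pred1.
have hj : index x (drop i.+1 L) < size L - i.+1 by have := hx; rewrite -index_mem size_drop.
have hk : nth 0 L (i.+1 + index x (drop i.+1 L)) = x by rewrite -nth_drop nth_index.
move: hj hk; set k := index _ _ => hj hk; exists (i.+1 + k); split=> //.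
  by rewrite -ltn_subRL.
by rewrite addSn eq_sym neq_ltn ltnS leq_addr.
Qed.

Section InsertTwo.
Variables (L1 L2 : seq nat) (x : nat).
Let s := size L1.
Let L := L1 ++ x :: x :: L2.

Let pos k := if k < s then k else k.+2.

Let nth_pos k : nth 0 L (pos k) = nth 0 (L1 ++ L2) k.
Proof.
rewrite /pos /L !nth_cat -/s; case: (ltnP k s) => hk; first by rewrite hk.
by rewrite ifN; [have -> : k.+2 - s = (k - s).+2 by lia|lia].
Qed.

Let nth_x k : s <= k < s.+2 -> nth 0 L k = x.
Proof.
case/andP=> h1 h2; rewrite /L nth_cat -/s ifN; last by lia.
by have [->|->] : k - s = 0 \/ k - s = 1 by lia.
Qed.

Let posP k : k < size L -> s <= k < s.+2 \/ exists2 k', k' < size (L1 ++ L2) & k = pos k'.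
Proof.
rewrite /L !size_cat /= -/s => hk; case: (ltnP k s) => h1.
  by right; exists k; rewrite /pos ?h1 //; lia.
case: (ltnP k s.+2) => h2; first by left.
by right; exists k.-2; [lia|rewrite /pos ifN; lia].
Qed.

Let pos_size k : k < size (L1 ++ L2) -> pos k < size L.
Proof. by rewrite /L /pos !size_cat /= -/s; case: (ltnP k s); lia. Qed.

Hypothesis hx : x \notin L1 ++ L2.

Let nth_neq k : k < size (L1 ++ L2) -> nth 0 (L1 ++ L2) k != x.
Proof. by move=> hk; apply: contraNneq hx => <-; exact: mem_nth. Qed.

Lemma insert_partner :
  (forall i, i < size (L1 ++ L2) -> exists j, [/\ j < size (L1 ++ L2), j != i,
     nth 0 (L1 ++ L2) j = nth 0 (L1 ++ L2) i &
     forall k, k < size (L1 ++ L2) -> nth 0 (L1 ++ L2) k = nth 0 (L1 ++ L2) i -> k = i \/ k = j]) ->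
  forall i, i < size L -> exists j, [/\ j < size L, j != i, nth 0 L j = nth 0 L i &
     forall k, k < size L -> nth 0 L k = nth 0 L i -> k = i \/ k = j].
Proof.
move=> IH i /posP[hi|[i' hi' ->]].
  have sL : size L = size (L1 ++ L2) + 2 by rewrite /L !size_cat /=; lia.
  have sg : s <= size (L1 ++ L2) by rewrite size_cat /s; lia.
  exists (s + s.+1 - i); split; [lia|lia| |]; first by rewrite !nth_x //; lia.
  move=> k /posP[hk _|[k' hk' ->]]; first by lia.
  by rewrite nth_pos nth_x // => /eqP; rewrite (negbTE (nth_neq hk')).
have [j [h1 h2 h3 h4]] := IH _ hi'; exists (pos j); split.
- exact: pos_size.
- by move: h2; rewrite /pos; case: (ltnP j s); case: (ltnP i' s); lia.
- by rewrite !nth_pos.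
move=> k /posP[hk|[k' hk' ->]].
  by rewrite nth_x // nth_pos => /esym/eqP; rewrite (negbTE (nth_neq hi')).
by rewrite !nth_pos => /(h4 _ hk')[] ->; [left|right].
Qed.

Lemma insert_noncrossing :
  (forall a b c d, a < b -> b < c -> c < d -> d < size (L1 ++ L2) ->
    nth 0 (L1 ++ L2) a = nth 0 (L1 ++ L2) c -> nth 0 (L1 ++ L2) b = nth 0 (L1 ++ L2) d ->
    nth 0 (L1 ++ L2) a = nth 0 (L1 ++ L2) b) ->
  forall a b c d, a < b -> b < c -> c < d -> d < size L ->
    nth 0 L a = nth 0 L c -> nth 0 L b = nth 0 L d -> nth 0 L a = nth 0 L b.
Proof.
move=> IH a b c d ab bc cd dL.
have [aL bL cL] : [/\ a < size L, b < size L & c < size L] by split; lia.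
have ne k k' : s <= k < s.+2 -> k' < size (L1 ++ L2) -> nth 0 L k <> nth 0 L (pos k').
  by move=> hk hk'; rewrite nth_x // nth_pos => /esym/eqP; rewrite (negbTE (nth_neq hk')).
case: (posP aL) => [ha|[a' ha ea]]; case: (posP cL) => [hc|[c' hc ec]].
- by lia.
- by rewrite ec => /(ne _ _ ha hc).
- by rewrite ea => /esym/(ne _ _ hc ha).
case: (posP bL) => [hb|[b' hb eb]]; case: (posP dL) => [hd|[d' hd ed]].
- by lia.
- by rewrite ed => _ /(ne _ _ hb hd).
- by rewrite eb => _ /esym/(ne _ _ hd hb).
have mono p q : pos p < pos q -> p < q by rewrite /pos; case: (ltnP p s); case: (ltnP q s); lia.
subst a b c d; rewrite !nth_pos; apply: IH => //; exact: mono.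
Qed.

End InsertTwo.

Lemma nclist_partner L : nclist L -> forall i, i < size L -> exists j, [/\ j < size L, j != i,
  nth 0 L j = nth 0 L i & forall k, k < size L -> nth 0 L k = nth 0 L i -> k = i \/ k = j].
Proof. by elim=> // L1 L2 x hx _; exact: insert_partner. Qed.

Lemma nclist_noncrossing L : nclist L -> forall a b c d, a < b -> b < c -> c < d -> d < size L ->
  nth 0 L a = nth 0 L c -> nth 0 L b = nth 0 L d -> nth 0 L a = nth 0 L b.
Proof. by elim=> // L1 L2 x hx _; exact: insert_noncrossing. Qed.

Lemma nclist_pairing L n : nclist L -> size L = n.*2 ->
  exists pi : {perm 'I_n.*2}, noncrossing_pairing pi /\ pairing_of L pi.
Proof.
move=> hL sL; have hp := nclist_partner hL; have hc := nclist_noncrossing hL.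
pose f (i : 'I_n.*2) := odflt i [pick j | (j != i) && (nth 0 L j == nth 0 L i)].
have fP i : [/\ f i != i, nth 0 L (f i) = nth 0 L i &
    forall k : 'I_n.*2, nth 0 L k = nth 0 L i -> k = i \/ k = f i].
  have [|j [h1 h2 h3 h4]] := hp i; first by rewrite sL.
  rewrite sL in h1; rewrite /f; case: pickP => [j' /andP[/= g1 /eqP g2]|/(_ (Ordinal h1))]; last first.
    by rewrite /= -val_eqE /= h2 h3 eqxx.
  split=> // k; rewrite sL in h4 => /(h4 _ (ltn_ord k))[hk|hk]; first by left; exact: val_inj.
  right; apply: val_inj; rewrite /= hk.
  case: (h4 _ (ltn_ord j') g2) => [e|//]; by rewrite -val_eqE /= e eqxx in g1.
have fK : involutive f.
  move=> i; have [h1 h2 h3] := fP i; have [g1 g2 g3] := fP (f i).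
  by case: (g3 i (esym h2)) => // e; rewrite {2}e eqxx in h1.
exists (perm (inv_inj fK)); split.
  split; first by move=> i; rewrite !permE fK.
    by move=> i; rewrite permE; case: (fP i).
  move=> a b; rewrite !permE => -[h1 h2 h3].
  have [_ ea _] := fP a; have [_ eb _] := fP b.
  have := hc _ _ _ _ h1 h2 h3 _ (esym ea) (esym eb); rewrite sL => /(_ (ltn_ord _)) E.
  have [_ _ g] := fP a; case: (g b (esym E)) => e; first by rewrite e ltnn in h1.
  by rewrite -e ltnn in h2.
move=> i j; rewrite permE; have [_ h2 h3] := fP i; apply/eqP/orP => [/esym/h3[]->|[]/eqP->//].
  by left.
by right.
Qed.

(** * Words obtained by the two moves *)

Section Words.
Variables l0 l1 : nat.
Hypothesis ne : l0 != l1.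

Definition wlab (W : seq (bool * nat)) : seq nat := l0 :: rcons (map snd W) l1.

Inductive Hword : nat -> seq (bool * nat) -> Prop :=
| Hword_base : Hword 2 [:: (true, l1); (false, l0)]
| Hword_insert n u a b v x l : Hword n (u ++ a :: b :: v) -> l \notin wlab (u ++ a :: b :: v) ->
    Hword n.+1 (u ++ a :: (x, l) :: (x, l) :: b :: v).

Inductive Aword : nat -> seq (bool * nat) -> Prop :=
| Aword_base : Aword 2 [:: (true, l1); (false, l0)]
| Aword_insert n u y k v l : Aword n (u ++ (y, k) :: v) -> l \notin wlab (u ++ (y, k) :: v) ->
    Aword n.+1 (u ++ (~~ y, l) :: (y, k) :: (~~ y, l) :: v).

Lemma Hword_good n W : Hword n W -> Hgood n W l0 l1.
Proof. by elim=> [|*]; [exact: Hgood_base|exact: Hgood_insert]. Qed.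

Lemma Aword_good n W : Aword n W -> Agood n W l0 l1.
Proof. by elim=> [|*]; [exact: Agood_base|exact: Agood_insert]. Qed.

Lemma qlab_perm W : perm_eq (qlab W l0 l1) (wlab W).
Proof.
have h : perm_eq ([seq p.2 | p <- W & ~~ p.1] ++ [seq p.2 | p <- W & p.1]) (map snd W).
  by rewrite -map_cat; apply: perm_map; rewrite perm_catC perm_filterC.
rewrite /qlab /wlab perm_cons perm_sym perm_rcons perm_sym -cat1s perm_catCA cat1s perm_cons.
by apply: perm_trans h; rewrite perm_cat2l perm_rev.
Qed.

Lemma mem_qlab W l : (l \in qlab W l0 l1) = (l \in wlab W).
Proof. exact: perm_mem (qlab_perm W) l. Qed.

(** The letters of [w] lie on the other boundary, so the two copies of [l] are adjacent in [qlab].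
    Both moves have this form, with [w] empty or a single letter. *)
Lemma qlab_insert2 u v w x l : l \notin wlab (u ++ w ++ v) -> all (fun p => p.1 == ~~ x) w ->
  nclist (qlab (u ++ w ++ v) l0 l1) -> nclist (qlab (u ++ (x, l) :: w ++ (x, l) :: v) l0 l1).
Proof.
rewrite -mem_qlab /qlab => fr hw.
have f0 : [seq p <- w | p.1 == x] = [::].
  by elim: w hw {fr} => //= p w IH /andP[/eqP -> /IH ->]; case: (x).
case: x f0 hw fr => f0 hw; rewrite !filter_cat /= !filter_cat /= !map_cat /= !map_cat.
  have -> : [seq p <- w | p.1] = [::] by rewrite -f0; apply: eq_filter => p; case: p.1.
  rewrite /= !rev_cat /= !rev_cons -!cats1 -!catA /=.
  set A := map snd _; set B := map snd _; set C := map snd _; set D := rev _; set E := rev _.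
  have E1 X : l0 :: A ++ B ++ C ++ l1 :: D ++ X = (l0 :: A ++ B ++ C ++ l1 :: D) ++ X.
    by rewrite /= -!catA.
  by rewrite !E1 => fr hn; apply: nclist_insert.
have -> : [seq p <- w | ~~ p.1] = [::] by rewrite -f0; apply: eq_filter => p; case: p.1.
rewrite /= -!catA /=.
set A := map snd _; set B := map snd _; set C := rev _.
have E1 X : l0 :: A ++ X = (l0 :: A) ++ X by [].
by rewrite !E1 => fr hn; apply: nclist_insert.
Qed.

Lemma qlab_base : nclist (qlab [:: (true, l1); (false, l0)] l0 l1).
Proof.
apply: (nclist_insert (L1 := [::]) (L2 := [:: l1; l1])); first by rewrite !inE negb_or ne.
apply: (nclist_insert (L1 := [::]) (L2 := [::])) => //; exact: nclist_nil.
Qed.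

Lemma Hword_nclist n W : Hword n W -> nclist (qlab W l0 l1).
Proof.
elim=> [|{}n u a b v x l _ IH fr]; first exact: qlab_base.
by have := @qlab_insert2 (u ++ [:: a]) (b :: v) [::] x l; rewrite -!catA /=; apply.
Qed.

Lemma Aword_nclist n W : Aword n W -> nclist (qlab W l0 l1).
Proof.
elim=> [|{}n u y k v l _ IH fr]; first exact: qlab_base.
by apply: (@qlab_insert2 u v [:: (y, k)]) => //=; rewrite negbK eqxx.
Qed.

Lemma Hword_size n W : Hword n W -> size W + 2 = n.*2 /\ 1 < n.
Proof. by elim=> [|{}n u a b v x l _ []] //; rewrite !size_cat /=; lia. Qed.

Lemma nclist_wlab_paired W : nclist (qlab W l0 l1) -> paired (wlab W).
Proof.
move=> h; apply: paired_count => x; rewrite -(perm_mem (qlab_perm W)) => hx.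
by rewrite -(seq.permP (qlab_perm W)) (nclist_count h).
Qed.

End Words.

(** * Loops and label colourings *)

Section Loops.
Variables (n : nat) (LH LA : seq nat) (piH piA : {perm 'I_n.*2}) (cH cA : nat -> nat) (k : nat).
Hypothesis sH : size LH = n.*2.
Hypothesis sA : size LA = n.*2.
Hypothesis hH : pairing_of LH piH.
Hypothesis hA : pairing_of LA piA.

Definition compatible (gH gA : nat -> nat) := all (fun p => gH p.1 == gA p.2) (zip LH LA).

Hypothesis hc : compatible cH cA.
Hypothesis hu : forall gH gA, compatible gH gA ->
  {in LH &, forall l l', cH l = cH l' -> gH l = gH l'}.

Let e : rel 'I_n.*2 := [rel i j | (j == piH i) || (j == piA i)].
Let c (i : 'I_n.*2) := cH (nth 0 LH i).

Let compatE gH gA : reflect (forall i : 'I_n.*2, gH (nth 0 LH i) = gA (nth 0 LA i)) (compatible gH gA).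
Proof.
have sz : size (zip LH LA) = n.*2 by rewrite size1_zip // sH sA.
apply: (iffP (all_nthP (0, 0))) => [h i|h i hi].
  by have := h i; rewrite sz => /(_ (ltn_ord i)); rewrite nth_zip ?sH ?sA // => /eqP.
rewrite sz in hi; rewrite nth_zip ?sH ?sA //=; apply/eqP; exact: (h (Ordinal hi)).
Qed.

Let esym_ : symmetric e.
Proof.
move=> i j /=; congr (_ || _).
  by rewrite eq_sym -(inj_eq (@perm_inj _ piH)) (pairing_invol hH).
by rewrite eq_sym -(inj_eq (@perm_inj _ piA)) (pairing_invol hA).
Qed.

Let csym : connect_sym e. Proof. exact: sym_connect_sym. Qed.

Let LH_pi i : nth 0 LH (piH i) = nth 0 LH i.
Proof. by apply/esym/eqP; rewrite hH eqxx orbT. Qed.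

Let LA_pi i : nth 0 LA (piA i) = nth 0 LA i.
Proof. by apply/esym/eqP; rewrite hA eqxx orbT. Qed.

Let connect_c i j : connect e i j = (c i == c j).
Proof.
apply/idP/eqP => [/connectP[p]|E].
  elim: p i => [|x p IH] i /= => [_ ->//|/andP[h hp] /(IH _ hp) <-].
  rewrite /c; case/orP: h => /eqP ->; first by rewrite LH_pi.
  by move/compatE: hc => hc'; rewrite !hc' LA_pi.
(* The colouring by loops: a label gets the root of the component of a position carrying it. *)
pose g L l : nat := fingraph.root e (odflt i [pick i : 'I_n.*2 | nth 0 L i == l]).
have gE L pi (hL : pairing_of L pi) (hpi : forall i, connect e i (pi i)) (l : 'I_n.*2) : g L (nth 0 L l) = fingraph.root e l.
  rewrite /g; case: pickP => [x /= hx|/(_ l)]; last by rewrite eqxx.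
  congr nat_of_ord; apply/eqP; rewrite root_connect //.
  by have := hL x l; rewrite hx => /esym/orP[]/eqP ->; [exact: connect0|exact: hpi].
have cHi x : connect e x (piH x) by apply: connect1; rewrite /e /= eqxx.
have cAi x : connect e x (piA x) by apply: connect1; rewrite /e /= eqxx orbT.
have hg : compatible (g LH) (g LA) by apply/compatE => x; rewrite (gE _ _ hH cHi) (gE _ _ hA cAi).
have := hu hg (mem_nth 0 _) (mem_nth 0 _) E; rewrite !sH => /(_ (ltn_ord _) (ltn_ord _)).
rewrite !(gE _ _ hH cHi) => /val_inj/eqP; by rewrite root_connect.
Qed.

(** A compatible colouring is constant on loops. The loops themselves give a compatible colouring,
    and [hu] says that [cH] separates whatever a compatible colouring separates. The colours used
    are therefore in bijection with the loops. *)
Lemma loops_colours : loops piH piA = size (undup (map cH LH)).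
Proof.
rewrite /loops /n_comp_mem -/e.
have -> : #|[predI roots e & predT]| = size [seq c i | i <- enum (roots e)].
  by rewrite size_map -cardE; apply: eq_card => x; rewrite !inE andbT.
apply: perm_size; apply: uniq_perm.
- rewrite map_inj_in_uniq ?enum_uniq // => x y; rewrite !mem_enum => /eqP rx /eqP ry E.
  by rewrite -rx -ry; apply/eqP; rewrite root_connect // connect_c; apply/eqP.
- exact: undup_uniq.
move=> x; rewrite mem_undup; apply/mapP/mapP => [[i _ ->]|[l hl ->]].
  by exists (nth 0 LH i) => //; apply: mem_nth; rewrite sH.
have hi : index l LH < n.*2 by rewrite -sH index_mem.
exists (fingraph.root e (Ordinal hi)); first by rewrite mem_enum; exact: roots_root.
rewrite /c; have := connect_root e (Ordinal hi); rewrite connect_c /c /= nth_index // => /eqP.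
by [].
Qed.

End Loops.

(** * Meanders from words *)

Lemma word_eq (W W' : seq (bool * nat)) : map fst W = map fst W' ->
    [seq p.2 | p <- W & ~~ p.1] = [seq p.2 | p <- W' & ~~ p.1] ->
    [seq p.2 | p <- W & p.1] = [seq p.2 | p <- W' & p.1] ->
  W = W'.
Proof.
elim: W W' => [|[x k] W IH] [|[y k'] W'] //= [<- E].
by case: x => /= E1 E2; [case: E2 => -> E2|case: E1 => -> E1]; rewrite (IH _ E).
Qed.

Lemma size_letters (W W' : seq (bool * nat)) (q : pred bool) : map fst W = map fst W' ->
  size [seq p.2 | p <- W & q p.1] = size [seq p.2 | p <- W' & q p.1].
Proof.
move=> E; have h V : size [seq p.2 | p <- V & q p.1] = count q (map fst V).
  by rewrite size_map size_filter count_map.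
by rewrite !h E.
Qed.

Section MeanderWords.
Variables l0 l1 : nat.

Definition meander_words (n : nat) (WH WA : seq (bool * nat))
    (p : set numbered_rmap * {perm 'I_n.*2} * {perm 'I_n.*2}) : Prop :=
  exists (k : nat) (M : cmap 'I_k) r es z,
  [/\ ostrip M r es z, map fst (eword es) = map fst WH,
      p.1.1 = rclass (existT (fun k => rmap 'I_k) k (RMap M r)),
      pairing_of (qlab WH l0 l1) p.1.2 & pairing_of (qlab WA l0 l1) p.2].

(** The two words have the same top and bottom letters, so a single outerplanar strip carries both
    pairings. *)
Lemma meander_of_words n WH WA : l0 != l1 -> Hword l0 l1 n WH -> Aword l0 l1 n WA ->
  map fst WH = map fst WA -> exists p, meander_set n p /\ meander_words WH WA p.
Proof.
move=> ne hH hA E.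
have [sz hn] := Hword_size ne hH.
have szA : size WA = size WH by rewrite -(size_map fst) -E size_map.
have [k [M [r [es [z [h1 h2]]]]]] := ostrip_exists WH.
have szs : size es + 2 = n.*2 by rewrite -sz -h2 size_map.
have [es' [h3 h4]] : exists es', map fst es' = map fst es /\ eword es' = WA.
  by apply: relabel; rewrite h2.
have szs' : size es' + 2 = n.*2 by rewrite -sz -szA -h4 size_map.
have h1' := ostrip_relabel h3 h1.
have cH := Hword_nclist ne hH; have cA := Aword_nclist ne hA.
have [piH [ncH pH]] := nclist_pairing cH (etrans (size_qlab _ _ _) sz).
have [piA [ncA pA]] := nclist_pairing cA (etrans (size_qlab _ _ _) (etrans (congr1 (addn^~ 2) szA) sz)).
exists (rclass (existT (fun k => rmap 'I_k) k (RMap M r)), piH, piA); split; last first.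
  by exists k, M, r, es, z; rewrite h2.
exists (existT (fun k => rmap 'I_k) k (RMap M r)); split=> //=.
- by rewrite -szs; exact: ostrip_outerplanar h1.
- apply: (glue_in_Hgood h1 hn szs); rewrite ?h2 //; last exact: Hword_good.
  by have := nclist_wlab_paired cH; rewrite /wlab -h2 eword_snd.
- apply: (glue_in_Agood h1' hn szs'); rewrite ?h4 //; last exact: Aword_good.
  by have := nclist_wlab_paired cA; rewrite /wlab -h4 eword_snd.
Qed.

(** The pairing tells which positions of [qlab] carry equal labels, so the two words differ by a
    renaming. *)
Lemma pairing_relabel m (W W' : seq (bool * nat)) (pi : {perm 'I_m}) :
    size W + 2 = m -> map fst W = map fst W' ->
    pairing_of (qlab W l0 l1) pi -> pairing_of (qlab W' l0 l1) pi ->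
  exists2 phi, {in map snd W &, injective phi} & W' = [seq (p.1, phi p.2) | p <- W].
Proof.
move=> sz E h h'.
have sz' : size W' + 2 = m by rewrite -sz -(size_map fst) -E size_map.
pose Q := qlab W l0 l1; pose Q' := qlab W' l0 l1.
have sQ : size Q = m by rewrite size_qlab.
have sQ' : size Q' = m by rewrite size_qlab.
have pat i j : i < m -> j < m -> (nth 0 Q i == nth 0 Q j) = (nth 0 Q' i == nth 0 Q' j).
  by move=> hi hj; rewrite (h (Ordinal hi) (Ordinal hj)) (h' (Ordinal hi) (Ordinal hj)).
pose phi l := nth 0 Q' (index l Q).
have hin l : l \in Q -> index l Q < m by rewrite -sQ index_mem.
have EQ : Q' = map phi Q.
  apply: (@eq_from_nth _ 0); rewrite ?size_map ?sQ // => i; rewrite sQ' => hi.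
  rewrite (nth_map 0) ?sQ // /phi; apply/esym/eqP; rewrite -pat //; last by apply: hin; rewrite mem_nth ?sQ.
  by rewrite nth_index // mem_nth ?sQ.
exists phi.
  have sub : {subset map snd W <= Q}.
    by move=> l hl; rewrite /Q mem_qlab inE mem_rcons inE hl !orbT.
  move=> l l' /sub hl /sub hl' /eqP; rewrite /phi -pat ?hin //.
  by rewrite !nth_index // => /eqP.
have Em : map fst W = map fst [seq (p.1, phi p.2) | p <- W] by rewrite -map_comp.
move: EQ; rewrite /Q /Q' /qlab /= => -[_ /eqP].
rewrite map_cat /= map_rev eqseq_cat ?size_map; last first.
  by have := @size_letters W' W negb (esym E); rewrite !size_map.
move=> /andP[/eqP E1 /eqP[_ E2']].
have E2 := can_inj revK E2'.
apply: word_eq; first by rewrite -E -Em.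
  by rewrite E1 filter_map -!map_comp.
by rewrite E2 filter_map -!map_comp.
Qed.

(** The last letters are assumed equal because the map does not determine them: both free sides of
    the last triangle are on the outer face. *)
Lemma meander_words_inj n WH WA WH' WA' p :
    size WH + 2 = n.*2 -> size WH' + 2 = n.*2 ->
    map fst WH = map fst WA -> map fst WH' = map fst WA' ->
    last false (map fst WH) = last false (map fst WH') ->
    @meander_words n WH WA p -> meander_words WH' WA' p ->
  (exists2 phi, {in map snd WH &, injective phi} & WH' = [seq (p.1, phi p.2) | p <- WH]) /\
  (exists2 phi, {in map snd WA &, injective phi} & WA' = [seq (p.1, phi p.2) | p <- WA]).
Proof.
move=> sz sz' E E' hl [k [M [r [es [z [h1 h2 h3 h4 h5]]]]]] [k' [M' [r' [es' [z' [g1 g2 g3 g4 g5]]]]]].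
have iso : risomorphic (RMap M r) (RMap M' r').
  have : rclass (existT (fun k => rmap 'I_k) k (RMap M r)) (existT (fun k => rmap 'I_k) k' (RMap M' r')).
    by rewrite -h3 g3; exact: risomorphic_refl.
  by [].
have [s1 s2] := ostrip_word h1 g1 iso.
have e1 V : [seq e.1.1 | e <- V : seq (entry 'I_k)] = map fst (eword V) by rewrite -map_comp.
have e2 V : [seq e.1.1 | e <- V : seq (entry 'I_k')] = map fst (eword V) by rewrite -map_comp.
have EW : map fst WH = map fst WH'.
  apply: (@eq_from_nth _ false); first by rewrite !size_map; lia.
  move=> i; rewrite size_map => hi.
  have [hi'|hi'] : i.+1 < size WH \/ i = (size WH).-1 by lia.
    by have := s2 i; rewrite e1 e2 h2 g2 -(size_map (fun e => (e.1.1, e.2))) -(size_map fst) -/(eword es) h2 size_map; apply.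
  move: hl; rewrite -!nth_last !size_map hi'; have -> // : size WH' = size WH by lia.
split; first exact: (pairing_relabel sz EW h4 g4).
apply: (pairing_relabel _ _ h5 g5); last by rewrite -E -E'.
by rewrite -sz; congr (_ + 2); rewrite -(size_map fst) -E size_map.
Qed.

End MeanderWords.

(** * Counting loops of labelled words *)

(** The hypotheses of [loops_colours] in terms of the set of pairs of labels found at a common
    position: a compatible colouring with [k] colours that is the finest one. *)
Definition certified (S : seq (nat * nat)) (k : nat) : Prop :=
  exists cH cA : nat -> nat, [/\ {in S, forall p, cH p.1 = cA p.2},
    forall gH gA : nat -> nat, {in S, forall p, gH p.1 = gA p.2} ->
      {in S &, forall p q, cH p.1 = cH q.1 -> gH p.1 = gH q.1}
    & size (undup [seq cH p.1 | p <- S]) = k].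

Lemma size_undup_mem (T : eqType) (s s' : seq T) : s =i s' -> size (undup s) = size (undup s').
Proof.
move=> h; apply: perm_size; apply: uniq_perm; rewrite ?undup_uniq // => x.
by rewrite !mem_undup.
Qed.

Lemma certified_mem S S' k : S =i S' -> certified S k -> certified S' k.
Proof.
move=> E [cH [cA [h1 h2 h3]]]; exists cH, cA; split.
- by move=> p; rewrite -E; exact: h1.
- move=> gH gA hg p q; rewrite -!E; apply: (h2 gH gA) => x; rewrite E; exact: hg.
- rewrite -h3; apply: size_undup_mem => x; exact/esym/eq_mem_map.
Qed.

(* [KH] and [KA] tell which fresh labels belong to the new loop.              *)
Lemma certified_step S N h a fr (KH KA : pred nat) k :
    certified ((h, a) :: S) k -> all (fun p => (p.1 < fr) && (p.2 < fr)) ((h, a) :: S) ->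
    let kH l := (fr <= l) && KH l in let kA l := (fr <= l) && KA l in
    {in N, forall p, [/\ (p.1 < fr -> p.1 = h), (p.2 < fr -> p.2 = a) & kH p.1 = kA p.2]} ->
    (exists2 p, p \in N & kH p.1) -> (exists2 p, p \in N & ~~ kH p.1) ->
    (forall gH gA : nat -> nat, {in N, forall p, gH p.1 = gA p.2} ->
       gH h = gA a /\ {in N &, forall p q, kH p.1 = kH q.1 -> gH p.1 = gH q.1} /\
       {in N, forall p, ~~ kH p.1 -> gH p.1 = gH h}) ->
  certified (N ++ S) k.+1.
Proof.
move=> [cH [cA [h1 h2 h3]]] /allP hb kH kA hN [pK pKN pKk] [pO pON pOk] hg.
pose V := [seq cH p.1 | p <- (h, a) :: S].
(* Larger than every colour in [V]; this is the colour of the new loop. *)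
pose K := (sumn V).+1.
have KV : K \notin V.
  apply/negP=> hK; have : K <= sumn V; last by rewrite /K; lia.
  by move: hK; elim: (V) => //= x s IH; rewrite inE => /orP[/eqP->|/IH]; lia.
have hin : (h, a) \in (h, a) :: S by exact: mem_head.
have Sin p : p \in S -> p \in (h, a) :: S by move=> hp; rewrite inE hp orbT.
have cha : cH h = cA a := h1 _ hin.
pose cH' l := if l < fr then cH l else if KH l then K else cH h.
pose cA' l := if l < fr then cA l else if KA l then K else cA a.
have cN p : p \in N -> cH' p.1 = if kH p.1 then K else cH h.
  by move=> /hN[g1 _ _]; rewrite /cH' /kH; case: ltnP => // /g1 ->.
have cN' p : p \in N -> cA' p.2 = if kA p.2 then K else cA a.
  by move=> /hN[_ g1 _]; rewrite /cA' /kA; case: ltnP => // /g1 ->.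
have cS p : p \in S -> cH' p.1 = cH p.1 /\ cA' p.2 = cA p.2.
  by move=> /Sin/hb/andP[g1 g2]; rewrite /cH' /cA' g1 g2.
exists cH', cA'; split.
- move=> p; rewrite mem_cat => /orP[hp|hp].
    by rewrite cN // cN' //; have [_ _ ->] := hN _ hp; rewrite cha.
  by have [-> ->] := cS _ hp; apply: h1; exact: Sin.
- move=> gH gA hc.
  have [e1 [e2 e3]] : gH h = gA a /\ {in N &, forall p q, kH p.1 = kH q.1 -> gH p.1 = gH q.1} /\
       {in N, forall p, ~~ kH p.1 -> gH p.1 = gH h}.
    by apply: hg => p hp; apply: hc; rewrite mem_cat hp.
  have hc' : {in (h, a) :: S, forall p, gH p.1 = gA p.2}.
    by move=> p; rewrite inE => /orP[/eqP->//|hp]; apply: hc; rewrite mem_cat hp orbT.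
  have old := h2 _ _ hc'.
  have rep p : p \in N ++ S -> (cH' p.1 = K /\ gH p.1 = gH pK.1) \/
      exists q, [/\ q \in (h, a) :: S, cH' p.1 = cH q.1 & gH p.1 = gH q.1].
    rewrite mem_cat => /orP[hp|hp]; last first.
      by right; exists p; have [-> _] := cS _ hp; split=> //; exact: Sin.
    case: (boolP (kH p.1)) => hk; first by left; rewrite cN // hk; split=> //; apply: e2; rewrite ?hk ?pKk.
    by right; exists (h, a); rewrite cN // (negbTE hk); split=> //; exact: e3.
  have Kne q : q \in (h, a) :: S -> cH q.1 <> K.
    by move=> hq E; move: KV; rewrite -E; rewrite map_f.
  move=> p q /rep[[-> ->]|[p' [hp -> ->]]] /rep[[-> ->]|[q' [hq -> ->]]] //.
  + by move/esym/Kne.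
  + by move/Kne.
  + exact: old.
- rewrite -[in RHS]h3 -/V.
  have -> : size (undup [seq cH' p.1 | p <- N ++ S]) = size (undup (K :: V)).
    apply: size_undup_mem => x; apply/mapP/idP => [[p + ->]|].
      rewrite mem_cat => /orP[hp|hp].
        by rewrite cN //; case: ifP => _; rewrite !inE eqxx ?orbT.
      have [-> _] := cS _ hp; rewrite inE; apply/orP; right.
      by apply: (map_f (fun p : nat * nat => cH p.1)); exact: Sin.
    rewrite !inE => /or3P[/eqP->|/eqP->|/mapP[p hp ->]].
    - by exists pK; rewrite ?mem_cat ?pKN // cN // pKk.
    - by exists pO; rewrite ?mem_cat ?pON // cN // (negbTE pOk).
    - by exists p; rewrite ?mem_cat ?hp ?orbT //; have [-> _] := cS _ hp.
  by rewrite /= (negbTE KV).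
Qed.

(** * A family of meanders *)

(* A letter [(x, h, a)] lies on the top if [x], and carries its labels for    *)
(* the hierarchical and the Apollonian gluing.                                  *)
Definition letter := (bool * nat * nat)%type.

Definition hword (E : seq letter) : seq (bool * nat) := [seq (l.1.1, l.1.2) | l <- E].
Definition aword (E : seq letter) : seq (bool * nat) := [seq (l.1.1, l.2) | l <- E].

(** The two ends of the strip carry the labels 0 and 1 in both words. *)
Definition label_pairs (E : seq letter) : seq (nat * nat) :=
  (0, 0) :: (1, 1) :: [seq (l.1.2, l.2) | l <- E].

Definition good (n k : nat) (E : seq letter) (fr : nat) : Prop :=
  [/\ Hword 0 1 n (hword E), Aword 0 1 n (aword E), certified (label_pairs E) k
    & all (fun p => (p.1 < fr) && (p.2 < fr)) (label_pairs E)].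

(* Each expansion is made of two insertions [x x] next to the letter for the  *)
(* labels [h] and of two replacements [y -> x y x] for the labels [a]. Only     *)
(* three of the five letters, those whose partner for [a] precedes them, will   *)
(* be expanded again.                                                           *)
Definition expansion (r : option bool) (l : letter) (fr : nat) : seq letter :=
  let: (y, h, a) := l in let x := ~~ y in
  match r with
  | None => [:: (x, fr, fr); (x, fr, fr.+1); (y, h, a); (x, fr.+2, fr.+1); (x, fr.+2, fr)]
  | Some true => [:: (y, h, fr.+1); (x, fr, fr); (y, fr.+2, fr.+1); (y, fr.+2, a); (x, fr, fr)]
  | Some false => [:: (x, fr, fr); (y, fr.+2, a); (y, fr.+2, fr.+1); (x, fr, fr); (y, h, fr.+1)]
  end.

Definition below (m : nat) (W : seq (bool * nat)) := all (fun p => p.2 < m) W.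

Lemma fresh_below W m : 1 < m -> below m W -> m \notin wlab 0 1 W.
Proof.
move=> hm /allP h; rewrite /wlab inE mem_rcons inE !negb_or; apply/and3P; split; try by lia.
by apply/negP=> /mapP[p /h + E]; rewrite -E ltnn.
Qed.

Lemma Hword_insert_at n u v x l : Hword 0 1 n (u ++ v) -> u != [::] -> v != [::] ->
  1 < l -> below l (u ++ v) -> Hword 0 1 n.+1 (u ++ (x, l) :: (x, l) :: v).
Proof.
case/lastP: u => // u a; case: v => // b v; rewrite !cat_rcons => h _ _ hl hb.
by apply: Hword_insert => //; exact: fresh_below.
Qed.

Lemma Aword_insert_at n u v y k l : Aword 0 1 n (u ++ (~~ y, k) :: v) ->
  1 < l -> below l (u ++ (~~ y, k) :: v) -> Aword 0 1 n.+1 (u ++ (y, l) :: (~~ y, k) :: (y, l) :: v).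
Proof.
by move=> h hl hb; have := Aword_insert h (fresh_below hl hb); rewrite negbK.
Qed.

Lemma Hword_expansion n u v r y h a fr : Hword 0 1 n (hword u ++ (y, h) :: hword v) ->
    u != [::] -> v != [::] -> 1 < fr -> below fr (hword u ++ (y, h) :: hword v) ->
  Hword 0 1 n.+2 (hword u ++ hword (expansion r (y, h, a) fr) ++ hword v).
Proof.
move=> hH nu nv fr1 hb.
have nu' : hword u != [::] by case: (u) nu.
have nv' : hword v != [::] by case: (v) nv.
have up m W : fr <= m -> below fr W -> below m W.
  by move=> hm; apply: sub_all => p /leq_trans; apply.
have ne s (b : bool * nat) : hword u ++ b :: s != [::] by case: (hword u).
move: (hb); rewrite /below all_cat /= => /and3P[bu bh bv].
have bu2 : below fr.+2 (hword u) by apply: up bu; lia.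
have bv2 : below fr.+2 (hword v) by apply: up bv; lia.
case: r => [[]|] /=.
- have h1 : Hword 0 1 n.+1 ((hword u ++ [:: (y, h)]) ++ (~~ y, fr) :: (~~ y, fr) :: hword v).
    by apply: Hword_insert_at; rewrite // -?catA.
  have := @Hword_insert_at n.+1 (hword u ++ [:: (y, h); (~~ y, fr)]) ((~~ y, fr) :: hword v) y fr.+2.
  rewrite -!catA /=; apply => //; first by move: h1; rewrite -catA.
  by rewrite /below all_cat /= -!/(below _ _) bu2 bv2 /=; lia.
- have h1 := Hword_insert_at (~~ y) (l := fr) hH nu' isT fr1 hb.
  have := @Hword_insert_at n.+1 (hword u ++ [:: (~~ y, fr)]) ((~~ y, fr) :: (y, h) :: hword v) y fr.+2.
  rewrite -!catA /=; apply => //.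
  by rewrite /below all_cat /= -!/(below _ _) bu2 bv2 /=; lia.
- have h1 := Hword_insert_at (~~ y) (l := fr) hH nu' isT fr1 hb.
  have := @Hword_insert_at n.+1 (hword u ++ [:: (~~ y, fr); (~~ y, fr); (y, h)]) (hword v) (~~ y) fr.+2.
  rewrite -!catA /=; apply => //.
  by rewrite /below all_cat /= -!/(below _ _) bu2 bv2 /=; lia.
Qed.

Lemma Aword_expansion n u v r y h a fr : Aword 0 1 n (aword u ++ (y, a) :: aword v) ->
    1 < fr -> below fr (aword u ++ (y, a) :: aword v) ->
  Aword 0 1 n.+2 (aword u ++ aword (expansion r (y, h, a) fr) ++ aword v).
Proof.
move=> hA fr1 hb.
have up m W : fr <= m -> below fr W -> below m W.
  by move=> hm; apply: sub_all => p /leq_trans; apply.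
move: (hb); rewrite /below all_cat /= => /and3P[bu bh bv].
have h1 : Aword 0 1 n.+1 (aword u ++ (~~ y, fr) :: (y, a) :: (~~ y, fr) :: aword v).
  by have := @Aword_insert_at n (aword u) (aword v) (~~ y) a fr; rewrite negbK; apply.
have bu' : below fr.+1 (aword u) by apply: up bu.
have bv' : below fr.+1 (aword v) by apply: up bv.
have a' : a < fr.+1 by lia.
have fr1' : 1 < fr.+1 by lia.
case: r => [[]|] /=.
- apply: (@Aword_insert_at n.+1 (aword u) ((y, a) :: (~~ y, fr) :: aword v) y fr fr.+1) => //.
  by rewrite /below all_cat /= -!/(below _ _) bu' bv' a' ltnSn.
- have := @Aword_insert_at n.+1 (aword u ++ [:: (~~ y, fr); (y, a)]) (aword v) y fr fr.+1.
  rewrite -!catA /=; apply => //.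
  by rewrite /below all_cat /= -!/(below _ _) bu' bv' a' ltnSn.
- have := @Aword_insert_at n.+1 (aword u ++ [:: (~~ y, fr)]) ((~~ y, fr) :: aword v) (~~ y) a fr.+1.
  rewrite negbK -!catA /=; apply => //.
  by rewrite /below all_cat /= -!/(below _ _) bu' bv' a' ltnSn.
Qed.

Lemma good_step n k u l v fr r : u != [::] -> v != [::] -> good n k (u ++ l :: v) fr ->
  good n.+2 k.+1 (u ++ expansion r l fr ++ v) (fr + 4).
Proof.
case: l => -[y h] a nu nv [hH hA hc hb].
pose P (w : seq letter) := [seq (l.1.2, l.2) | l <- w].
pose S := (0, 0) :: (1, 1) :: P u ++ P v.
have pS w : label_pairs (u ++ w ++ v) =i P w ++ S.
  move=> x; rewrite /label_pairs /P /S !map_cat !inE !mem_cat !inE !mem_cat.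
  by do !case: (_ \in _); do ?case: (_ == _).
have pS1 : label_pairs (u ++ (y, h, a) :: v) =i (h, a) :: S := pS [:: (y, h, a)].
have hb' : all (fun p => (p.1 < fr) && (p.2 < fr)) ((h, a) :: S) by rewrite -(eq_all_r pS1).
have [hfr afr] : h < fr /\ a < fr by move: hb' => /= /andP[/andP[-> ->] _].
have fr1 : 1 < fr by move: hb' => /= /and4P[_ _ /andP[-> _]].
have bE : all (fun l : letter => (l.1.2 < fr) && (l.2 < fr)) (u ++ (y, h, a) :: v).
  by move: hb => /= /andP[_ /andP[_]]; rewrite all_map.
have bH : below fr (hword (u ++ (y, h, a) :: v)).
  by rewrite /below /hword all_map; apply: sub_all bE => q /andP[].
have bA : below fr (aword (u ++ (y, h, a) :: v)).
  by rewrite /below /aword all_map; apply: sub_all bE => q /andP[].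
split.
- by move: hH bH; rewrite /hword !map_cat => hH bH; apply: Hword_expansion.
- by move: hA bA; rewrite /aword !map_cat => hA bA; apply: Aword_expansion.
- apply: (@certified_mem (P (expansion r (y, h, a) fr) ++ S)); first by move=> x; rewrite pS.
  have hc' := certified_mem pS1 hc.
  have [E0 [E1 [E2 [E3 [E4 E5]]]]] : (fr <= fr.+1) = true /\ (fr <= fr.+2) = true /\
     (fr <= h) = false /\ (fr <= a) = false /\ (fr.+2 == fr.+1) = false /\ (fr.+1 == fr.+2) = false.
    by split; [|split; [|split; [|split; [|split]]]]; lia.
  (* Both [Some] expansions produce this set of pairs. The label [fr] is a loop by itself, while
     [h], [fr.+1], [fr.+2] and [a] form a chain that extends the loop of the replaced letter. *)
  have case2 : certified ([:: (h, fr.+1); (fr, fr); (fr.+2, fr.+1); (fr.+2, a)] ++ S) k.+1.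
    apply: (certified_step (KH := pred1 fr) (KA := pred1 fr) hc' hb').
    + move=> p; rewrite !inE => /or4P[]/eqP-> /=; split; lia.
    + by exists (fr, fr); rewrite ?inE ?eqxx ?orbT //= leqnn.
    + by exists (h, fr.+1); rewrite ?inE ?eqxx //= E2.
    + move=> gH gA hg.
      have e1 : gH h = gA fr.+1 by apply: (hg (h, fr.+1)); rewrite !inE eqxx.
      have e2 : gH fr.+2 = gA fr.+1 by apply: (hg (fr.+2, fr.+1)); rewrite !inE eqxx !orbT.
      have e3 : gH fr.+2 = gA a by apply: (hg (fr.+2, a)); rewrite !inE eqxx !orbT.
      split; [by rewrite e1 -e2|split].
        move=> p q; rewrite !inE => /or4P[]/eqP-> /or4P[]/eqP->; rewrite /= ?E0 ?E1 ?E2 ?leqnn ?eqxx //= ?e1 ?e2 //; lia.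
      by move=> p; rewrite !inE => /or4P[]/eqP->; rewrite /= ?leqnn ?eqxx //= ?e1 ?e2.
  case: r => [[]|].
  + by apply: certified_mem case2 => p; rewrite /= !inE; do !case: (_ == _).
  + by apply: certified_mem case2 => p; rewrite /= !inE; do !case: (_ == _).
  (* Here the fresh labels together form the new loop, and the old pair [(h, a)] survives. *)
  + apply: (certified_step (KH := xpredT) (KA := xpredT) hc' hb').
    * move=> p; rewrite !inE => /or4P[|||/orP[]]/eqP-> /=; split; lia.
    * by exists (fr, fr); rewrite ?inE ?eqxx ?orbT //= leqnn.
    * by exists (h, a); rewrite ?inE ?eqxx ?orbT //= E2.
    * move=> gH gA hg.
      have e1 : gH fr = gA fr by apply: (hg (fr, fr)); rewrite !inE eqxx.
      have e2 : gH fr = gA fr.+1 by apply: (hg (fr, fr.+1)); rewrite !inE eqxx !orbT.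
      have e3 : gH fr.+2 = gA fr by apply: (hg (fr.+2, fr)); rewrite !inE eqxx !orbT.
      have e4 : gH h = gA a by apply: (hg (h, a)); rewrite !inE eqxx !orbT.
      split=> //; split.
        move=> p q; rewrite !inE => /or4P[|||/orP[]]/eqP-> /or4P[|||/orP[]]/eqP->; rewrite /= ?E0 ?E1 ?E2 ?leqnn //= ?e3 -?e1 //.
      by move=> p; rewrite !inE => /or4P[|||/orP[]]/eqP->; rewrite /= ?leqnn ?E1.
- rewrite (eq_all_r (pS _)) all_cat; apply/andP; split.
    by case: r => [[]|] /=; lia.
  have bS : all (fun p => (p.1 < fr) && (p.2 < fr)) S by case/andP: hb'.
  by apply: sub_all bS => p; lia.
Qed.

(** * The words generated by trees of expansions *)

Inductive code := Leaf | Node of option bool & code & code & code.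

Fixpoint csize (c : code) : nat :=
  if c is Node _ c1 c2 c3 then (csize c1 + csize c2 + csize c3).+1 else 0.

(** Each expansion is allotted a block of four labels, and its subtrees get disjoint consecutive
    ranges after it. *)
Fixpoint gen (c : code) (l : letter) (fr : nat) : seq letter :=
  if c is Node r c1 c2 c3 then
    let: (y, h, a) := l in let x := ~~ y in
    let fr1 := fr + 4 in let fr2 := fr1 + 4 * csize c1 in let fr3 := fr2 + 4 * csize c2 in
    match r with
    | None => (x, fr, fr) :: (x, fr, fr.+1) :: gen c1 (y, h, a) fr1
        ++ gen c2 (x, fr.+2, fr.+1) fr2 ++ gen c3 (x, fr.+2, fr) fr3
    | Some true => (y, h, fr.+1) :: (x, fr, fr) :: gen c1 (y, fr.+2, fr.+1) fr1
        ++ gen c2 (y, fr.+2, a) fr2 ++ gen c3 (x, fr, fr) fr3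
    | Some false => (x, fr, fr) :: gen c1 (y, fr.+2, a) fr1 ++ (y, fr.+2, fr.+1) ::
        gen c2 (x, fr, fr) fr2 ++ gen c3 (y, h, fr.+1) fr3
    end
  else [:: l].

Lemma good_gen c n k u l v fr : u != [::] -> v != [::] -> good n k (u ++ l :: v) fr ->
  good (n + (csize c).*2) (k + csize c) (u ++ gen c l fr ++ v) (fr + 4 * csize c).
Proof.
elim: c n k u l v fr => [|r c1 IH1 c2 IH2 c3 IH3] n k u l v fr nu nv; first by rewrite muln0 !addn0.
move=> /(good_step r nu nv); case: l => -[y h] a hg.
have cu w : u ++ w != [::] by case: (u) nu.
rewrite /= (_ : n + _ = n.+2 + (csize c1).*2 + (csize c2).*2 + (csize c3).*2); last by lia.
rewrite (_ : k + _ = k.+1 + csize c1 + csize c2 + csize c3); last by lia.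
rewrite (_ : fr + 4 * _.+1 = fr + 4 + 4 * csize c1 + 4 * csize c2 + 4 * csize c3); last by lia.
case: r hg => [[]|] /= hg.
- have := IH1 _ _ (u ++ [:: (y, h, fr.+1); (~~ y, fr, fr)]) (y, fr.+2, fr.+1) [:: (y, fr.+2, a), (~~ y, fr, fr) & v] (fr + 4).
  rewrite -!catA /= => /(_ _ _ (cu _) isT hg).
  have := IH2 _ _ (u ++ (y, h, fr.+1) :: (~~ y, fr, fr) :: gen c1 (y, fr.+2, fr.+1) (fr + 4)) (y, fr.+2, a) [:: (~~ y, fr, fr) & v] _.
  rewrite -!catA /= => h2 h1; have := h2 _ _ _ (cu _) isT h1.
  have := IH3 _ _ (u ++ (y, h, fr.+1) :: (~~ y, fr, fr) :: gen c1 (y, fr.+2, fr.+1) (fr + 4) ++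
    gen c2 (y, fr.+2, a) (fr + 4 + 4 * csize c1)) (~~ y, fr, fr) v _.
  rewrite -!catA /= -!catA => h3 h4; have := h3 _ _ _ (cu _) nv h4.
  by rewrite -!catA /= -!catA.
- have := IH1 _ _ (u ++ [:: (~~ y, fr, fr)]) (y, fr.+2, a) [:: (y, fr.+2, fr.+1), (~~ y, fr, fr), (y, h, fr.+1) & v] (fr + 4).
  rewrite -!catA /= => /(_ _ _ (cu _) isT hg).
  have := IH2 _ _ (u ++ (~~ y, fr, fr) :: gen c1 (y, fr.+2, a) (fr + 4) ++ [:: (y, fr.+2, fr.+1)]) (~~ y, fr, fr) [:: (y, h, fr.+1) & v] _.
  rewrite -!catA /= -!catA => h2 h1; have := h2 _ _ _ (cu _) isT h1.
  have := IH3 _ _ (u ++ (~~ y, fr, fr) :: gen c1 (y, fr.+2, a) (fr + 4) ++ (y, fr.+2, fr.+1) ::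
    gen c2 (~~ y, fr, fr) (fr + 4 + 4 * csize c1)) (y, h, fr.+1) v _.
  rewrite -!catA /= -!catA /= => h3 h4; have := h3 _ _ _ (cu _) nv h4.
  by rewrite -!catA /= -!catA.
- have := IH1 _ _ (u ++ [:: (~~ y, fr, fr); (~~ y, fr, fr.+1)]) (y, h, a) [:: (~~ y, fr.+2, fr.+1), (~~ y, fr.+2, fr) & v] (fr + 4).
  rewrite -!catA /= => /(_ _ _ (cu _) isT hg).
  have := IH2 _ _ (u ++ (~~ y, fr, fr) :: (~~ y, fr, fr.+1) :: gen c1 (y, h, a) (fr + 4)) (~~ y, fr.+2, fr.+1) [:: (~~ y, fr.+2, fr) & v] _.
  rewrite -!catA /= => h2 h1; have := h2 _ _ _ (cu _) isT h1.
  have := IH3 _ _ (u ++ (~~ y, fr, fr) :: (~~ y, fr, fr.+1) :: gen c1 (y, h, a) (fr + 4) ++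
    gen c2 (~~ y, fr.+2, fr.+1) (fr + 4 + 4 * csize c1)) (~~ y, fr.+2, fr) v _.
  rewrite -!catA /= -!catA => h3 h4; have := h3 _ _ _ (cu _) nv h4.
  by rewrite -!catA /= -!catA.
Qed.

(** * Reading a tree of expansions back from its word *)

Definition hlabels (E : seq letter) : seq nat := [seq l.1.2 | l <- E].
Definition alabels (E : seq letter) : seq nat := [seq l.2 | l <- E].

(* Whether the partners of the letters come later in the word. *)
Fixpoint types (E : seq letter) : seq (bool * bool * bool) :=
  if E is l :: E' then (l.1.1, l.1.2 \in hlabels E', l.2 \in alabels E') :: types E' else [::].

(* The types of the letters of [gen c (y, h, a) fr], if [h] occurs later      *)
(* exactly when [th] and [a] does not occur later.                              *)
Fixpoint gent (c : code) (y th : bool) : seq (bool * bool * bool) :=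
  if c is Node r c1 c2 c3 then let x := ~~ y in
    match r with
    | None => (x, true, true) :: (x, false, true) :: gent c1 y th ++ gent c2 x true ++ gent c3 x false
    | Some true => (y, th, true) :: (x, true, true) :: gent c1 y true ++ gent c2 y false ++ gent c3 x false
    | Some false => (x, true, true) :: gent c1 y true ++ (y, false, true) :: gent c2 x false ++ gent c3 y th
    end
  else [:: (y, th, false)].

Definition outside (c : code) (fr l : nat) := (l < fr) || (fr + 4 * csize c <= l).

Lemma gen_labels c y h a fr l : h < fr -> a < fr -> outside c fr l ->
  (l \in hlabels (gen c (y, h, a) fr)) = (l == h) /\ (l \in alabels (gen c (y, h, a) fr)) = (l == a).
Proof.
rewrite /outside; elim: c y h a fr => [|r c1 IH1 c2 IH2 c3 IH3] y h a fr hfr afr /= ho; first by rewrite !inE.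
have o1 fr1 : fr1 = fr + 4 -> (l < fr1) || (fr1 + 4 * csize c1 <= l) by lia.
have p2 fr2 : fr2 = fr + 4 + 4 * csize c1 -> (l < fr2) || (fr2 + 4 * csize c2 <= l) by lia.
have p3 fr3 : fr3 = fr + 4 + 4 * csize c1 + 4 * csize c2 -> (l < fr3) || (fr3 + 4 * csize c3 <= l) by lia.
have n0 : (l == fr) = false by lia.
have n1 : (l == fr.+1) = false by lia.
have n2 : (l == fr.+2) = false by lia.
have J1 y' h' a' : h' < fr + 4 -> a' < fr + 4 -> _ := fun g g' => IH1 y' h' a' _ g g' (o1 _ erefl).
have J2 y' h' a' : h' < fr + 4 + 4 * csize c1 -> a' < fr + 4 + 4 * csize c1 -> _ := fun g g' => IH2 y' h' a' _ g g' (p2 _ erefl).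
have J3 y' h' a' : h' < fr + 4 + 4 * csize c1 + 4 * csize c2 -> a' < fr + 4 + 4 * csize c1 + 4 * csize c2 -> _ :=
  fun g g' => IH3 y' h' a' _ g g' (p3 _ erefl).
case: r => [[]|]; rewrite /hlabels /alabels /= ?map_cat /= ?map_cat -!/(hlabels _) -!/(alabels _) !(inE, mem_cat).
- have [|| -> ->] := J1 y fr.+2 fr.+1; try lia.
  have [|| -> ->] := J2 y fr.+2 a; try lia.
  have [|| -> ->] := J3 (~~ y) fr fr; lia.
- have [|| -> ->] := J1 y fr.+2 a; try lia.
  have [|| -> ->] := J2 (~~ y) fr fr; try lia.
  have [|| -> ->] := J3 y h fr.+1; lia.
- have [|| -> ->] := J1 y h a; try lia.
  have [|| -> ->] := J2 (~~ y) fr.+2 fr.+1; try lia.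
  have [|| -> ->] := J3 (~~ y) fr.+2 fr; lia.
Qed.

Definition clean c h a fr (E : seq letter) : Prop := forall l, outside c fr l ->
  (l \in hlabels E) = (l == h) /\ (l \in alabels E) = (l == a).

(** By [gen_labels], a label outside the range of a generated block occurs in it only if it is [h]
    or [a]. The membership tests in [types] can then be settled block by block. *)
Lemma types_gen c y h a fr v : h < fr -> a < fr ->
    (forall l, (l \in hlabels v) || (l \in alabels v) -> outside c fr l) -> a \notin alabels v ->
  types (gen c (y, h, a) fr ++ v) = gent c y (h \in hlabels v) ++ types v.
Proof.
elim: c y h a fr v => [|r c1 IH1 c2 IH2 c3 IH3] y h a fr v hfr afr hv av /=; first by rewrite (negbTE av).
have hcat w1 w2 : hlabels (w1 ++ w2) = hlabels w1 ++ hlabels w2 by exact: map_cat.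
have acat w1 w2 : alabels (w1 ++ w2) = alabels w1 ++ alabels w2 by exact: map_cat.
have hcons w1 x0 h0 a0 : hlabels ((x0, h0, a0) :: w1) = h0 :: hlabels w1 by [].
have acons w1 x0 h0 a0 : alabels ((x0, h0, a0) :: w1) = a0 :: alabels w1 by [].
have hvN l : ~~ outside (Node r c1 c2 c3) fr l -> (l \in hlabels v) = false /\ (l \in alabels v) = false.
  by move=> ho; split; apply/negbTE; apply: contra ho => E; apply: hv; rewrite E ?orbT.
have N k : k < 4 -> (fr + k \in hlabels v) = false /\ (fr + k \in alabels v) = false.
  by move=> hk; apply: hvN; rewrite /outside /=; lia.
have [] := N 0 isT; have [] := N 1 isT; have [] := N 2 isT; rewrite addn0 addn1 addn2 => v2 v2' v1 v1' v0 v0'.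
have [f1 Ef1] : exists f1, f1 = fr + 4 by exists (fr + 4).
have [f2 Ef2] : exists f2, f2 = f1 + 4 * csize c1 by exists (f1 + 4 * csize c1).
have [f3 Ef3] : exists f3, f3 = f2 + 4 * csize c2 by exists (f2 + 4 * csize c2).
rewrite -Ef1 -Ef2 -Ef3.
have avf : (a \in alabels v) = false by exact: negbTE.
have G1 y0 h0 a0 : h0 < f1 -> a0 < f1 -> clean c1 h0 a0 f1 (gen c1 (y0, h0, a0) f1).
  by move=> g g' l; exact: gen_labels.
have G2 y0 h0 a0 : h0 < f1 -> a0 < f1 -> clean c2 h0 a0 f2 (gen c2 (y0, h0, a0) f2).
  by move=> g g' l; apply: gen_labels; lia.
have G3 y0 h0 a0 : h0 < f1 -> a0 < f1 -> clean c3 h0 a0 f3 (gen c3 (y0, h0, a0) f3).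
  by move=> g g' l; apply: gen_labels; lia.
have small l : l < f1 -> [/\ outside c1 f1 l, outside c2 f2 l & outside c3 f3 l].
  by rewrite /outside; split; lia.
have s1 l (hl : l < f1) : outside c1 f1 l by case: (small l hl).
have s2 l (hl : l < f1) : outside c2 f2 l by case: (small l hl).
have s3 l (hl : l < f1) : outside c3 f3 l by case: (small l hl).
have out1 l : ~~ outside c1 f1 l -> [/\ f1 <= l, outside c2 f2 l, outside c3 f3 l & ~~ outside (Node r c1 c2 c3) fr l].
  by rewrite /outside /=; split; lia.
have out2 l : ~~ outside c2 f2 l -> [/\ f1 <= l, outside c3 f3 l & ~~ outside (Node r c1 c2 c3) fr l].
  by rewrite /outside /=; split; lia.
have out3 l : ~~ outside c3 f3 l -> f1 <= l /\ ~~ outside (Node r c1 c2 c3) fr l.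
  by rewrite /outside /=; split; lia.
have lt0 : fr < f1 by lia.
have lt1 : fr.+1 < f1 by lia.
have lt2 : fr.+2 < f1 by lia.
have lth : h < f1 by lia.
have lta : a < f1 by lia.
have i2 l : l < f1 -> l < f2 by lia.
have i3 l : l < f1 -> l < f3 by lia.
clear Ef1 Ef2 Ef3 small N.
case: r hv hvN out1 out2 out3 => [[]|] hv hvN out1 out2 out3; rewrite /= -?catA /= -?catA.
- have := G1 y _ _ lt2 lt1; have := G2 y _ _ lt2 lta; have := G3 (~~ y) _ _ lt0 lt0.
  have := fun w => IH1 y _ _ f1 w lt2 lt1; have := fun w => IH2 y _ _ f2 w (i2 _ lt2) (i2 _ lta).
  have := fun w => IH3 (~~ y) _ _ f3 w (i3 _ lt0) (i3 _ lt0).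
  set g1 := gen c1 _ _; set g2 := gen c2 _ _; set g3 := gen c3 _ _ => I3 I2 I1 m3 m2 m1.
  have p1 l (g : l < f1) := m1 l (s1 l g).
  have p2 l (g : l < f1) := m2 l (s2 l g).
  have p3 l (g : l < f1) := m3 l (s3 l g).
  have q1 l (g : l < f1) := proj1 (p1 l g); have q1' l (g : l < f1) := proj2 (p1 l g).
  have q2 l (g : l < f1) := proj1 (p2 l g); have q2' l (g : l < f1) := proj2 (p2 l g).
  have q3 l (g : l < f1) := proj1 (p3 l g); have q3' l (g : l < f1) := proj2 (p3 l g).
  have o1 l : (l \in hlabels (g2 ++ g3 ++ v)) || (l \in alabels (g2 ++ g3 ++ v)) -> outside c1 f1 l.
    apply: contraTT => /out1[g o2 o3 o]; rewrite ?hcons ?acons ?inE !hcat !acat !mem_cat.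
    by have [-> ->] := m2 _ o2; have [-> ->] := m3 _ o3; have [-> ->] := hvN _ o; lia.
  have o2 l : (l \in hlabels (g3 ++ v)) || (l \in alabels (g3 ++ v)) -> outside c2 f2 l.
    apply: contraTT => /out2[g o3 o]; rewrite !hcat !acat !mem_cat.
    by have [-> ->] := m3 _ o3; have [-> ->] := hvN _ o; lia.
  have o3 l : (l \in hlabels v) || (l \in alabels v) -> outside c3 f3 l.
    by apply: contraTT => /out3[g o]; have [-> ->] := hvN _ o.
  rewrite (I1 _ o1) ?(I2 _ o2) ?(I3 _ o3) /=.
  + by congr [:: (_, _, _), (_, _, _) & gent _ _ _ ++ gent _ _ _ ++ gent _ _ _ ++ _]; rewrite ?hcons ?acons ?inE ?hcat ?acat ?mem_cat ?hcons ?acons ?inE ?hcat ?acat ?mem_cat ?q1 ?q1' ?q2 ?q2' ?q3 ?q3' ?v0 ?v0' ?v1 ?v1' ?v2 ?v2' ?avf //; do ?case: (_ \in _); lia.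
  + by rewrite ?hcons ?acons ?inE ?hcat ?acat ?mem_cat ?hcons ?acons ?inE ?hcat ?acat ?mem_cat ?q1 ?q1' ?q2 ?q2' ?q3 ?q3' ?v0 ?v0' ?v1 ?v1' ?v2 ?v2' ?avf //; do ?case: (_ \in _); lia.
  + by rewrite ?hcons ?acons ?inE ?hcat ?acat ?mem_cat ?hcons ?acons ?inE ?hcat ?acat ?mem_cat ?q1 ?q1' ?q2 ?q2' ?q3 ?q3' ?v0 ?v0' ?v1 ?v1' ?v2 ?v2' ?avf //; do ?case: (_ \in _); lia.
  + by rewrite ?hcons ?acons ?inE ?hcat ?acat ?mem_cat ?hcons ?acons ?inE ?hcat ?acat ?mem_cat ?q1 ?q1' ?q2 ?q2' ?q3 ?q3' ?v0 ?v0' ?v1 ?v1' ?v2 ?v2' ?avf //; do ?case: (_ \in _); lia.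
- have := G1 y _ _ lt2 lta; have := G2 (~~ y) _ _ lt0 lt0; have := G3 y _ _ lth lt1.
  have := fun w => IH1 y _ _ f1 w lt2 lta; have := fun w => IH2 (~~ y) _ _ f2 w (i2 _ lt0) (i2 _ lt0).
  have := fun w => IH3 y _ _ f3 w (i3 _ lth) (i3 _ lt1).
  set g1 := gen c1 _ _; set g2 := gen c2 _ _; set g3 := gen c3 _ _ => I3 I2 I1 m3 m2 m1.
  have p1 l (g : l < f1) := m1 l (s1 l g).
  have p2 l (g : l < f1) := m2 l (s2 l g).
  have p3 l (g : l < f1) := m3 l (s3 l g).
  have q1 l (g : l < f1) := proj1 (p1 l g); have q1' l (g : l < f1) := proj2 (p1 l g).
  have q2 l (g : l < f1) := proj1 (p2 l g); have q2' l (g : l < f1) := proj2 (p2 l g).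
  have q3 l (g : l < f1) := proj1 (p3 l g); have q3' l (g : l < f1) := proj2 (p3 l g).
  have o1 l : (l \in hlabels ((y, fr.+2, fr.+1) :: g2 ++ g3 ++ v)) || (l \in alabels ((y, fr.+2, fr.+1) :: g2 ++ g3 ++ v)) -> outside c1 f1 l.
    apply: contraTT => /out1[g o2 o3 o]; rewrite ?hcons ?acons ?inE !hcat !acat !mem_cat.
    by have [-> ->] := m2 _ o2; have [-> ->] := m3 _ o3; have [-> ->] := hvN _ o; lia.
  have o2 l : (l \in hlabels (g3 ++ v)) || (l \in alabels (g3 ++ v)) -> outside c2 f2 l.
    apply: contraTT => /out2[g o3 o]; rewrite !hcat !acat !mem_cat.
    by have [-> ->] := m3 _ o3; have [-> ->] := hvN _ o; lia.
  have o3 l : (l \in hlabels v) || (l \in alabels v) -> outside c3 f3 l.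
    by apply: contraTT => /out3[g o]; have [-> ->] := hvN _ o.
  rewrite (I1 _ o1) /= ?(I2 _ o2) ?(I3 _ o3) /=.
  + by congr [:: (_, _, _) & gent _ _ _ ++ (_, _, _) :: gent _ _ _ ++ gent _ _ _ ++ _]; rewrite ?hcons ?acons ?inE ?hcat ?acat ?mem_cat ?hcons ?acons ?inE ?hcat ?acat ?mem_cat ?q1 ?q1' ?q2 ?q2' ?q3 ?q3' ?v0 ?v0' ?v1 ?v1' ?v2 ?v2' ?avf //; do ?case: (_ \in _); lia.
  + by rewrite ?hcons ?acons ?inE ?hcat ?acat ?mem_cat ?hcons ?acons ?inE ?hcat ?acat ?mem_cat ?q1 ?q1' ?q2 ?q2' ?q3 ?q3' ?v0 ?v0' ?v1 ?v1' ?v2 ?v2' ?avf //; do ?case: (_ \in _); lia.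
  + by rewrite ?hcons ?acons ?inE ?hcat ?acat ?mem_cat ?hcons ?acons ?inE ?hcat ?acat ?mem_cat ?q1 ?q1' ?q2 ?q2' ?q3 ?q3' ?v0 ?v0' ?v1 ?v1' ?v2 ?v2' ?avf //; do ?case: (_ \in _); lia.
  + by rewrite ?hcons ?acons ?inE ?hcat ?acat ?mem_cat ?hcons ?acons ?inE ?hcat ?acat ?mem_cat ?q1 ?q1' ?q2 ?q2' ?q3 ?q3' ?v0 ?v0' ?v1 ?v1' ?v2 ?v2' ?avf //; do ?case: (_ \in _); lia.
- have := G1 y _ _ lth lta; have := G2 (~~ y) _ _ lt2 lt1; have := G3 (~~ y) _ _ lt2 lt0.
  have := fun w => IH1 y _ _ f1 w lth lta; have := fun w => IH2 (~~ y) _ _ f2 w (i2 _ lt2) (i2 _ lt1).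
  have := fun w => IH3 (~~ y) _ _ f3 w (i3 _ lt2) (i3 _ lt0).
  set g1 := gen c1 _ _; set g2 := gen c2 _ _; set g3 := gen c3 _ _ => I3 I2 I1 m3 m2 m1.
  have p1 l (g : l < f1) := m1 l (s1 l g).
  have p2 l (g : l < f1) := m2 l (s2 l g).
  have p3 l (g : l < f1) := m3 l (s3 l g).
  have q1 l (g : l < f1) := proj1 (p1 l g); have q1' l (g : l < f1) := proj2 (p1 l g).
  have q2 l (g : l < f1) := proj1 (p2 l g); have q2' l (g : l < f1) := proj2 (p2 l g).
  have q3 l (g : l < f1) := proj1 (p3 l g); have q3' l (g : l < f1) := proj2 (p3 l g).
  have o1 l : (l \in hlabels (g2 ++ g3 ++ v)) || (l \in alabels (g2 ++ g3 ++ v)) -> outside c1 f1 l.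
    apply: contraTT => /out1[g o2 o3 o]; rewrite ?hcons ?acons ?inE !hcat !acat !mem_cat.
    by have [-> ->] := m2 _ o2; have [-> ->] := m3 _ o3; have [-> ->] := hvN _ o; lia.
  have o2 l : (l \in hlabels (g3 ++ v)) || (l \in alabels (g3 ++ v)) -> outside c2 f2 l.
    apply: contraTT => /out2[g o3 o]; rewrite !hcat !acat !mem_cat.
    by have [-> ->] := m3 _ o3; have [-> ->] := hvN _ o; lia.
  have o3 l : (l \in hlabels v) || (l \in alabels v) -> outside c3 f3 l.
    by apply: contraTT => /out3[g o]; have [-> ->] := hvN _ o.
  rewrite (I1 _ o1) ?(I2 _ o2) ?(I3 _ o3) /=.
  + by congr [:: (_, _, _), (_, _, _) & gent _ _ _ ++ gent _ _ _ ++ gent _ _ _ ++ _]; rewrite ?hcons ?acons ?inE ?hcat ?acat ?mem_cat ?hcons ?acons ?inE ?hcat ?acat ?mem_cat ?q1 ?q1' ?q2 ?q2' ?q3 ?q3' ?v0 ?v0' ?v1 ?v1' ?v2 ?v2' ?avf //; do ?case: (_ \in _); lia.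
  + by rewrite ?hcons ?acons ?inE ?hcat ?acat ?mem_cat ?hcons ?acons ?inE ?hcat ?acat ?mem_cat ?q1 ?q1' ?q2 ?q2' ?q3 ?q3' ?v0 ?v0' ?v1 ?v1' ?v2 ?v2' ?avf //; do ?case: (_ \in _); lia.
  + by rewrite ?hcons ?acons ?inE ?hcat ?acat ?mem_cat ?hcons ?acons ?inE ?hcat ?acat ?mem_cat ?q1 ?q1' ?q2 ?q2' ?q3 ?q3' ?v0 ?v0' ?v1 ?v1' ?v2 ?v2' ?avf //; do ?case: (_ \in _); lia.
  + by rewrite ?hcons ?acons ?inE ?hcat ?acat ?mem_cat ?hcons ?acons ?inE ?hcat ?acat ?mem_cat ?q1 ?q1' ?q2 ?q2' ?q3 ?q3' ?v0 ?v0' ?v1 ?v1' ?v2 ?v2' ?avf //; do ?case: (_ \in _); lia.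
Qed.

(** A prefix code: the last component of the first type is [false] for a leaf and [true] for a node.
    Among nodes, the boundary of the first letter isolates [Some true], and the second type
    separates [None] from [Some false], by [nh]. *)
Lemma gent_prefix c c' y th s s' : gent c y th ++ s = gent c' y th ++ s' -> c = c' /\ s = s'.
Proof.
have nh d y0 w w' : gent d y0 true ++ w <> (~~ y0, false, true) :: w'.
  by case: d => [|[[]|] d1 d2 d3] /= [] //; case: y0.
elim: c c' y th s s' => [|r c1 IH1 c2 IH2 c3 IH3] [|r' c1' c2' c3'] y th s s' /=.
- by case.
- by case: r' => [[]|] /= []; case: y.
- by case: r => [[]|] /= []; case: y.
case: r => [[]|]; case: r' => [[]|] /=; rewrite -?catA /= -?catA.
- by case=> /IH1[<- /IH2[<- /IH3[<- <-]]].
- by case; case: y.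
- by case; case: y.
- by case; case: y.
- by case=> /IH1[<- [/IH2[<- /IH3[<- <-]]]].
- by case=> /nh.
- by case; case: y.
- by case=> /esym/nh.
- by case=> /IH1[<- /IH2[<- /IH3[<- <-]]].
Qed.

(** * The meander attached to a code *)

(** The starting word. Both partners of its letter [(true, 2, 2)] to be expanded precede it, and its
    last letter is fixed, as [meander_words_inj] requires. *)
Definition word_left : seq letter := [:: (true, 1, 1); (true, 2, 2); (false, 3, 0); (false, 3, 4)].
Definition word_right : seq letter := [:: (false, 0, 4)].

Definition word (c : code) : seq letter := word_left ++ gen c (true, 2, 2) 5 ++ word_right.

Lemma good_base : good 4 3 (word_left ++ (true, 2, 2) :: word_right) 5.
Proof.
split=> //.
- have h1 := @Hword_insert 0 1 2 [::] (true, 1) (false, 0) [::] true 2 (Hword_base 0 1) isT.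
  exact: (@Hword_insert 0 1 3 [:: (true, 1)] (true, 2) (true, 2) [:: (false, 0)] false 3 h1 isT).
- have h1 := @Aword_insert 0 1 2 [:: (true, 1)] false 0 [::] 2 (Aword_base 0 1) isT.
  exact: (@Aword_insert 0 1 3 [:: (true, 1); (true, 2); (false, 0)] true 2 [::] 4 h1 isT).
(* Three loops: the hierarchical label 3 and the Apollonian label 4 belong to the loop of the label
   0. *)
exists (fun l => nth 0 [:: 0; 1; 2; 0] l), (fun l => nth 0 [:: 0; 1; 2; 0; 0] l); split=> //.
  by move=> p; rewrite !inE => /or4P[/eqP->|/eqP->|/eqP->|/or4P[/eqP->|/eqP->|/eqP->|/orP[]/eqP->]].
move=> gH gA hg.
have e0 : gH 0 = gA 0 by apply: (hg (0, 0)).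
have e1 : gH 3 = gA 0 by apply: (hg (3, 0)).
have e2 : gH 3 = gA 4 by apply: (hg (3, 4)).
move=> p q; rewrite !inE => /or4P[/eqP->|/eqP->|/eqP->|/or4P[/eqP->|/eqP->|/eqP->|/orP[]/eqP->]];
  move=> /or4P[/eqP->|/eqP->|/eqP->|/or4P[/eqP->|/eqP->|/eqP->|/orP[]/eqP->]] //=; by rewrite ?e0 ?e1.
Qed.

Lemma good_word c : good (4 + (csize c).*2) (3 + csize c) (word c) (5 + 4 * csize c).
Proof. exact: good_gen good_base. Qed.

(** Types depend on equality of labels only. *)
Lemma types_relabel (phi psi : nat -> nat) E E' :
    {in map snd (hword E) &, injective phi} -> {in map snd (aword E) &, injective psi} ->
    hword E' = [seq (p.1, phi p.2) | p <- hword E] -> aword E' = [seq (p.1, psi p.2) | p <- aword E] ->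
  types E' = types E.
Proof.
have hE F : map snd (hword F) = hlabels F by rewrite -map_comp.
have aE F : map snd (aword F) = alabels F by rewrite -map_comp.
elim: E E' => [|[[x h] a] E IH] [|[[x' h'] a'] E'] //= hphi hpsi [-> -> eH] [-> eA].
rewrite (IH E') //; first last.
- by move=> p q hp hq; apply: hpsi; rewrite inE ?hp ?hq orbT.
- by move=> p q hp hq; apply: hphi; rewrite inE ?hp ?hq orbT.
have e1 : hlabels E' = map phi (hlabels E) by rewrite -hE eH -hE -!map_comp.
have e2 : alabels E' = map psi (alabels E) by rewrite -aE eA -aE -!map_comp.
congr ((_, _, _) :: _).
  rewrite e1; apply/mapP/idP => [[l hl /hphi ->//]|hl]; last by exists h.
    by rewrite inE eqxx.
  by rewrite inE hE hl orbT.
rewrite e2; apply/mapP/idP => [[l hl /hpsi ->//]|hl]; last by exists a.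
  by rewrite inE eqxx.
by rewrite inE aE hl orbT.
Qed.

Lemma types_word c : drop 4 (types (word c)) = gent c true false ++ types word_right.
Proof.
rewrite /word /word_left /= drop0 types_gen //.
by move=> l; rewrite /= !inE /outside => /orP[]/eqP->.
Qed.

Lemma zip_qlab E : zip (qlab (hword E) 0 1) (qlab (aword E) 0 1) =i label_pairs E.
Proof.
have hz (p : pred bool) : zip [seq q.2 | q <- hword E & p q.1] [seq q.2 | q <- aword E & p q.1] =
    [seq (l.1.2, l.2) | l <- E & p l.1.1].
  by rewrite /hword /aword !filter_map -!map_comp; elim: E => //= l E IH; case: ifP => _ //=; rewrite IH.
have sz (p : pred bool) : size [seq q.2 | q <- hword E & p q.1] = size [seq q.2 | q <- aword E & p q.1].
  by apply: size_letters; rewrite /hword /aword -!map_comp.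
have h1 := hz negb; have h2 := hz id; have s1 := sz negb; have s2 := sz id.
move=> x; rewrite /qlab /= zip_cat // h1 /= -rev_zip // h2.
rewrite /label_pairs !inE mem_cat inE mem_rev -[in RHS](perm_mem (perm_map _ (permEl (perm_filterC (fun l : letter => l.1.1) E)))).
rewrite map_cat mem_cat; congr (_ || _); rewrite orbCA; congr (_ || _).
by rewrite orbC.
Qed.

Definition code_meander (k : nat) (c : code) p : Prop :=
  [/\ meander_set (4 + k.*2) p, loops p.1.2 p.2 = 3 + k &
      meander_words 0 1 (hword (word c)) (aword (word c)) p].

Lemma code_meander_ex k c : csize c = k -> exists p, @code_meander k c p.
Proof.
have ne01 : 0 != 1 by [].
move=> <-; have [hH hA hc _] := good_word c.
have E : map fst (hword (word c)) = map fst (aword (word c)) by rewrite -!map_comp.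
have [p [h1 h2]] := meander_of_words ne01 hH hA E.
exists p; split=> //; have [sH _] := Hword_size ne01 hH.
case: h2 => j [M [r [es [z [_ _ _ pH pA]]]]].
have sA : size (aword (word c)) = size (hword (word c)) by rewrite !size_map.
have [cH [cA [c1 c2 <-]]] := hc.
have zE := zip_qlab (word c).
rewrite (@loops_colours _ (qlab (hword (word c)) 0 1) (qlab (aword (word c)) 0 1) _ _ cH cA) ?size_qlab ?sA //.
- rewrite -(@unzip1_zip _ _ (qlab (hword (word c)) 0 1) (qlab (aword (word c)) 0 1)); last by rewrite !size_qlab sA.
  rewrite /unzip1 -map_comp; apply: size_undup_mem; exact: eq_mem_map.
- by apply/allP=> q; rewrite zE => /c1/eqP.
- move=> gH gA /allP hg l l' hl hl' El.
  have mem x : x \in qlab (hword (word c)) 0 1 -> exists2 q, q \in label_pairs (word c) & x = q.1.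
    rewrite -(@unzip1_zip _ _ (qlab (hword (word c)) 0 1) (qlab (aword (word c)) 0 1)); last by rewrite !size_qlab sA.
    by case/mapP=> q hq ->; exists q; rewrite -?zE.
  have [q hq eq] := mem _ hl; have [q' hq' eq'] := mem _ hl'; subst l l'.
  apply: (c2 gH gA) => // x; rewrite -zE => /hg/eqP //.
Qed.

(** The meander determines both words up to renaming, hence the types, hence the code. *)
Lemma code_meander_inj k c c' p : @code_meander k c p -> code_meander c' p -> csize c = k -> csize c' = k -> c = c'.
Proof.
have ne01 : 0 != 1 by [].
move=> [_ _ h] [_ _ h'] sc sc'.
have [hH _ _ _] := good_word c; have [hH' _ _ _] := good_word c'.
have [sH _] := Hword_size ne01 hH; have [sH' _] := Hword_size ne01 hH'.
rewrite sc in sH; rewrite sc' in sH'.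
have E e : map fst (hword (word e)) = map fst (aword (word e)) by rewrite -!map_comp.
have L e : last false (map fst (hword (word e))) = false.
  by rewrite /word /word_right /hword !map_cat !last_cat.
have [|[phi i1 e1] [psi i2 e2]] := meander_words_inj sH sH' (E c) (E c') _ h h'.
  by rewrite !L.
have := types_relabel i1 i2 e1 e2 => /(congr1 (drop 4)).
by rewrite !types_word => /gent_prefix[].
Qed.

(** * The generating function of codes and the lower bound *)

HB.instance Definition _ := gen_eqMixin code.

Definition nodes (C : seq code) : seq code :=
  [seq Node r p.1.1 p.1.2 p.2 | r <- [:: None; Some true; Some false],
     p <- [seq (q, c) | q <- [seq (a, b) | a <- C, b <- C], c <- C]].

(** The codes of height at most [h], whose weighted sums are the iterates of [S -> 1 + 3 q S^3]. *)
Fixpoint codes (h : nat) : seq code := if h is h'.+1 then Leaf :: nodes (codes h') else [:: Leaf].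

Lemma codesS h : codes h.+1 = Leaf :: nodes (codes h).
Proof. by []. Qed.

Lemma codes_uniq h : uniq (codes h).
Proof.
elim: h => // h IH; rewrite codesS cons_uniq; apply/andP; split.
  by apply/negP=> /allpairsP[p []].
apply: allpairs_uniq => //.
  apply: allpairs_uniq => //; first by apply: allpairs_uniq => // -[a b] [a' b'].
  by move=> [a b] [a' b'].
by move=> [r [[a b] c]] [r' [[a' b'] c']] _ _ /= [-> -> -> ->].
Qed.

Section LowerBound.
Local Open Scope ring_scope.
Variables (R : realType) (x : R).
Hypothesis x0 : 0 < x.

Lemma sum_codes h (q : R) : \sum_(c <- codes h.+1) q ^+ csize c =
  1 + 3 * q * (\sum_(c <- codes h) q ^+ csize c) ^+ 3.
Proof.
rewrite codesS big_cons expr0; congr (_ + _); rewrite big_allpairs_dep.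
set S := \sum_(c <- codes h) _.
have E (r : option bool) : \sum_(p <- [seq (a, c) | a <- [seq (a, b) | a <- codes h, b <- codes h], c <- codes h])
    q ^+ csize (Node r p.1.1 p.1.2 p.2) = q * S ^+ 3.
  rewrite big_allpairs big_allpairs !exprS expr0 mulr1 /S mulr_suml mulr_sumr.
  apply: eq_bigr => a _; rewrite mulr_suml mulr_sumr mulr_sumr.
  apply: eq_bigr => b _; rewrite mulr_sumr mulr_sumr mulr_sumr.
  by apply: eq_bigr => c _; rewrite /= exprS !exprD !mulrA.
by rewrite !big_cons big_nil !E /=; ring.
Qed.

(** As [1 + (4/27) S^3 - S = (4/27) (S - 3/2)^2 (S + 3)] is nonnegative, each iteration increases
    the sum by at least [3 (q - 4/81) S^3], and [S] is at least 1. *)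
Lemma sum_codes_ge h (q : R) : 4 / 81 < q ->
  1 + h%:R * (3 * (q - 4 / 81)) <= \sum_(c <- codes h) q ^+ csize c.
Proof.
move=> hq; elim: h => [|h IH]; first by rewrite mul0r addr0 big_seq1.
rewrite sum_codes; set S := \sum_(c <- codes h) _ in IH *.
set d := 3 * (q - 4 / 81).
have d0 : 0 < d by rewrite /d; lra.
have S1 : 1 <= S by apply: le_trans IH; rewrite lerDl mulr_ge0 // ltW.
have S3 : 1 <= S ^+ 3 by rewrite exprn_ege1.
have e : 3 * q * S ^+ 3 = d * S ^+ 3 + 4 / 27 * S ^+ 3 by rewrite /d; field.
have h1 : d <= d * S ^+ 3 by rewrite ler_peMr // ltW.
have h2 : 0 <= 4 / 27 * ((S - 3 / 2) ^+ 2 * (S + 3)).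
  have S0 : 0 <= S + 3 by lra.
  by apply: mulr_ge0; [lra|apply: mulr_ge0 => //; exact: sqr_ge0].
have h3 : 4 / 27 * ((S - 3 / 2) ^+ 2 * (S + 3)) = 1 + 4 / 27 * S ^+ 3 - S by field.
by rewrite e -natr1 mulrDl mul1r; rewrite h3 in h2; rewrite -/d in IH; lra.
Qed.

(** Distinct codes with [k] nodes give distinct meanders, each with [3 + k] loops. *)
Lemma size_codes_le k (cs : seq code) : uniq cs -> {in cs, forall c, csize c = k} ->
  (size cs)%:R * x ^+ (3 + k) <= meander_coef x (4 + k.*2).
Proof.
move=> us hs.
have fin : finite_set (meander_set (4 + k.*2)) by apply: finite_meanders.
have /choice[f hf] : forall c, exists p : set numbered_rmap * {perm 'I_(4 + k.*2).*2} * {perm 'I_(4 + k.*2).*2},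
    csize c = k -> code_meander c p.
  move=> c; have [/code_meander_ex[p hp]|ne] := eqVneq (csize c) k; first by exists p.
  (* A placeholder for codes of another size. *)
  by exists (classical_sets.set0, 1%g, 1%g) => /eqP; rewrite (negbTE ne).
have ui : uniq (map f cs).
  rewrite map_inj_in_uniq // => c c' /hs hc /hs hc' E.
  by have := hf c hc; rewrite E => h1; exact: (code_meander_inj h1 (hf c' hc')).
have sub : {subset map f cs <= fset_set (meander_set (4 + k.*2))}.
  by move=> _ /mapP[c /hs hc ->]; rewrite in_fset_set //; apply/mem_set; case: (hf c hc).
have -> : meander_coef x (4 + k.*2) = meander_poly (4 + k.*2) x by [].
rewrite /meander_poly fsbig_finite //.
set F := fset_set _ in sub *.
apply: (@le_trans _ _ (\sum_(p <- map f cs) x ^+ loops p.1.2 p.2)).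
  rewrite big_map big_seq (eq_bigr (fun=> x ^+ (3 + k))); last first.
    by move=> c /hs hc; case: (hf c hc) => _ ->.
  by rewrite -big_seq big_const_seq count_predT iter_addr_0 mulr_natl.
apply: (@le_trans _ _ (\sum_(p <- F | p \in map f cs) x ^+ loops p.1.2 p.2)); last first.
  rewrite [leRHS](bigID (fun p => p \in map f cs)) /= lerDl.
  by apply: sumr_ge0 => p _; exact: exprn_ge0 (ltW x0).
have hp : perm_eq [seq p <- F | p \in map f cs] (map f cs).
  apply: uniq_perm => //; first by rewrite filter_uniq // finmap.fset_uniq.
  by move=> p; rewrite mem_filter; case: (boolP (p \in map f cs)) => // /sub ->.
by rewrite -[leRHS]big_filter [leRHS](perm_big _ hp).
Qed.

(** Codes are grouped by their number [k] of nodes and compared with the coefficient of index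
    [4 + 2k]. *)
Lemma codes_le_series h (r : R) : 0 < r -> exists N,
  x ^+ 3 * r ^+ 4 * \sum_(c <- codes h) (r ^+ 2 * x) ^+ csize c <= \sum_(n < N) meander_coef x n * r ^+ n.
Proof.
move=> r0; pose K := (\sum_(c <- codes h) csize c).+1%N.
have hK c : c \in codes h -> (csize c < K)%N.
  by move=> hc; rewrite ltnS (big_rem c) //= leq_addr.
have t0 n : 0 <= meander_coef x n * r ^+ n by rewrite mulr_ge0 ?meander_coef_ge0 ?exprn_ge0 // ltW.
exists (4 + K.*2)%N.
apply: (@le_trans _ _ (\sum_(k < K) meander_coef x (4 + k.*2) * r ^+ (4 + k.*2))); last first.
  elim: K {hK} => [|k IH]; first by rewrite big_ord0 sumr_ge0.
  rewrite big_ord_recr doubleS !addnS 2!big_ord_recr.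
  have := t0 (4 + k.*2).+1; move: IH => /=; lra.
have -> : x ^+ 3 * r ^+ 4 * \sum_(c <- codes h) (r ^+ 2 * x) ^+ csize c =
    \sum_(k < K) \sum_(c <- codes h | csize c == k) x ^+ (3 + k) * r ^+ (4 + k.*2).
  rewrite (exchange_big_dep xpredT) //= mulr_sumr big_seq [RHS]big_seq.
  apply: eq_bigr => c hc; rewrite (big_pred1 (Ordinal (hK c hc))) /=; last first.
    by move=> i /=; rewrite -[RHS]val_eqE /= eq_sym.
  rewrite exprMn -exprM mul2n [x ^+ (3 + _)]exprD [r ^+ (4 + _)]exprD.
  by rewrite [r ^+ (csize c).*2 * _]mulrC mulrACA.
apply: ler_sum => k _; rewrite -big_filter big_const_seq count_predT iter_addr_0 -[leLHS]mulr_natl mulrA.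
apply: ler_wpM2r; first by rewrite exprn_ge0 // ltW.
apply: size_codes_le; first by rewrite filter_uniq // codes_uniq.
by move=> c; rewrite mem_filter => /andP[/eqP].
Qed.

(** Since [K^2 = (81/4) x], any [r > K^-1] has [r^2 x > 4/81]. Convergence at some [|z| > K^-1]
    would bound the partial sums at an [r] strictly in between, and with them the sums over codes,
    which are unbounded. *)
Lemma inv_radius_meander_ge :
  ((9 / 2 * Num.sqrt x)%:E <= (radius_of_convergence (meander_coef x))^-1)%E.
Proof.
have s0 : 0 < Num.sqrt x by rewrite sqrtr_gt0.
have ss : Num.sqrt x ^+ 2 = x by rewrite sqr_sqrtr // ltW.
set K := 9 / 2 * Num.sqrt x.
have K0 : 0 < K by rewrite /K; lra.
have Ki : 0 < K^-1 by rewrite invr_gt0.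
apply: inv_radius_ge => // z hz; rewrite leNgt; apply/negP => hlt.
have [B /= B0 hB] : exists2 B, 0 < B & forall n, `|meander_coef x n * z ^+ n| <= B.
  have /cvg_series_bounded/ex_strict_bound_gt0[B B0 h] := hz.
  by exists B => // n; apply: ltW; exact: h.
pose r := (`|z| + K^-1) / 2.
have z0 : 0 < `|z| by exact: lt_trans Ki hlt.
have r0 : 0 < r by rewrite /r; lra.
have rz : r < `|z| by rewrite /r; lra.
have rK : K^-1 < r by rewrite /r; lra.
pose q := r / `|z|.
have q0 : 0 < q by rewrite divr_gt0.
have q1 : q < 1 by rewrite ltr_pdivrMr // mul1r.
have bound N : \sum_(n < N) meander_coef x n * r ^+ n <= B / (1 - q).
  have q1' : `|q| < 1 by rewrite gtr0_norm.
  apply: le_trans (geometric_le_lim N (ltW B0) q0 q1').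
  rewrite /series /= big_mkord; apply: ler_sum => n _.
  have -> : r = q * `|z| by rewrite /q divfK // gt_eqF.
  rewrite /geometric /= exprMn mulrCA mulrC; apply: ler_wpM2r; first by rewrite exprn_ge0 // ltW.
  by have := hB n; rewrite normrM normrX ger0_norm // meander_coef_ge0.
have hq : 4 / 81 < r ^+ 2 * x.
  have h1 : 1 < r * K by rewrite -ltr_pdivrMr // div1r.
  have h2 : 1 < (r * K) ^+ 2 by rewrite exprn_egt1.
  have h3 : (r * K) ^+ 2 = 81 / 4 * (r ^+ 2 * x) by rewrite -[in RHS]ss /K; field.
  by rewrite h3 in h2; lra.
pose d := 3 * (r ^+ 2 * x - 4 / 81).
have d0 : 0 < d by rewrite /d; lra.
pose A := x ^+ 3 * r ^+ 4.
have A0 : 0 < A by rewrite mulr_gt0 // exprn_gt0.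
pose C := B / (1 - q) / A / d.
have C0 : 0 <= C.
  by rewrite /C !divr_ge0 ?(ltW A0) ?(ltW d0) ?(ltW B0) // subr_ge0 ltW.
pose h := Num.bound C.
have hh : C < h%:R by exact: archi_boundP.
have [N hN] := codes_le_series h r0.
have := le_trans hN (bound N); rewrite -/A mulrC -ler_pdivlMr // => h4.
have := le_trans (sum_codes_ge h hq) h4; rewrite -/d.
have : C * d < h%:R * d by rewrite ltr_pM2r.
by rewrite {1}/C divfK ?gt_eqF //; lra.
Qed.

End LowerBound.

Local Open Scope ring_scope.

(* On [\bar R], [0^-1 = +oo] and [+oo^-1 = 0]. *)
Theorem mainTheorem7 (R : realType) (x : R) :
  0 < x ->
  ((9 / 2 * Num.sqrt x)%:E <= (radius_of_convergence (meander_coef x))^-1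
   <= (48 * Num.max 1 x)%:E)%E.
Proof. by move=> x0; rewrite inv_radius_meander_ge // inv_radius_meander_le. Qed.
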